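(* Let $N\ge 3$, let $G$ be a cocompact Kleinian group acting on $\partial\mathbb{H}^N$, and let $f$ be a $C^2$ diffeomorphism of $\partial\mathbb{H}^N$ with a fixed point $x_0$ which is not a fixed point of any non-identity element of $G$. Suppose that $Df(x_0)$ is conjugate (by an invertible linear map) to a conformal linear map $\lambda O$ with $O$ orthogonal, $\lambda>0$ and $\lambda\neq 1$. Then the closed subgroup $\overline{\langle G,f\rangle}$ of $\mathrm{Homeo}(\partial\mathbb{H}^N)$ contains a non-trivial one-parameter subgroup $(f_t)_{t\in\mathbb{R}}$ which is conformally conjugate to a flow of affine linear maps, i.e. there is a conformal map $\phi$ of $\partial\mathbb{H}^N$ such that $(\phi f_t\phi^{-1})_{t\in\mathbb{R}}$ is a one-parameter group of invertible real affine maps of $\mathbb{R}^{N-1}$ (extended by fixing $\infty$).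
   Context: Upper half-space model: $\mathbb{H}^N=\{(x,t): x\in\mathbb{R}^{N-1}, t>0\}$, with boundary $\partial\mathbb{H}^N=\mathbb{R}^{N-1}\cup\{\infty\}$, a smooth sphere. A Kleinian group is a discrete group of isometries of $\mathbb{H}^N$; it is cocompact if it acts cocompactly on $\mathbb{H}^N$. It acts on $\partial\mathbb{H}^N$ by conformal maps. A conformal map of $\partial\mathbb{H}^N$ means a M\''obius transformation (boundary value of an isometry of $\mathbb{H}^N$, orientation-preserving or not). $\mathrm{Homeo}(\partial\mathbb{H}^N)$ is the group of homeomorphisms of $\partial\mathbb{H}^N$ with the topology of uniform convergence, and $\overline{\langle G,f\rangle}$ is the closure in it of the subgroup generated by $G$ and $f$. A one-parameter subgroup is a continuous homomorphism $t\mapsto f_t$ from $\mathbb{R}$; it is non-trivial if some $f_t\neq\mathrm{id}$. *)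

(* Defs.v *)
From HB Require Import structures.
From mathcomp Require Import all_boot all_order all_algebra.
From mathcomp Require Import all_classical all_reals all_analysis.
Import Order.TTheory GRing.Theory Num.Theory.
Import numFieldNormedType.Exports.

Set Implicit Arguments.
Unset Strict Implicit.
Unset Printing Implicit Defensive.

Local Open Scope classical_set_scope.
Local Open Scope ring_scope.

(* Throughout, n is the dimension N - 1 of the boundary of H^N.  Vectors are
   row vectors, so a linear map is v |-> v *m A.  The norm that the library puts
   on 'rV[R]_n is the sup norm; [sqnorm] is the square of the Euclidean norm. *)
Definition sqnorm (R : realType) (n : nat) (x : 'rV[R]_n) : R :=
  \sum_(i < n) x ord0 i ^+ 2.

Definition inversion (R : realType) (n : nat) (x : 'rV[R]_n) : 'rV[R]_n :=
  (sqnorm x)^-1 *: x.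

Definition arcosh (R : realType) (u : R) : R := ln (u + Num.sqrt (u ^+ 2 - 1)).

(** * Hyperbolic space, upper half-space model *)

(* A [set_type], hence endowed by the library with the subspace topology. *)
Definition Hset (R : realType) (n : nat) : set ('rV[R]_n * R) :=
  [set p | 0 < p.2].

Notation hyp R n := (set_type (@Hset R n)).

Definition hdist (R : realType) (n : nat) (p q : hyp R n) : R :=
  arcosh (1 + (sqnorm ((val p).1 - (val q).1) + ((val p).2 - (val q).2) ^+ 2)
              / (2 * (val p).2 * (val q).2)).

Definition isometry (R : realType) (n : nat) (g : hyp R n -> hyp R n) : Prop :=
  bijective g /\ forall p q, hdist (g p) (g q) = hdist p q.

(* Closure under identity, composition and inverse; the last clause only
   concerns the bijections in [A]. *)
Definition transf_closed (T : Type) (A : set (T -> T)) : Prop :=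
  [/\ A id,
      forall g h, A g -> A h -> A (g \o h)
    & forall g h, A g -> cancel g h -> cancel h g -> A h].

Definition generated (T : Type) (X : set (T -> T)) : set (T -> T) :=
  smallest (@transf_closed T) X.

Definition discrete_isometries (R : realType) (n : nat)
    (G : set (hyp R n -> hyp R n)) : Prop :=
  forall g, G g ->
    exists U : set {compact-open, hyp R n -> hyp R n},
      open U /\ U `&` G = [set g].

Definition kleinian (R : realType) (n : nat)
    (G : set (hyp R n -> hyp R n)) : Prop :=
  [/\ G `<=` @isometry R n, transf_closed G & discrete_isometries G].

Definition cocompact (R : realType) (n : nat)
    (G : set (hyp R n -> hyp R n)) : Prop :=
  exists2 K : set (hyp R n), compact K & \bigcup_(g in G) (g @` K) = setT.

(** * The sphere at infinity *)

(* [None] is the point at infinity. The topology and the uniform structure come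
   from the inverse stereographic projection onto the unit sphere. *)
Definition stereo (R : realType) (n : nat) (p : option 'rV[R]_n) :
    'rV[R]_n * R :=
  if p is Some x then
    ((2 / (sqnorm x + 1)) *: x, (sqnorm x - 1) / (sqnorm x + 1))
  else (0, 1).

Definition bdry (R : realType) (n : nat) : Type :=
  initial_topology (@stereo R n).

HB.instance Definition _ (R : realType) (n : nat) :=
  PseudoMetric.copy (bdry R n) (initial_topology (@stereo R n)).

Definition homeos (R : realType) (n : nat) : set (bdry R n -> bdry R n) :=
  [set f | continuous f /\
     exists g : bdry R n -> bdry R n,
       [/\ cancel f g, cancel g f & continuous g]].

(* Closure, for uniform convergence, in the group of homeomorphisms. *)
Definition closure_in_homeos (R : realType) (n : nat)
    (A : set (bdry R n -> bdry R n)) : set (bdry R n -> bdry R n) :=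
  closure (A : set {uniform bdry R n -> bdry R n}) `&` @homeos R n.

(* H^N and its boundary both lie in the one-point compactification of
   R^(N-1) x R, which induces the usual topology on their union. *)
Definition hyp_emb (R : realType) (n : nat) (p : hyp R n) :
    one_point_compactification ('rV[R]_n * R)%type := Some (val p).

Definition bdry_emb (R : realType) (n : nat) (xi : bdry R n) :
    one_point_compactification ('rV[R]_n * R)%type :=
  if xi is Some x then Some (x, 0) else None.

Definition to_bdry (R : realType) (n : nat) (xi : bdry R n) :
    set_system (hyp R n) :=
  filter_from (nbhs (bdry_emb xi)) (fun B => @hyp_emb R n @^-1` B).

(* [gamma] is the map induced on the boundary by [g]. *)
Definition boundary_value (R : realType) (n : nat)
    (g : hyp R n -> hyp R n) (gamma : bdry R n -> bdry R n) : Prop :=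
  forall xi : bdry R n,
    (@hyp_emb R n \o g) @ to_bdry xi --> bdry_emb (gamma xi).

Definition boundary_action (R : realType) (n : nat)
    (G : set (hyp R n -> hyp R n)) : set (bdry R n -> bdry R n) :=
  [set gamma | exists2 g, G g & boundary_value g gamma].

(* Boundary values of isometries, orientation-preserving or not. *)
Definition moebius (R : realType) (n : nat) : set (bdry R n -> bdry R n) :=
  boundary_action (@isometry R n).

(** * Smooth structure *)

(* The atlas has two charts: the identity of R^n (for [true]), and the inversion
   (for [false]), which is defined away from 0 and sends infinity to 0. *)
Definition chart_dom (R : realType) (n : nat) (b : bool) : set (bdry R n) :=
  [set p | p <> (if b then None else Some 0)].

Definition chart (R : realType) (n : nat) (b : bool) (p : bdry R n) :
    'rV[R]_n :=
  if p is Some x then (if b then x else inversion x) else 0.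

Definition chart_inv (R : realType) (n : nat) (b : bool) (x : 'rV[R]_n) :
    bdry R n :=
  if b then Some x else if x == 0 then None else Some (inversion x).

(* [Ck k U F]: the map F is of class C^k on the open set U. *)
Fixpoint Ck (R : realType) (n m : nat) (k : nat) (U : set 'rV[R]_n)
    (F : 'rV[R]_n -> 'rV[R]_m) : Prop :=
  if k is k'.+1 then
    (forall x, U x -> differentiable F x) /\
    (forall v : 'rV[R]_n, Ck k' U (fun x => 'D_v F x))
  else forall x, U x -> {for x, continuous F}.

Definition local_rep (R : realType) (n : nat) (a b : bool)
    (f : bdry R n -> bdry R n) : 'rV[R]_n -> 'rV[R]_n :=
  @chart R n b \o f \o @chart_inv R n a.

Definition smooth_map (R : realType) (n : nat) (k : nat)
    (f : bdry R n -> bdry R n) : Prop :=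
  continuous f /\
  forall a b : bool,
    Ck k (@chart_inv R n a @^-1`
            (@chart_dom R n a `&` f @^-1` (@chart_dom R n b)))
         (local_rep a b f).

Definition diffeo (R : realType) (n : nat) (k : nat)
    (f : bdry R n -> bdry R n) : Prop :=
  smooth_map k f /\
  exists g : bdry R n -> bdry R n,
    [/\ cancel f g, cancel g f & smooth_map k g].

(* The matrix of Df(x0), for a fixed point x0 of f, in the standard chart at x0
   (the inversion if x0 is infinity, the identity otherwise). *)
Definition fixpt_diff (R : realType) (n : nat) (f : bdry R n -> bdry R n)
    (x0 : bdry R n) : 'M[R]_n :=
  let b := isSome (x0 : option 'rV[R]_n) in
  'J (local_rep b b f) (chart b x0).

Definition orthogonal_mx (R : realType) (n : nat) (O : 'M[R]_n) : Prop :=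
  O *m O^T = 1%:M.

(** * One-parameter subgroups *)

Definition one_parameter_subgroup (R : realType) (n : nat)
    (A : set (bdry R n -> bdry R n)) (F : R -> bdry R n -> bdry R n) : Prop :=
  [/\ forall t, A (F t),
      forall s t, F (s + t) = F s \o F t
    & continuous (F : R -> {uniform bdry R n -> bdry R n})].

Definition affine_ext (R : realType) (n : nat) (A : 'M[R]_n) (v : 'rV[R]_n)
    (p : bdry R n) : bdry R n :=
  if p is Some x then Some (x *m A + v) else None.

(* A family of maps (F t) of the boundary which is conformally conjugate to
   invertible affine maps; when F is a homomorphism from R so are the affine
   maps. *)
Definition conformally_affine (R : realType) (n : nat)
    (F : R -> bdry R n -> bdry R n) : Prop :=
  exists phi psi : bdry R n -> bdry R n,
    [/\ @moebius R n phi, cancel phi psi, cancel psi phi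
      & forall t, exists (A : 'M[R]_n) (v : 'rV[R]_n),
          A \in unitmx /\ phi \o F t \o psi = affine_ext A v].

(* Main.v *)
Require Import Defs.
From mathcomp Require Import all_boot all_order all_algebra.
From mathcomp Require Import all_classical all_reals all_analysis.
From mathcomp Require Import ring lra.
Import Order.TTheory GRing.Theory Num.Theory.
Import numFieldNormedType.Exports.

Set Implicit Arguments.
Unset Strict Implicit.
Unset Printing Implicit Defensive.

Local Open Scope classical_set_scope.
Local Open Scope ring_scope.

(** The hyperbolic space and its boundary are modelled in the light cone of the
    quadratic form |x|^2 - d e on R^n x R x R: isometries become Lorentz matrices
    preserving the future cone ([isometry_moeb]), their boundary values act on
    the rays of light vectors ([boundary_value_hact]), and compactness of sets of
    isometries is compactness of sets of matrices.

    Move the fixed point of f to 0 by a Moebius map S and let A be the derivative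
    of f there. By cocompactness, for each s there is g_s in G such that
    M_s = g_s o S o (1/s) stays in a compact set of Moebius maps, so that M_s
    tends to some M along an ultrafilter. Then g_s f g_s^-1 is conjugate by M_s to
    f seen through a magnifying glass of factor s, which tends to A uniformly on
    the sphere ([cconv_zoom]); hence M A M^-1 is in the closed group.

    Put N_s = M^-1 M_s, which tends to the identity, and p_s = N_s(0). Since the
    fixed point of f has trivial stabiliser, the points g_s(x_0) are distinct for
    distinct g_s, and a given g_s occurs only for finitely many s
    ([renorm_distinct]); so p_s tends to 0 without being 0. The conjugate
    alpha_s of g_s f g_s^-1 by M fixes p_s and is close to first order at p_s to
    the linear map A ([tangent_family_conj]). Let C be A or A^-1, whichever is a
    contraction. Conjugating alpha_s by the power C^m for which C^-m p_s has size
    about 1, the limit is an affine map with linear part A that fixes some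
    z <> 0 ([tangent_family_limit]). It is here that A must be conjugate to a
    similarity: the norms of C^m and C^-m then compensate each other, and first
    order errors stay small. Composing with A^-1 gives the translation by z - A z,
    conjugating by powers of C gives arbitrarily short translations, and a limit
    direction of these gives a line of translations ([translation_flow]), which M
    conjugates to the flow sought.

    Convergence is handled in the form of continuous convergence [cconv], which
    is stable under composition and, by compactness of the sphere, implies
    uniform convergence ([cconv_unif]). *)

(** * The light cone model *)

Definition dot (R : realType) n (x y : 'rV[R]_n) : R := (x *m y^T) 0 0.

Definition mkw (R : realType) n (x : 'rV[R]_n) (d e : R) :
    'rV[R]_(n + (1 + 1)) :=
  row_mx x (row_mx d%:M e%:M).

Definition wx (R : realType) n (y : 'rV[R]_(n + (1 + 1))) : 'rV[R]_n :=
  lsubmx y.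
Definition wd (R : realType) n (y : 'rV[R]_(n + (1 + 1))) : R :=
  lsubmx (rsubmx y) 0 0.
Definition we (R : realType) n (y : 'rV[R]_(n + (1 + 1))) : R :=
  rsubmx (rsubmx y) 0 0.

(** The form |x|^2 - d e. In these coordinates the finite boundary points are the
    light vectors (x, 1, |x|^2), and infinity is (0, 0, 1). *)
Definition form (R : realType) n : 'M[R]_(n + (1 + 1)) :=
  block_mx 1%:M 0 0 (block_mx 0 (- 2^-1)%:M (- 2^-1)%:M 0).

Definition bil (R : realType) n (y z : 'rV[R]_(n + (1 + 1))) : R :=
  (y *m form R n *m z^T) 0 0.

Lemma dotE (R : realType) n (x y : 'rV[R]_n) :
  dot x y = \sum_i x 0 i * y 0 i.
Proof. by rewrite /dot mxE; apply: eq_bigr => i _; rewrite mxE. Qed.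

Lemma dotxx (R : realType) n (x : 'rV[R]_n) : dot x x = sqnorm x.
Proof. by rewrite dotE; apply: eq_bigr => i _; rewrite expr2. Qed.

Lemma dotC (R : realType) n (x y : 'rV[R]_n) : dot x y = dot y x.
Proof. by rewrite !dotE; apply: eq_bigr => i _; rewrite mulrC. Qed.

Lemma dotDl (R : realType) n (x y z : 'rV[R]_n) :
  dot (x + y) z = dot x z + dot y z.
Proof. by rewrite /dot mulmxDl mxE. Qed.

Lemma dotZl (R : realType) n (a : R) (x y : 'rV[R]_n) :
  dot (a *: x) y = a * dot x y.
Proof. by rewrite /dot -scalemxAl mxE. Qed.

Lemma dotDr (R : realType) n (x y z : 'rV[R]_n) :
  dot z (x + y) = dot z x + dot z y.
Proof. by rewrite !(dotC z) dotDl. Qed.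

Lemma dotZr (R : realType) n (a : R) (x y : 'rV[R]_n) :
  dot y (a *: x) = a * dot y x.
Proof. by rewrite !(dotC y) dotZl. Qed.

Lemma dot0l (R : realType) n (x : 'rV[R]_n) : dot 0 x = 0.
Proof. by rewrite /dot mul0mx mxE. Qed.

Lemma dotNl (R : realType) n (x y : 'rV[R]_n) : dot (- x) y = - dot x y.
Proof. by rewrite -scaleN1r dotZl mulN1r. Qed.

Lemma dotNr (R : realType) n (x y : 'rV[R]_n) : dot y (- x) = - dot y x.
Proof. by rewrite !(dotC y) dotNl. Qed.

Lemma sqnorm_ge0 (R : realType) n (x : 'rV[R]_n) : 0 <= sqnorm x.
Proof. by apply: sumr_ge0 => i _; rewrite sqr_ge0. Qed.

Lemma sqnorm_eq0 (R : realType) n (x : 'rV[R]_n) : sqnorm x = 0 -> x = 0.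
Proof.
move=> /eqP; rewrite psumr_eq0 => [/allP H|i _]; last by rewrite sqr_ge0.
apply/rowP => i; rewrite mxE; apply/eqP.
by have := H i (mem_index_enum _); rewrite sqrf_eq0.
Qed.

Lemma sqnorm0 (R : realType) n : sqnorm (0 : 'rV[R]_n) = 0.
Proof. by rewrite -dotxx /dot mul0mx mxE. Qed.

Lemma sqnormZ (R : realType) n (a : R) (x : 'rV[R]_n) :
  sqnorm (a *: x) = a ^+ 2 * sqnorm x.
Proof. by rewrite -!dotxx dotZl dotZr mulrA expr2. Qed.

Lemma sqnormB (R : realType) n (x y : 'rV[R]_n) :
  sqnorm (x - y) = sqnorm x + sqnorm y - 2 * dot x y.
Proof.
by rewrite -!dotxx dotDl !dotDr !dotNl !dotNr (dotC y x); ring.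
Qed.

Lemma sqnormD (R : realType) n (x y : 'rV[R]_n) :
  sqnorm (x + y) = sqnorm x + sqnorm y + 2 * dot x y.
Proof.
by rewrite -!dotxx dotDl !dotDr (dotC y x); ring.
Qed.

Lemma mkwE (R : realType) n (y : 'rV[R]_(n + (1 + 1))) :
  y = mkw (wx y) (wd y) (we y).
Proof. by rewrite /mkw /wd /we -!mx11_scalar !hsubmxK. Qed.

Lemma wx_mkw (R : realType) n (x : 'rV[R]_n) d e : wx (mkw x d e) = x.
Proof. by rewrite /wx row_mxKl. Qed.

Lemma wd_mkw (R : realType) n (x : 'rV[R]_n) d e : wd (mkw x d e) = d.
Proof. by rewrite /wd row_mxKr row_mxKl mxE eqxx. Qed.

Lemma we_mkw (R : realType) n (x : 'rV[R]_n) d e : we (mkw x d e) = e.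
Proof. by rewrite /we !row_mxKr mxE eqxx. Qed.

Definition mkwK := (wx_mkw, wd_mkw, we_mkw).

Lemma wP (R : realType) n (y z : 'rV[R]_(n + (1 + 1))) :
  wx y = wx z -> wd y = wd z -> we y = we z -> y = z.
Proof. by move=> h1 h2 h3; rewrite (mkwE y) (mkwE z) h1 h2 h3. Qed.

Lemma wxD (R : realType) n (y z : 'rV[R]_(n + (1 + 1))) :
  wx (y + z) = wx y + wx z.
Proof. by rewrite /wx linearD. Qed.
Lemma wdD (R : realType) n (y z : 'rV[R]_(n + (1 + 1))) :
  wd (y + z) = wd y + wd z.
Proof. by rewrite /wd !linearD mxE. Qed.
Lemma weD (R : realType) n (y z : 'rV[R]_(n + (1 + 1))) :
  we (y + z) = we y + we z.
Proof. by rewrite /we !linearD mxE. Qed.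
Lemma wxZ (R : realType) n a (y : 'rV[R]_(n + (1 + 1))) :
  wx (a *: y) = a *: wx y.
Proof. by rewrite /wx linearZ. Qed.
Lemma wdZ (R : realType) n a (y : 'rV[R]_(n + (1 + 1))) :
  wd (a *: y) = a * wd y.
Proof. by rewrite /wd !linearZ mxE. Qed.
Lemma weZ (R : realType) n a (y : 'rV[R]_(n + (1 + 1))) :
  we (a *: y) = a * we y.
Proof. by rewrite /we !linearZ mxE. Qed.

Lemma wx_0 (R : realType) n : wx (0 : 'rV[R]_(n + (1 + 1))) = 0.
Proof. by rewrite /wx linear0. Qed.
Lemma wd_0 (R : realType) n : wd (0 : 'rV[R]_(n + (1 + 1))) = 0.
Proof. by rewrite /wd !linear0 mxE. Qed.
Lemma we_0 (R : realType) n : we (0 : 'rV[R]_(n + (1 + 1))) = 0.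
Proof. by rewrite /we !linear0 mxE. Qed.
Definition w_0 := (wx_0, wd_0, we_0).

Lemma bilE (R : realType) n (y z : 'rV[R]_(n + (1 + 1))) :
  bil y z = dot (wx y) (wx z) - (wd y * we z + we y * wd z) / 2.
Proof.
rewrite {1}(mkwE y) {1}(mkwE z) /bil /form /mkw mul_row_block.
rewrite !mulmx0 add0r addr0 mulmx1 mul_row_block !mulmx0 add0r addr0.
rewrite !tr_row_mx !mul_row_col mxE /dot; congr (_ + _).
rewrite !tr_scalar_mx -!scalar_mxM mxE !mxE /= !mulr1n.
by field.
Qed.

Lemma bilC (R : realType) n (y z : 'rV[R]_(n + (1 + 1))) : bil y z = bil z y.
Proof. by rewrite !bilE dotC; congr (_ - _ / _); ring. Qed.

Lemma bilDl (R : realType) n (x y z : 'rV[R]_(n + (1 + 1))) :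
  bil (x + y) z = bil x z + bil y z.
Proof. by rewrite !bilE wxD wdD weD dotDl; field. Qed.

Lemma bilZl (R : realType) n a (y z : 'rV[R]_(n + (1 + 1))) :
  bil (a *: y) z = a * bil y z.
Proof. by rewrite !bilE wxZ wdZ weZ dotZl; field. Qed.

Lemma bilDr (R : realType) n (x y z : 'rV[R]_(n + (1 + 1))) :
  bil z (x + y) = bil z x + bil z y.
Proof. by rewrite !(bilC z) bilDl. Qed.

Lemma bilZr (R : realType) n a (y z : 'rV[R]_(n + (1 + 1))) :
  bil z (a *: y) = a * bil z y.
Proof. by rewrite !(bilC z) bilZl. Qed.

Lemma bilyy (R : realType) n (y : 'rV[R]_(n + (1 + 1))) :
  bil y y = sqnorm (wx y) - wd y * we y.
Proof. by rewrite bilE dotxx; field. Qed.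

Lemma form_unit (R : realType) n : form R n \in unitmx.
Proof.
suff /mulmx1_unit[] : form R n *m
  block_mx 1%:M 0 0 (block_mx 0 (- 2)%:M (- 2)%:M 0) = 1%:M by [].
rewrite /form !mulmx_block !(mulmx0, mul0mx, mulmx1, addr0, add0r).
rewrite -!scalar_mxM (_ : - 2^-1 * - 2 = 1 :> R); last by field.
by rewrite -!scalar_mx_block.
Qed.

(** * Lorentz transformations *)

Definition lorentz (R : realType) n (L : 'M[R]_(n + (1 + 1))) : Prop :=
  L *m form R n *m L^T = form R n.

(** The open future cone, the cone over hyperbolic space. *)
Definition future (R : realType) n (y : 'rV[R]_(n + (1 + 1))) : Prop :=
  0 < wd y /\ bil y y < 0.

Definition lightlike (R : realType) n (y : 'rV[R]_(n + (1 + 1))) : Prop :=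
  [/\ bil y y = 0, 0 <= wd y, 0 <= we y & 0 < wd y + we y].

Definition moeb (R : realType) n (L : 'M[R]_(n + (1 + 1))) : Prop :=
  lorentz L /\ forall y, future y -> future (y *m L).

Lemma lorentz_bil (R : realType) n (L : 'M[R]_(n + (1 + 1))) y z :
  lorentz L -> bil (y *m L) (z *m L) = bil y z.
Proof.
by move=> hL; rewrite /bil trmx_mul !mulmxA -(mulmxA y L) -(mulmxA y _ L^T) hL.
Qed.

Lemma lorentzP (R : realType) n (L : 'M[R]_(n + (1 + 1))) :
  (forall y z, bil (y *m L) (z *m L) = bil y z) -> lorentz L.
Proof.
move=> h; apply/matrixP => i j.
have := h (delta_mx 0 i) (delta_mx 0 j).
rewrite /bil trmx_mul !mulmxA -(mulmxA (delta_mx 0 i) L).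
rewrite -(mulmxA (delta_mx 0 i) _ L^T) -!rowE trmx_delta -!colE.
by rewrite !mxE.
Qed.

Lemma lorentz_unit (R : realType) n (L : 'M[R]_(n + (1 + 1))) :
  lorentz L -> L \in unitmx.
Proof.
move=> hL; have := form_unit R n; rewrite -{1}hL !unitmxE !det_mulmx.
by rewrite !unitrM => /andP[/andP[]].
Qed.

Lemma lorentz_inv (R : realType) n (L : 'M[R]_(n + (1 + 1))) :
  lorentz L -> lorentz (invmx L).
Proof.
move=> hL; have uL := lorentz_unit hL; apply: lorentzP => y z.
by rewrite -(lorentz_bil _ _ hL) !mulmxKV.
Qed.

Lemma future_we (R : realType) n (y : 'rV[R]_(n + (1 + 1))) :
  future y -> 0 < we y.
Proof.
move=> [d0]; rewrite bilyy => h; have := sqnorm_ge0 (wx y).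
by move=> s0; rewrite -(pmulr_rgt0 _ d0); lra.
Qed.

Lemma moebM (R : realType) n (L K : 'M[R]_(n + (1 + 1))) :
  moeb L -> moeb K -> moeb (L *m K).
Proof.
move=> [l1 l2] [k1 k2]; split.
  by apply: lorentzP => y z; rewrite !mulmxA !lorentz_bil.
by move=> y /l2/k2; rewrite mulmxA.
Qed.

Lemma moeb1 (R : realType) n : moeb (1%:M : 'M[R]_(n + (1 + 1))).
Proof.
by split=> [|y]; [apply: lorentzP => y z; rewrite !mulmx1|rewrite mulmx1].
Qed.

Lemma timelike_cases (R : realType) n (y : 'rV[R]_(n + (1 + 1))) :
  bil y y < 0 -> future y \/ future (- y).
Proof.
move=> h; have [d0|d0|d0] := ltrgtP 0 (wd y).
- by left.
- right; split; last by rewrite -scaleN1r bilZl bilZr; lra.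
  by rewrite -scaleN1r wdZ; lra.
- by move: h; rewrite bilyy -d0 mul0r subr0 ltNge sqnorm_ge0.
Qed.

Lemma future_opp (R : realType) n (y : 'rV[R]_(n + (1 + 1))) :
  future y -> ~ future (- y).
Proof. by move=> [d0 _] [+ _]; rewrite -scaleN1r wdZ; lra. Qed.

Lemma moeb_inv (R : realType) n (L : 'M[R]_(n + (1 + 1))) :
  moeb L -> moeb (invmx L).
Proof.
move=> [l1 l2]; split; first exact: lorentz_inv.
move=> y fy; have uL := lorentz_unit l1.
have : bil (y *m invmx L) (y *m invmx L) < 0.
  by rewrite (lorentz_bil _ _ (lorentz_inv l1)); case: fy.
case/timelike_cases => // /l2; rewrite mulNmx mulmxKV // => fy'.
by case: (future_opp fy fy').
Qed.

Lemma lightlike_neq0 (R : realType) n (y : 'rV[R]_(n + (1 + 1))) :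
  bil y y = 0 -> 0 <= wd y -> 0 <= we y -> y != 0 -> lightlike y.
Proof.
move=> q0 d0 e0 y0; split => //; rewrite lt_def addr_ge0 // andbT.
apply: contra_neq y0 => de0; have wd0 : wd y = 0 by lra.
have we0 : we y = 0 by lra.
move: q0; rewrite bilyy wd0 mul0r subr0 => /sqnorm_eq0 wx0.
by apply: wP; rewrite w_0.
Qed.

Definition base (R : realType) n : 'rV[R]_(n + (1 + 1)) := mkw 0 1 1.

(** A light vector y is the limit of the future vectors y + e b, where b is the
    base point, and the sign conditions on their images pass to the limit. *)
Lemma moeb_lightlike (R : realType) n (L : 'M[R]_(n + (1 + 1))) y :
  moeb L -> lightlike y -> lightlike (y *m L).
Proof.
move=> [l1 l2] [q0 d0 e0 de0]; have uL := lorentz_unit l1.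
have fut (e : R) : 0 < e -> future (y *m L + e *: (base R n *m L)).
  move=> ep; rewrite scalemxAl -mulmxDl; apply: l2; split.
    by rewrite wdD wdZ mkwK; lra.
  rewrite bilDl !bilDr !bilZl !bilZr q0 (bilC (base _ _) y) bilyy bilE !mkwK.
  rewrite sqnorm0 dotC dot0l.
  by have := mulr_gt0 ep ep; have := mulr_gt0 ep de0; lra.
have lim0 (a b : R) : (forall e, 0 < e -> 0 < a + e * b) -> 0 <= a.
  move=> h; rewrite leNgt; apply/negP => a0.
  have b0 : 0 < b.
    by rewrite ltNge; apply/negP => b0; have := h 1 ltr01; lra.
  have := h (- a / b / 2); rewrite divr_gt0 ?divr_gt0 ?oppr_gt0 // => /(_ isT).
  rewrite (_ : - a / b / 2 * b = - a / 2); first by lra.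
  by field; rewrite gt_eqF.
apply: lightlike_neq0.
- by rewrite lorentz_bil.
- apply: (lim0 _ (wd (base R n *m L))) => e /fut[+ _].
  by rewrite wdD wdZ.
- apply: (lim0 _ (we (base R n *m L))) => e /fut/future_we.
  by rewrite weD weZ.
- apply/eqP => yL; have : y = 0 by rewrite -(mulmxK uL y) yL mul0mx.
  by move=> y0; move: de0; rewrite y0 !w_0 addr0 ltxx.
Qed.

(** * Isometries of hyperbolic space are Lorentz transformations *)

(** The vector on the ray of (x, s) that is scaled so that d = 1: it tends to the
    lift of the boundary point x when s tends to 0. *)
Definition hlift (R : realType) n (p : 'rV[R]_n * R) : 'rV[R]_(n + (1 + 1)) :=
  mkw p.1 1 (sqnorm p.1 + p.2 ^+ 2).

Definition hactp (R : realType) n (L : 'M[R]_(n + (1 + 1)))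
    (p : 'rV[R]_n * R) : 'rV[R]_n * R :=
  let y := hlift p *m L in ((wd y)^-1 *: wx y, (wd y)^-1 * p.2).

Definition hact (R : realType) n (L : 'M[R]_(n + (1 + 1))) (p : hyp R n) :
    hyp R n := insubd p (hactp L (val p)).

Lemma hyp_gt0 (R : realType) n (p : hyp R n) : 0 < (val p).2.
Proof. by have := valP p; rewrite inE. Qed.

Lemma bil_hlift (R : realType) n (p q : 'rV[R]_n * R) :
  bil (hlift p) (hlift q) =
  - (sqnorm (p.1 - q.1) + p.2 ^+ 2 + q.2 ^+ 2) / 2.
Proof. by rewrite bilE !mkwK sqnormB; field. Qed.

Lemma bil_hliftxx (R : realType) n (p : 'rV[R]_n * R) :
  bil (hlift p) (hlift p) = - p.2 ^+ 2.
Proof. by rewrite bil_hlift subrr sqnorm0; field. Qed.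

Lemma future_hlift (R : realType) n (p : 'rV[R]_n * R) :
  0 < p.2 -> future (hlift p).
Proof.
by move=> p0; split; rewrite ?mkwK ?bil_hliftxx ?oppr_lt0 ?exprn_gt0.
Qed.

Lemma hlift_inj (R : realType) n (p q : hyp R n) :
  hlift (val p) = hlift (val q) -> p = q.
Proof.
move=> h; apply: val_inj; have p0 := hyp_gt0 p; have q0 := hyp_gt0 q.
move: h (congr1 (@wx R n) h) (congr1 (@we R n) h); rewrite !mkwK.
case: (val p) p0 (val q) q0 => [x s] /= s0 [y t] /= t0 _ -> /addrI.
by move=> /eqP; rewrite eqrXn2 ?ltW // => /eqP ->.
Qed.

Lemma wd_moeb_gt0 (R : realType) n (L : 'M[R]_(n + (1 + 1))) p :
  moeb L -> 0 < p.2 -> 0 < wd (hlift p *m L).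
Proof. by move=> [_ hL] p0; have [] := hL _ (future_hlift p0). Qed.

Lemma val_hact (R : realType) n (L : 'M[R]_(n + (1 + 1))) (p : hyp R n) :
  moeb L -> val (hact L p) = hactp L (val p).
Proof.
move=> hL; rewrite /hact val_insubd ifT // inE /Hset /hactp /=.
by rewrite mulr_gt0 ?invr_gt0 ?wd_moeb_gt0 ?hyp_gt0.
Qed.

Lemma hlift_hact (R : realType) n (L : 'M[R]_(n + (1 + 1))) (p : hyp R n) :
  moeb L -> hlift (val (hact L p)) =
  (wd (hlift (val p) *m L))^-1 *: (hlift (val p) *m L).
Proof.
move=> hL; rewrite val_hact // /hactp /hlift /=.
set y := mkw _ _ _ *m L; have y0 : 0 < wd y by apply: wd_moeb_gt0; rewrite ?hyp_gt0.
have : bil y y = - (val p).2 ^+ 2.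
  by rewrite lorentz_bil ?bil_hliftxx //; case: hL.
rewrite bilyy => qy.
apply: wP; rewrite ?wxZ ?wdZ ?weZ !mkwK // ?mulVf ?gt_eqF //.
rewrite sqnormZ exprMn -mulrDr.
have -> : sqnorm (wx y) + (val p).2 ^+ 2 = wd y * we y by lra.
by field; rewrite gt_eqF.
Qed.

Lemma hlift_scale (R : realType) n (p q : hyp R n) a :
  hlift (val p) = a *: hlift (val q) -> p = q.
Proof.
move=> h; apply: hlift_inj; have := congr1 (@wd R n) h.
by rewrite wdZ !mkwK mulr1 h => <-; rewrite scale1r.
Qed.

Lemma hactM (R : realType) n (L K : 'M[R]_(n + (1 + 1))) (p : hyp R n) :
  moeb L -> moeb K -> hact (L *m K) p = hact K (hact L p).
Proof.
move=> hL hK; have hLK := moebM hL hK.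
set a := wd (hlift (val p) *m L).
have a0 : a != 0 by rewrite gt_eqF // wd_moeb_gt0 // hyp_gt0.
have h : hlift (val p) *m L = a *: hlift (val (hact L p)).
  by rewrite hlift_hact // scalerA mulfV // scale1r.
apply: hlift_inj; rewrite (hlift_hact _ hLK) (hlift_hact (hact L p) hK).
by rewrite mulmxA h -!scalemxAl wdZ scalerA invfM mulrAC mulVf // mul1r.
Qed.

Lemma hact1 (R : realType) n (p : hyp R n) : hact 1%:M p = p.
Proof.
apply: (@hlift_scale _ _ _ _ 1); rewrite hlift_hact; last exact: moeb1.
by rewrite mulmx1 mkwK invr1.
Qed.

Lemma hactK (R : realType) n (L : 'M[R]_(n + (1 + 1))) :
  moeb L -> cancel (hact L) (hact (invmx L)).
Proof.
move=> hL p; rewrite -hactM //; last exact: moeb_inv.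
by rewrite mulmxV ?hact1 //; apply: lorentz_unit; case: hL.
Qed.

Lemma hactKV (R : realType) n (L : 'M[R]_(n + (1 + 1))) :
  moeb L -> cancel (hact (invmx L)) (hact L).
Proof. by move=> hL p; have := hactK (moeb_inv hL) p; rewrite invmxK. Qed.

(** The representative on the hyperboloid bil y y = -1, on which isometries act
    linearly. *)
Definition hyperb (R : realType) n (p : hyp R n) : 'rV[R]_(n + (1 + 1)) :=
  (val p).2^-1 *: hlift (val p).

Lemma hyperb_hact (R : realType) n (L : 'M[R]_(n + (1 + 1))) (p : hyp R n) :
  moeb L -> hyperb (hact L p) = hyperb p *m L.
Proof.
move=> hL; rewrite /hyperb hlift_hact // -scalemxAl scalerA val_hact //=.
rewrite invfM invrK mulrAC mulfV ?mul1r //.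
by rewrite gt_eqF // wd_moeb_gt0 // hyp_gt0.
Qed.

Lemma hdistE (R : realType) n (p q : hyp R n) :
  hdist p q = arcosh (- bil (hyperb p) (hyperb q)).
Proof.
rewrite /hdist /hyperb bilZl bilZr bil_hlift; congr (arcosh _).
by field; rewrite !gt_eqF ?hyp_gt0.
Qed.

Lemma bil_hyperb_ge1 (R : realType) n (p q : hyp R n) :
  1 <= - bil (hyperb p) (hyperb q).
Proof.
have -> : - bil (hyperb p) (hyperb q) =
    1 + (sqnorm ((val p).1 - (val q).1) + ((val p).2 - (val q).2) ^+ 2)
              / (2 * (val p).2 * (val q).2).
  rewrite /hyperb bilZl bilZr bil_hlift.
  by field; rewrite !gt_eqF ?hyp_gt0.
rewrite lerDl divr_ge0 ?addr_ge0 ?sqnorm_ge0 ?sqr_ge0 //.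
by rewrite !mulr_ge0 // ltW // hyp_gt0.
Qed.

Lemma arcosh_inj (R : realType) : {in `[1, +oo[ &, injective (@arcosh R)}.
Proof.
have lt (u v : R) : 1 <= u -> u < v -> arcosh u < arcosh v.
  move=> u1 uv; have s : Num.sqrt (u ^+ 2 - 1) <= Num.sqrt (v ^+ 2 - 1).
    by apply: ler_wsqrtr; rewrite lerD2r ler_sqr ?nnegrE; lra.
  have s0 := sqrtr_ge0 (u ^+ 2 - 1).
  by rewrite /arcosh ltr_ln ?posrE; lra.
move=> u v; rewrite !in_itv /= !andbT => u1 v1 e.
have [uv|vu|//] := ltrgtP u v.
  by have := lt _ _ u1 uv; rewrite e ltxx.
by have := lt _ _ v1 vu; rewrite e ltxx.
Qed.

Lemma isometry_hyperb (R : realType) n (g : hyp R n -> hyp R n) p q :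
  Defs.isometry g -> bil (hyperb (g p)) (hyperb (g q)) = bil (hyperb p) (hyperb q).
Proof.
move=> [_ /(_ p q)]; rewrite !hdistE => /arcosh_inj.
by rewrite !in_itv /= !andbT !bil_hyperb_ge1 => /(_ isT isT) /oppr_inj.
Qed.

Lemma isometry_hact (R : realType) n (L : 'M[R]_(n + (1 + 1))) :
  moeb L -> Defs.isometry (hact L).
Proof.
move=> hL; split; first by exists (hact (invmx L)); [exact: hactK|exact: hactKV].
by move=> p q; rewrite !hdistE !hyperb_hact // lorentz_bil //; case: hL.
Qed.

Definition mkhyp (R : realType) n (x : 'rV[R]_n) (s : R) (s0 : 0 < s) : hyp R n :=
  exist (fun p => p \in @Hset R n) (x, s) (mem_set s0).

(** Points whose lifts form a basis of the ambient space. *)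
Definition frame_pt (R : realType) n (i : 'I_(n + (1 + 1))) : hyp R n :=
  match fintype.split i with
  | inl j => mkhyp (delta_mx 0 j) ltr01
  | inr j => mkhyp 0 (ltr0Sn R j)
  end.

Definition frame (R : realType) n (g : hyp R n -> hyp R n) :
    'M[R]_(n + (1 + 1)) :=
  \matrix_i hyperb (g (frame_pt R i)).

Lemma frame_sep (R : realType) n (z : 'rV[R]_(n + (1 + 1))) :
  (forall i, bil z (row i (frame id)) = 0) -> z = 0.
Proof.
move=> h; have {}h i : bil z (hlift (val (frame_pt R i))) = 0.
  have := h i; rewrite rowK /hyperb bilZr => /eqP; rewrite mulf_eq0 invr_eq0.
  by rewrite gt_eqF ?hyp_gt0 //= => /eqP.
have /= h1 := h (rshift n (lshift 1 0)); have h2 := h (rshift n (rshift 1 0)).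
move: h1 h2; rewrite /frame_pt !(unsplitK (inr _)) /= !bilE !mkwK.
rewrite sqnorm0 dotC dot0l.
move=> h1 h2; have d0 : wd z = 0 by lra.
have e0 : we z = 0 by lra.
apply: wP; rewrite ?w_0 //.
apply/rowP => j; have := h (lshift _ j).
rewrite /frame_pt !(unsplitK (inl _)) /= bilE !mkwK d0 e0 !mul0r addr0 mul0r.
rewrite subr0 dotE (bigD1 j) //= [delta_mx _ _ _ _]mxE !eqxx mulr1.
rewrite big1 ?addr0 => [->|i ij]; first by rewrite mxE.
by rewrite [delta_mx _ _ _ _]mxE eqxx /= (negPf ij) mulr0.
Qed.

Lemma bil_tr (R : realType) n (A B : 'M[R]_(n + (1 + 1))) i j :
  (A *m form R n *m B^T) i j = bil (row i A) (row j B).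
Proof.
rewrite /bil !rowE trmx_mul trmx_delta !mulmxA -(mulmxA (delta_mx 0 i) A).
by rewrite -(mulmxA (delta_mx 0 i) _ B^T) -rowE -colE !mxE.
Qed.

Lemma frame_unit (R : realType) n : frame (@id (hyp R n)) \in unitmx.
Proof.
rewrite -unitmx_tr -row_free_unit; apply: inj_row_free => v hv.
rewrite -(mulmxKV (form_unit R n) v) [v *m invmx _](_ : _ = 0) ?mul0mx //.
apply: frame_sep => i; rewrite /bil (mulmxKV (form_unit R n)).
by rewrite tr_row colE mulmxA hv mul0mx mxE.
Qed.

Lemma future_hlift_ex (R : realType) n (y : 'rV[R]_(n + (1 + 1))) :
  future y -> exists p : hyp R n, y = wd y *: hlift (val p).
Proof.
move=> [d0]; rewrite bilyy => q0.
set s := Num.sqrt ((wd y * we y - sqnorm (wx y)) / wd y ^+ 2).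
have r0 : 0 < (wd y * we y - sqnorm (wx y)) / wd y ^+ 2.
  by rewrite divr_gt0 ?exprn_gt0 //; lra.
have s0 : 0 < s by rewrite sqrtr_gt0.
exists (mkhyp ((wd y)^-1 *: wx y) s0).
apply: wP; rewrite ?wxZ ?wdZ ?weZ !mkwK /= ?mulr1 //.
  by rewrite scalerA mulfV ?gt_eqF // scale1r.
rewrite sqr_sqrtr ?(ltW r0) // sqnormZ; field.
by rewrite gt_eqF.
Qed.

(** An isometry preserves the inner products of the points of the hyperboloid,
    and these span the ambient space: it extends to a linear map. *)
Lemma isometry_moeb (R : realType) n (g : hyp R n -> hyp R n) :
  Defs.isometry g -> exists2 L : 'M[R]_(n + (1 + 1)), moeb L & g = hact L.
Proof.
move=> hg; set E := frame (@id (hyp R n)); set L := invmx E *m frame g.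
have uE : E \in unitmx := frame_unit R n.
have EL : E *m L = frame g by rewrite mulmxA mulmxV // mul1mx.
have lL : lorentz L.
  rewrite /lorentz /L trmx_mul !mulmxA.
  rewrite -(mulmxA _ (frame g)) -(mulmxA _ _ (frame g)^T).
  have -> : frame g *m form R n *m (frame g)^T = E *m form R n *m E^T.
    by apply/matrixP => i j; rewrite !bil_tr !rowK isometry_hyperb.
  by rewrite !mulmxA mulVmx // mul1mx -mulmxA -trmx_mul mulVmx // trmx1 mulmx1.
have uL := lorentz_unit lL.
have gL p : hyperb (g p) = hyperb p *m L.
  apply/eqP; rewrite -subr_eq0; apply/eqP.
  rewrite -(mulmxKV uL (_ - _)) [_ *m invmx L](_ : _ = 0) ?mul0mx //.
  apply: frame_sep => i; rewrite -(lorentz_bil _ _ lL) mulmxKV //.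
  have rw : row i E *m L = hyperb (g (frame_pt R i)).
    by rewrite -row_mul EL rowK.
  rewrite rw -scaleN1r bilDl (bilZl (- 1)) isometry_hyperb // -rw lorentz_bil //.
  by rewrite rowK; lra.
have hL : moeb L.
  split=> // y fy; have [p yp] := future_hlift_ex fy; have [d0 _] := fy.
  have [d1 q1] := future_hlift (hyp_gt0 (g p)).
  have -> : y *m L = (wd y * (val p).2 * (val (g p)).2^-1) *: hlift (val (g p)).
    rewrite -scalerA -[_^-1 *: _]/(hyperb (g p)) gL /hyperb -scalemxAl scalerA.
    by rewrite mulfK ?gt_eqF ?hyp_gt0 // scalemxAl -yp.
  set c := _ * _; have c0 : 0 < c.
    by rewrite /c !mulr_gt0 ?invr_gt0 ?hyp_gt0.
  split; first by rewrite wdZ mulr_gt0.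
  by rewrite (bilZl c) (bilZr c) !pmulr_rlt0.
exists L => //; apply: funext => p.
apply: (@hlift_scale _ _ _ _ ((val (g p)).2 / (val (hact L p)).2)).
rewrite -scalerA -[_^-1 *: hlift (val (hact L p))]/(hyperb (hact L p)).
rewrite hyperb_hact // -gL /hyperb scalerA mulfV ?scale1r //.
by rewrite gt_eqF // hyp_gt0.
Qed.

(** * The action on the boundary *)

Definition blift (R : realType) n (p : bdry R n) : 'rV[R]_(n + (1 + 1)) :=
  if p is Some x then mkw x 1 (sqnorm x) else mkw 0 0 1.

(** A light vector is determined up to scale by a boundary point; d vanishes
    only on the ray of infinity. *)
Definition bpt (R : realType) n (y : 'rV[R]_(n + (1 + 1))) : bdry R n :=
  if wd y == 0 then None else Some ((wd y)^-1 *: wx y).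

Definition bact (R : realType) n (L : 'M[R]_(n + (1 + 1))) (p : bdry R n) :
    bdry R n := bpt (blift p *m L).

Lemma lightlike_blift (R : realType) n (p : bdry R n) : lightlike (blift p).
Proof.
case: p => [x|]; split; rewrite ?bilyy /= !mkwK ?sqnorm_ge0 ?sqnorm0 ?mul1r //.
- by rewrite subrr.
- by rewrite ltr_pwDl // sqnorm_ge0.
- by rewrite mul0r subr0.
Qed.

Lemma lightlikeZ (R : realType) n c (y : 'rV[R]_(n + (1 + 1))) :
  0 < c -> lightlike y -> lightlike (c *: y).
Proof.
move=> c0 [q d e de]; split; rewrite ?bilZl ?bilZr ?q ?mulr0 ?wdZ ?weZ //.
- by rewrite mulr_ge0 // ltW.
- by rewrite mulr_ge0 // ltW.
- by rewrite -mulrDr mulr_gt0.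
Qed.

Lemma bpt_blift (R : realType) n (p : bdry R n) : bpt (blift p) = p.
Proof.
case: p => [x|]; rewrite /bpt /= !mkwK ?eqxx // oner_eq0.
by rewrite invr1 scale1r.
Qed.

Lemma bptZ (R : realType) n c (y : 'rV[R]_(n + (1 + 1))) :
  c != 0 -> bpt (c *: y) = bpt y.
Proof.
move=> c0; rewrite /bpt wdZ wxZ mulf_eq0 (negPf c0) /=.
case: eqP => // _; congr Some.
by rewrite scalerA invfM mulrAC mulVf // mul1r.
Qed.

Lemma blift_bpt (R : realType) n (y : 'rV[R]_(n + (1 + 1))) :
  lightlike y -> exists2 c, 0 < c & y = c *: blift (bpt y).
Proof.
move=> [q d e de]; rewrite /bpt; case: eqP => [d0|/eqP d0] /=.
  exists (we y); first by move: de; rewrite d0 add0r.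
  apply: wP; rewrite ?wxZ ?wdZ ?weZ !mkwK ?scaler0 ?mulr0 ?mulr1 //.
  by apply: sqnorm_eq0; move: q; rewrite bilyy d0 mul0r subr0.
exists (wd y); first by rewrite lt_def d0.
apply: wP; rewrite ?wxZ ?wdZ ?weZ !mkwK ?mulr1 //.
  by rewrite scalerA mulfV // scale1r.
move: q; rewrite bilyy sqnormZ => /eqP; rewrite subr_eq0 => /eqP ->.
by field.
Qed.

Lemma bactM (R : realType) n (L K : 'M[R]_(n + (1 + 1))) (p : bdry R n) :
  moeb L -> bact (L *m K) p = bact K (bact L p).
Proof.
move=> hL; have [c c0 yc] := blift_bpt (moeb_lightlike hL (lightlike_blift p)).
by rewrite /bact mulmxA {1}yc -scalemxAl bptZ ?gt_eqF.
Qed.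

Lemma bact1 (R : realType) n (p : bdry R n) : bact 1%:M p = p.
Proof. by rewrite /bact mulmx1 bpt_blift. Qed.

Lemma bactK (R : realType) n (L : 'M[R]_(n + (1 + 1))) :
  moeb L -> cancel (@bact R n L) (bact (invmx L)).
Proof.
by move=> hL p; rewrite -bactM // mulmxV ?bact1 //; apply: lorentz_unit; case: hL.
Qed.

Lemma bactKV (R : realType) n (L : 'M[R]_(n + (1 + 1))) :
  moeb L -> cancel (@bact R n (invmx L)) (bact L).
Proof. by move=> hL p; have := bactK (moeb_inv hL) p; rewrite invmxK. Qed.

(** Unlike the affine coordinate, this expression of a light ray as a point of
    the unit sphere is continuous at infinity. *)
Definition raypt (R : realType) n (y : 'rV[R]_(n + (1 + 1))) :
    'rV[R]_n * R :=
  ((2 / (wd y + we y)) *: wx y, (we y - wd y) / (wd y + we y)).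

(** The inverse of [raypt], normalised by d + e = 1; it is affine in q, and this
    makes the action on the sphere visibly continuous. *)
Definition nlift (R : realType) n (q : 'rV[R]_n * R) :
    'rV[R]_(n + (1 + 1)) :=
  mkw (2^-1 *: q.1) ((1 - q.2) / 2) ((1 + q.2) / 2).

Lemma stereo_raypt (R : realType) n (p : bdry R n) :
  stereo p = raypt (blift p).
Proof.
case: p => [x|]; rewrite /raypt /= !mkwK.
  by rewrite [1 + _]addrC.
by rewrite scaler0 subr0 add0r divr1.
Qed.

Lemma rayptZ (R : realType) n c (y : 'rV[R]_(n + (1 + 1))) :
  c != 0 -> raypt (c *: y) = raypt y.
Proof.
move=> c0; rewrite /raypt wxZ wdZ weZ -mulrDr -mulrBr scalerA; congr pair.
  by rewrite invfM mulrA mulrAC mulfVK.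
by rewrite invfM mulrACA mulfV // mul1r.
Qed.

Lemma stereo_bpt (R : realType) n (y : 'rV[R]_(n + (1 + 1))) :
  lightlike y -> stereo (bpt y) = raypt y.
Proof.
move=> ly; have [c c0 yc] := blift_bpt ly.
by rewrite stereo_raypt {2}yc rayptZ // gt_eqF.
Qed.

Lemma nlift_stereo (R : realType) n (p : bdry R n) :
  exists2 c, 0 < c & nlift (stereo p) = c *: blift p.
Proof.
have [_ _ _ de] := lightlike_blift p.
exists (wd (blift p) + we (blift p))^-1; first by rewrite invr_gt0.
rewrite stereo_raypt /nlift /raypt /=; apply: wP; rewrite !mkwK ?wxZ ?wdZ ?weZ.
- by rewrite scalerA mulrA mulVf ?mul1r // gt_eqF.
- by field; rewrite gt_eqF.
- by field; rewrite gt_eqF.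
Qed.

Lemma stereo_bact (R : realType) n (L : 'M[R]_(n + (1 + 1))) (p : bdry R n) :
  moeb L -> stereo (bact L p) = raypt (nlift (stereo p) *m L).
Proof.
move=> hL; have [c c0 ->] := nlift_stereo p.
rewrite -scalemxAl rayptZ ?gt_eqF // stereo_bpt //.
exact: moeb_lightlike hL (lightlike_blift p).
Qed.

(** * Topology of the boundary *)

(** Ultrafilters replace the extraction of convergent subsequences. *)
Lemma ultra_cvg T (F : set_system T) (X : topologicalType) (f : T -> X)
    (K : set X) :
  UltraFilter F -> compact K -> F (f @^-1` K) -> exists2 x, K x & f @ F --> x.
Proof.
move=> FU; rewrite compact_ultra => cK FK.
have FfU : UltraFilter (f @ F).
  split=> [|G GF FG]; first exact: fmap_proper_filter.
  apply/seteqP; split=> // A GA.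
  have [//|FA] := in_ultra_setVsetC (f @^-1` A) FU.
  have : G (A `&` ~` A) by apply: filterI => //; exact: FG.
  by rewrite setICr => /filter_not_empty.
by have [x [Kx fx]] := cK _ FfU FK; exists x.
Qed.

Lemma cvg_sumR (R : realType) T (F : set_system T) {FF : Filter F} (I : finType)
    (f : I -> T -> R) (l : I -> R) :
  (forall i, f i @ F --> l i) -> (fun t => \sum_i f i t) @ F --> \sum_i l i.
Proof.
move=> h; apply: (@cvg_big _ _ +%R 0 xpredT _ T F) => // z.
by apply: cvgD; [exact: cvg_fst|exact: cvg_snd].
Qed.

Lemma cvg_prod T (F : set_system T) {FF : Filter F} (U V : topologicalType)
    (f : T -> U) (g : T -> V) (a : U) (b : V) :
  f @ F --> a -> g @ F --> b -> (fun t => (f t, g t)) @ F --> (a, b).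
Proof. by move=> fa gb; exact: (cvg_pair (G := nbhs a) (H := nbhs b)). Qed.

Lemma cvg_mx (R : realType) T (F : set_system T) {FF : Filter F} m n
    (f : T -> 'M[R]_(m, n)) (M : 'M[R]_(m, n)) :
  (forall i j, (fun t => f t i j) @ F --> M i j) -> f @ F --> M.
Proof.
move=> h; apply/cvg_ballP => e e0; near=> t; split => // i j.
move: (i) (j); near: t; apply: filter_forall => i; apply: filter_forall => j.
exact: (cvg_ball (h i j)).
Unshelve. all: by end_near. Qed.

Lemma cvg_mx_coord (R : realType) T (F : set_system T) {FF : Filter F} m n
    (f : T -> 'M[R]_(m, n)) (M : 'M[R]_(m, n)) i j :
  f @ F --> M -> (fun t => f t i j) @ F --> M i j.
Proof.
move=> h; apply: (cvg_comp _ (fun A : 'M[R]_(m, n) => A i j) h).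
exact: coord_continuous.
Qed.

Lemma cvg_mulmx (R : realType) T (F : set_system T) {FF : Filter F} m n p
    (f : T -> 'M[R]_(m, n)) (g : T -> 'M[R]_(n, p)) (A : 'M[R]_(m, n)) (B : 'M[R]_(n, p)) :
  f @ F --> A -> g @ F --> B -> (fun t => f t *m g t) @ F --> A *m B.
Proof.
move=> fA gB; apply: cvg_mx => i j.
rewrite mxE; under eq_fun do rewrite mxE.
by apply: cvg_sumR => k; apply: cvgM; exact: cvg_mx_coord.
Qed.

Lemma cvg_trmx (R : realType) T (F : set_system T) {FF : Filter F} m n
    (f : T -> 'M[R]_(m, n)) (A : 'M[R]_(m, n)) :
  f @ F --> A -> (fun t => (f t)^T) @ F --> A^T.
Proof.
move=> fA; apply: cvg_mx => i j.
rewrite mxE; under eq_fun do rewrite mxE.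
exact: cvg_mx_coord.
Qed.

Lemma cvg_wx (R : realType) T (F : set_system T) {FF : Filter F} n
    (f : T -> 'rV[R]_(n + (1 + 1))) (y : 'rV[R]_(n + (1 + 1))) :
  f @ F --> y -> (fun t => wx (f t)) @ F --> wx y.
Proof.
move=> fA; apply: cvg_mx => i j; rewrite /wx mxE.
under eq_fun do rewrite mxE.
exact: cvg_mx_coord.
Qed.

Lemma cvg_wd (R : realType) T (F : set_system T) {FF : Filter F} n
    (f : T -> 'rV[R]_(n + (1 + 1))) (y : 'rV[R]_(n + (1 + 1))) :
  f @ F --> y -> (fun t => wd (f t)) @ F --> wd y.
Proof.
move=> fA; rewrite /wd !mxE; under eq_fun do rewrite !mxE.
exact: cvg_mx_coord.
Qed.

Lemma cvg_we (R : realType) T (F : set_system T) {FF : Filter F} n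
    (f : T -> 'rV[R]_(n + (1 + 1))) (y : 'rV[R]_(n + (1 + 1))) :
  f @ F --> y -> (fun t => we (f t)) @ F --> we y.
Proof.
move=> fA; rewrite /we !mxE; under eq_fun do rewrite !mxE.
exact: cvg_mx_coord.
Qed.

Lemma cvg_sqnorm (R : realType) T (F : set_system T) {FF : Filter F} n
    (f : T -> 'rV[R]_n) (y : 'rV[R]_n) :
  f @ F --> y -> (fun t => sqnorm (f t)) @ F --> sqnorm y.
Proof.
move=> fy; apply: cvg_sumR => i; rewrite expr2; under eq_fun do rewrite expr2.
by apply: cvgM; exact: cvg_mx_coord.
Qed.

Lemma cvg_mkw (R : realType) T (F : set_system T) {FF : Filter F} n
    (f : T -> 'rV[R]_n) (d e : T -> R) (f0 : 'rV[R]_n) (d0 e0 : R) :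
  f @ F --> f0 -> d @ F --> d0 -> e @ F --> e0 ->
  (fun t => mkw (f t) (d t) (e t)) @ F --> mkw f0 d0 e0.
Proof.
move=> hf hd he; apply: cvg_mx => i j; rewrite ord1 /mkw.
case: (split_ordP j) => k ->.
  rewrite row_mxEl; under eq_fun do rewrite row_mxEl.
  exact: cvg_mx_coord.
rewrite row_mxEr; under eq_fun do rewrite row_mxEr.
case: (split_ordP k) => l ->; rewrite ord1.
  rewrite row_mxEl; under eq_fun do rewrite row_mxEl mxE.
  by rewrite mxE.
rewrite row_mxEr; under eq_fun do rewrite row_mxEr mxE.
by rewrite mxE.
Qed.

Lemma cvg_raypt (R : realType) T (F : set_system T) {FF : Filter F} n
    (f : T -> 'rV[R]_(n + (1 + 1))) (y : 'rV[R]_(n + (1 + 1))) :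
  lightlike y -> f @ F --> y -> (fun t => raypt (f t)) @ F --> raypt y.
Proof.
move=> [_ _ _ de] fy.
have hde : (fun t => (wd (f t) + we (f t))^-1) @ F --> (wd y + we y)^-1.
  apply: cvgV; first by rewrite gt_eqF.
  by apply: cvgD; [exact: cvg_wd|exact: cvg_we].
apply: cvg_prod.
  by apply: cvgZ; [apply: cvgM => //; exact: cvg_cst|exact: cvg_wx].
by apply: cvgM => //; apply: cvgB; [exact: cvg_we|exact: cvg_wd].
Qed.

Lemma cvg_nlift (R : realType) T (F : set_system T) {FF : Filter F} n
    (f : T -> 'rV[R]_n * R) (y : 'rV[R]_n * R) :
  f @ F --> y -> (fun t => nlift (f t)) @ F --> nlift y.
Proof.
move=> fy; have f1 : (fun t => (f t).1) @ F --> y.1 by apply: cvg_comp fy cvg_fst.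
have f2 : (fun t => (f t).2) @ F --> y.2 by apply: cvg_comp fy cvg_snd.
apply: cvg_mkw.
- by apply: cvgZ => //; exact: cvg_cst.
- by apply: cvgM; [apply: cvgB => //; exact: cvg_cst|exact: cvg_cst].
- by apply: cvgM; [apply: cvgD => //; exact: cvg_cst|exact: cvg_cst].
Qed.

Lemma stereo_continuous (R : realType) n :
  continuous (@stereo R n : bdry R n -> _).
Proof. exact: initial_continuous. Qed.

Lemma cvg_bdry (R : realType) n T (F : set_system T) {FF : Filter F}
    (u : T -> bdry R n) (p : bdry R n) :
  (fun t => stereo (u t)) @ F --> stereo p -> u @ F --> p.
Proof. by move=> h; apply/cvg_ballP => e e0; exact: (cvg_ball h). Qed.

Lemma stereo_sphere (R : realType) n (q : 'rV[R]_n * R) :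
  sqnorm q.1 + q.2 ^+ 2 = 1 -> exists p : bdry R n, stereo p = q.
Proof.
move=> h; exists (bpt (nlift q)).
have e1 : wd (nlift q) + we (nlift q) = 1 by rewrite !mkwK; field.
have q1 : q.2 ^+ 2 <= 1 by have := sqnorm_ge0 q.1; lra.
have : `|q.2| <= 1 by rewrite -(@expr_le1 _ 2) // -normrX ger0_norm ?sqr_ge0.
rewrite ler_norml => /andP[qa qb].
rewrite stereo_bpt.
  rewrite /raypt e1 !mkwK scalerA !divr1 mulfV // scale1r.
  by rewrite [X in (_, X)](_ : _ = q.2); [case: (q)|field].
split; rewrite ?e1 // ?bilyy !mkwK; first by rewrite sqnormZ; lra.
- by lra.
- by lra.
Qed.

Lemma sphere_stereo (R : realType) n (p : bdry R n) :
  sqnorm (stereo p).1 + (stereo p).2 ^+ 2 = 1.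
Proof.
case: p => [x|] /=; last by rewrite sqnorm0 expr1n add0r.
rewrite sqnormZ; field.
by have := sqnorm_ge0 x; lra.
Qed.

Lemma bdry_compact (R : realType) n : compact [set: bdry R n].
Proof.
have cS : compact [set q : 'rV[R]_n * R | sqnorm q.1 + q.2 ^+ 2 = 1].
  apply: (@subclosed_compact _ _
      ([set v : 'rV[R]_n | forall i, `[(-1 : R), 1]%classic (v ord0 i)]
       `*` `[(-1 : R), 1]%classic)).
  - apply: (@closed_comp _ _ (fun q : 'rV[R]_n * R => sqnorm q.1 + q.2 ^+ 2)
              [set (1 : R)]).
      move=> q _; apply: cvgD.
        by apply: cvg_sqnorm; exact: cvg_fst.
      under eq_fun do rewrite expr2.
      by rewrite expr2; apply: cvgM; exact: cvg_snd.
    exact: closed_eq.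
  - apply: compact_setX; last exact: segment_compact.
    by apply: (@rV_compact _ _ (fun=> `[(-1 : R), 1]%classic)) => i; exact: segment_compact.
  - move=> [x s] /= h.
    have abs1 (a : R) : a ^+ 2 <= 1 -> a \in `[(-1 : R), 1].
      move=> a1; rewrite in_itv /= -ler_norml.
      by rewrite -(@expr_le1 _ 2) // -normrX ger0_norm ?sqr_ge0.
    split => [i|] /=; apply: abs1; last by have := sqnorm_ge0 x; lra.
    apply: le_trans (_ : sqnorm x <= _); last by have := sqr_ge0 s; lra.
    rewrite /sqnorm (bigD1 i) //= lerDl.
    by apply: sumr_ge0 => j _; exact: sqr_ge0.
rewrite compact_ultra => F FU _.
have [|q /stereo_sphere [p <-] hp] := ultra_cvg FU (f := @stereo R n) cS.
  by apply: filterS filterT => p _; exact: sphere_stereo.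
by exists p; split => //; exact: (cvg_bdry (u := id)).
Qed.

(** * Continuous convergence *)

(** The maps (h t) converge to h0 locally uniformly, in the form that composes:
    h t p tends to h0 p0 when t and p vary together. *)
Definition cconv (R : realType) n T (F : set_system T)
    (h : T -> bdry R n -> bdry R n) (h0 : bdry R n -> bdry R n) : Prop :=
  forall p, (fun q : T * bdry R n => h q.1 q.2) @ (F, nbhs p) --> h0 p.

Lemma cconv_comp (R : realType) n T (F : set_system T) {FF : Filter F}
    (h k : T -> bdry R n -> bdry R n) h0 k0 :
  cconv F h h0 -> cconv F k k0 ->
  cconv F (fun t => h t \o k t) (h0 \o k0).
Proof.
move=> hh kk p.
apply: (@cvg_comp _ _ _ (fun q : T * bdry R n => (q.1, k q.1 q.2))
   (fun q : T * bdry R n => h q.1 q.2) (filter_prod F (nbhs p)) (filter_prod F (nbhs (k0 p)))).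
  by apply: (cvg_pair (G := F) (H := nbhs (k0 p))); [exact: cvg_fst|exact: kk].
exact: hh.
Qed.

Lemma cconv_cst (R : realType) n T (F : set_system T) {FF : Filter F}
    (h : bdry R n -> bdry R n) :
  continuous h -> cconv F (fun=> h) h.
Proof.
by move=> hc p; apply: (@cvg_comp _ _ _ snd h) (hc p); exact: cvg_snd.
Qed.

(** Uniformity in p comes from compactness of the sphere. *)
Lemma cconv_unif (R : realType) n T (F : set_system T) {FF : Filter F}
    (h : T -> bdry R n -> bdry R n) h0 (e : R) :
  cconv F h h0 -> continuous h0 -> 0 < e ->
  \forall t \near F, forall p, ball (h0 p) e (h t p).
Proof.
move=> hh h0c e0.
have /compact_near_coveringP nc := @bdry_compact R n.
have := nc T F (fun t p => ball (h0 p) e (h t p)) FF.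
have e2 : 0 < e / 2 by rewrite divr_gt0.
move=> H; suff : \forall t \near F, [set: bdry R n] `<=` (fun p => ball (h0 p) e (h t p)).
  by apply: filterS => t + p; apply.
apply: H => p _.
have /cvg_ballP /(_ _ e2) [[A B] /= [FA nB] AB] := hh p.
have /cvg_ballP /(_ _ e2) nB' := h0c p.
exists (B `&` [set x | ball (h0 p) (e / 2) (h0 x)], A) => /=.
  by split => //; exact: filterI.
move=> [x t] [/= [Bx b2] At]; have b1 := AB (t, x) (conj At Bx).
by rewrite (splitr e); apply: ball_triangle b1; exact: ball_sym.
Qed.

(** On the sphere a Moebius map is a rational function of the point and of the
    matrix, whose denominator d + e does not vanish on light vectors. *)
Lemma cconv_bact (R : realType) n T (F : set_system T) {FF : Filter F}
    (M : T -> 'M[R]_(n + (1 + 1))) (L : 'M[R]_(n + (1 + 1))) :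
  (forall t, moeb (M t)) -> moeb L -> M @ F --> L ->
  cconv F (fun t => bact (M t)) (bact L).
Proof.
move=> hM hL ML p; apply: cvg_bdry.
rewrite stereo_bact //; under eq_fun do rewrite stereo_bact //.
have [c c0 np] := nlift_stereo p.
apply: cvg_raypt.
  rewrite np -scalemxAl; apply: lightlikeZ => //.
  exact: moeb_lightlike hL (lightlike_blift p).
apply: cvg_mulmx.
  apply: cvg_nlift; apply: (@cvg_comp _ _ _ snd (@stereo R n)); first exact: cvg_snd.
  exact: stereo_continuous.
by apply: (@cvg_comp _ _ _ fst M) ML; exact: cvg_fst.
Qed.

Lemma bact_continuous (R : realType) n (L : 'M[R]_(n + (1 + 1))) :
  moeb L -> continuous (@bact R n L).
Proof.
move=> hL p; apply: (@cvg_bdry _ _ _ (nbhs (p : bdry R n))).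
rewrite stereo_bact //; under eq_fun do rewrite stereo_bact //.
have [c c0 np] := nlift_stereo p.
apply: cvg_raypt.
  rewrite np -scalemxAl; apply: lightlikeZ => //.
  exact: moeb_lightlike hL (lightlike_blift p).
apply: cvg_mulmx; last exact: cvg_cst.
by apply: cvg_nlift; exact: stereo_continuous.
Qed.

(** * Closed groups of homeomorphisms *)

Definition closed_group (R : realType) n (A : set (bdry R n -> bdry R n)) :
    Prop :=
  [/\ @transf_closed (bdry R n) A, A `<=` @homeos R n &
    forall h, homeos h ->
      (forall e : R, 0 < e -> exists2 k, A k & forall x, ball (h x) e (k x)) ->
      A h].

Lemma uniform_continuous_bdry (R : realType) n (h : bdry R n -> bdry R n)
    (e : R) :
  continuous h -> 0 < e ->
  exists2 d : R, 0 < d & forall x y, ball x d y -> ball (h x) e (h y).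
Proof.
move=> hc e0.
have /compact_near_coveringP nc := @bdry_compact R n.
have e2 : 0 < e / 2 by rewrite divr_gt0.
have H := nc R (0^'+) (fun d x => forall y, ball x d y -> ball (h x) e (h y)) _.
have {}H : \forall d \near (0 : R)^'+, [set: bdry R n] `<=`
    (fun x => forall y, ball x d y -> ball (h x) e (h y)).
  apply: H => p _; have /cvg_ballP /(_ _ e2) /nbhs_ballP[d /= d0 pd] := hc p.
  have d2 : 0 < d / 2 by rewrite divr_gt0.
  exists (ball p (d / 2), [set c | 0 < c < d / 2]) => /=.
    split; first exact: nbhsx_ballx.
    near=> c => /=; apply/andP; split => //; near: c; exact: nbhs_right_lt.
  move=> [x c] /= [px /andP[c0 cd]] y xy.
  have hx : ball (h p) (e / 2) (h x).
    by apply: pd; apply: le_ball px; lra.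
  have hy : ball (h p) (e / 2) (h y).
    apply: pd; rewrite /= (splitr d); apply: ball_triangle px _.
    by apply: le_ball xy; exact: ltW.
  by rewrite (splitr e); apply: ball_triangle hy; exact: ball_sym.
near (0 : R)^'+ => d; exists d => //.
have : [set: bdry R n] `<=` (fun x => forall y, ball x d y -> ball (h x) e (h y)).
  by near: d.
by move=> + x; apply.
Unshelve. all: by end_near. Qed.

Lemma homeos_closed (R : realType) n : @transf_closed (bdry R n) (@homeos R n).
Proof.
split.
- by split => [x|]; [exact: cvg_id|exists id; split => // x; exact: cvg_id].
- move=> g h [gc [g' [k1 k2 g'c]]] [hc [h' [k3 k4 h'c]]]; split.
    by move=> x; apply: continuous_comp; [exact: hc|exact: gc].
  exists (h' \o g'); split.
  + by move=> x /=; rewrite k1 k3.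
  + by move=> x /=; rewrite k4 k2.
  + by move=> x; apply: continuous_comp; [exact: g'c|exact: h'c].
- move=> g h [gc [g' [k1 k2 g'c]]] k3 k4.
  have -> : h = g' by apply: funext => x; rewrite -{1}(k2 x) k3.
  by split => //; exists g.
Qed.

Lemma generated_closed (T : Type) (X : set (T -> T)) :
  transf_closed (generated X).
Proof.
split.
- by move=> A [[]].
- by move=> g h hg hh A hA; case: (hA) => -[_ + _] _; apply; [apply: hg|apply: hh].
- move=> g h hg k1 k2 A hA; case: (hA) => -[_ _ hi] _; apply: hi k1 k2.
  exact: hg.
Qed.

Lemma sub_generated (T : Type) (X : set (T -> T)) : X `<=` generated X.
Proof. by move=> g Xg A [_]; apply. Qed.

Lemma closure_homeosP (R : realType) n (A : set (bdry R n -> bdry R n)) h :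
  closure_in_homeos A h <-> homeos h /\
  forall e : R, 0 < e -> exists2 k, A k & forall x, ball (h x) e (k x).
Proof.
split=> [[hcl hh]|[hh happ]]; split => //.
  move=> e e0; have : nbhs (h : {uniform bdry R n -> bdry R n})
      [set k | forall x, ball (h x) e (k x)].
    apply/uniform_nbhs; exists [set xy | ball xy.1 e xy.2]; split.
      by rewrite -entourage_ballE; exists e.
    by move=> k hk x; exact: hk.
  by move=> /hcl [k [Ak hk]]; exists k.
move=> B /uniform_nbhs [E [entE EB]].
move: entE; rewrite -entourage_ballE => -[e /= e0 eE].
have [k Ak hk] := happ _ e0; exists k; split => //.
by apply: EB => x _; apply: eE; exact: hk.
Qed.

(** For a composition, the outer map is uniformly continuous. For the inverse: if
    k is uniformly close to h, then writing points as k x shows that the inverses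
    are uniformly close, by uniform continuity of the inverse of h. *)
Lemma closed_group_closure (R : realType) n (X : set (bdry R n -> bdry R n)) :
  X `<=` @homeos R n -> closed_group (closure_in_homeos (generated X)).
Proof.
move=> Xh; have [gid gcomp ginv] := generated_closed X.
have gh : generated X `<=` @homeos R n.
  by move=> g; apply; split => //; exact: homeos_closed.
have [hid hcomp hinv] := @homeos_closed R n.
split; [split|..].
- apply/closure_homeosP; split => // e e0; exists id => // x; exact: ballxx.
- move=> g h /closure_homeosP [gh' ga] /closure_homeosP [hh' ha].
  apply/closure_homeosP; split; first exact: hcomp.
  move=> e e0; have e2 : 0 < e / 2 by rewrite divr_gt0.
  have [gc _] := gh'; have [d d0 gd] := uniform_continuous_bdry gc e2.
  have [g' Gg' gg'] := ga _ e2; have [h' Gh' hh''] := ha _ d0.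
  exists (g' \o h'); first exact: gcomp.
  move=> x; rewrite /= (splitr e); apply: ball_triangle (gg' _).
  exact: gd.
- move=> g h /closure_homeosP [gh' ga] k1 k2.
  have hh' := hinv _ _ gh' k1 k2.
  apply/closure_homeosP; split => // e e0.
  have [hc _] := hh'; have [d d0 hd] := uniform_continuous_bdry hc e0.
  have [k Gk gk] := ga _ d0; have [_ [l [kl lk _]]] := gh _ Gk.
  exists l; first exact: ginv Gk kl lk.
  move=> x; have := hd _ _ (gk (l x)).
  by rewrite lk k1 => /ball_sym.
- by move=> h [].
- move=> h hh ha; apply/closure_homeosP; split => // e e0.
  have e2 : 0 < e / 2 by rewrite divr_gt0.
  have [k /closure_homeosP[_ kc] hk] := ha _ e2.
  have [l Gl kl] := kc _ e2; exists l => // x.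
  by rewrite (splitr e); exact: ball_triangle (hk x) (kl x).
Qed.

Lemma closed_group_conj (R : realType) n (A : set (bdry R n -> bdry R n))
    (phi psi : bdry R n -> bdry R n) :
  closed_group A -> homeos phi -> cancel phi psi -> cancel psi phi ->
  closed_group [set h : bdry R n -> bdry R n | A (phi \o h \o psi)].
Proof.
move=> [[Aid Acomp Ainv] Ah Al] hphi k1 k2.
have [hid hcomp hinv] := @homeos_closed R n.
have hpsi := hinv _ _ hphi k1 k2.
split; [split|..] => /=.
- by rewrite (_ : _ \o _ = id) //; apply: funext => x /=; rewrite k2.
- move=> g h Ag Ah'; rewrite (_ : _ \o _ = (phi \o g \o psi) \o (phi \o h \o psi)).
    exact: Acomp.
  by apply: funext => x /=; rewrite k1.
- move=> g h Ag c1 c2; apply: Ainv Ag _ _ => x /=; first by rewrite k1 c1 k2.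
  by rewrite k1 c2 k2.
- move=> h /Ah hh; have -> : h = psi \o (phi \o h \o psi) \o phi.
    by apply: funext => x /=; rewrite !k1.
  by apply: (hcomp) => //; exact: hcomp.
- move=> h hh ha; apply: Al; first by apply: (hcomp) => //; exact: hcomp.
  move=> e e0; have [pc _] := hphi.
  have [d d0 pd] := uniform_continuous_bdry pc e0.
  have [k Ak hk] := ha _ d0; exists (phi \o k \o psi) => // x.
  exact: pd.
Qed.

Lemma closed_group_cconv (R : realType) n (A : set (bdry R n -> bdry R n))
    T (F : set_system T) {FF : ProperFilter F}
    (h : T -> bdry R n -> bdry R n) h0 :
  closed_group A -> homeos h0 -> cconv F h h0 ->
  (\forall t \near F, A (h t)) -> A h0.
Proof.
move=> [_ _ Al] hh0 hc At; apply: Al => // e e0.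
have hn : \forall t \near F, forall p, ball (h0 p) e (h t p).
  by apply: cconv_unif => //; case: hh0.
by have [t [At' ht]] := filter_ex (filterI At hn); exists (h t).
Qed.

Lemma homeos_bact (R : realType) n (L : 'M[R]_(n + (1 + 1))) :
  moeb L -> homeos (@bact R n L).
Proof.
move=> hL; split; first exact: bact_continuous.
exists (bact (invmx L)); split; [exact: bactK|exact: bactKV|].
exact/bact_continuous/moeb_inv.
Qed.

(** * Neighbourhoods of boundary points in the affine coordinate *)

Lemma norm_coord (R : realType) m n (A : 'M[R]_(m, n)) i j : `|A i j| <= `|A|.
Proof.
rewrite [leRHS]/Num.Def.normr/= mx_normrE; apply/bigmax_geP; right => /=.
by exists (i, j).
Qed.

Lemma norm_le (R : realType) m n (A : 'M[R]_(m, n)) a :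
  0 <= a -> (forall i j, `|A i j| <= a) -> `|A| <= a.
Proof.
by move=> a0 h; rewrite [leLHS]/Num.Def.normr/= mx_normrE; apply/bigmax_leP; split.
Qed.

Lemma norm_mulmx (R : realType) m n p (A : 'M[R]_(m, n)) (B : 'M[R]_(n, p)) :
  `|A *m B| <= n%:R * `|A| * `|B|.
Proof.
apply: norm_le => [|i j]; first by rewrite !mulr_ge0.
rewrite mxE; apply: le_trans (ler_norm_sum _ _ _) _.
apply: (@le_trans _ _ (\sum_(k < n) `|A| * `|B|)).
  by apply: ler_sum => k _; rewrite normrM ler_pM ?norm_coord.
by rewrite sumr_const card_ord -mulrA mulr_natl.
Qed.

Lemma sqnorm_le (R : realType) n (x : 'rV[R]_n) : sqnorm x <= n%:R * `|x| ^+ 2.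
Proof.
apply: (@le_trans _ _ (\sum_(k < n) `|x| ^+ 2)).
  apply: ler_sum => k _; rewrite -(ger0_norm (sqr_ge0 (x _ _))) normrX.
  by rewrite ler_sqr ?nnegrE // norm_coord.
by rewrite sumr_const card_ord mulr_natl.
Qed.

Lemma sqnorm_ge (R : realType) n (x : 'rV[R]_n) : `|x| ^+ 2 <= sqnorm x.
Proof.
rewrite -[leRHS]sqr_sqrtr ?sqnorm_ge0 // ler_sqr ?nnegrE ?sqrtr_ge0 //.
apply: norm_le => [|i j]; first exact: sqrtr_ge0.
rewrite ord1 -sqrtr_sqr ler_wsqrtr // /sqnorm (bigD1 j) //= lerDl.
by apply: sumr_ge0 => k _; exact: sqr_ge0.
Qed.

Lemma nbhs_bdry_Some (R : realType) n (x0 : 'rV[R]_n) (e : R) : 0 < e ->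
  \forall p \near (Some x0 : bdry R n),
    exists2 x, p = Some x & `|x - x0| < e.
Proof.
move=> e0; have s0 := sqnorm_ge0 x0.
pose dest (q : 'rV[R]_n * R) := (1 - q.2)^-1 *: q.1.
have destE x : dest (stereo (Some x)) = x.
  have sx := sqnorm_ge0 x.
  rewrite /dest /= scalerA (_ : _ * _ = 1) ?scale1r //.
  by field; rewrite !gt_eqF //; lra.
have q1 : (stereo (Some x0)).2 < 1 by rewrite /= ltr_pdivrMr; lra.
have h2 : (fun p : bdry R n => (stereo p).2) @ nbhs (Some x0 : bdry R n) -->
    (stereo (Some x0)).2.
  apply: (@cvg_comp _ _ _ (@stereo R n) snd); first exact: stereo_continuous.
  exact: cvg_snd.
have h1 : (fun p : bdry R n => (stereo p).1) @ nbhs (Some x0 : bdry R n) -->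
    (stereo (Some x0)).1.
  apply: (@cvg_comp _ _ _ (@stereo R n) fst); first exact: stereo_continuous.
  exact: cvg_fst.
have h : (fun p : bdry R n => dest (stereo p)) @ nbhs (Some x0 : bdry R n) -->
    dest (stereo (Some x0)).
  apply: cvgZ h1; apply: cvgV; first by rewrite subr_eq0 gt_eqF.
  by apply: cvgB h2; exact: cvg_cst.
have near1 : \forall p \near (Some x0 : bdry R n), (stereo p).2 < 1.
  exact: (cvgr_lt _ h2).
have near2 : \forall p \near (Some x0 : bdry R n),
    `|dest (stereo (Some x0)) - dest (stereo p)| < e.
  by move/cvgrPdist_lt : h => /(_ e e0).
apply: filterS (filterI near1 near2) => -[x [_]|[/=]]; last by rewrite ltxx.
by rewrite !destE distrC => hx; exists x.
Qed.

Lemma nbhs_bdry_None (R : realType) n (B : R) :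
  \forall p \near (None : bdry R n), forall x, p = Some x -> B < `|x|.
Proof.
have h2 : (fun p : bdry R n => (stereo p).2) @ nbhs (None : bdry R n) --> (1 : R).
  apply: (@cvg_comp _ _ _ (@stereo R n) snd).
    exact: (@stereo_continuous _ _ None).
  exact: cvg_snd.
pose c := 2 / (n%:R * B ^+ 2 + 1).
have d0 : 0 < n%:R * B ^+ 2 + 1.
  by rewrite ltr_pwDr // mulr_ge0 ?sqr_ge0.
have c0 : 0 < c by rewrite divr_gt0.
have near1 : \forall p \near (None : bdry R n), 1 - c < (stereo p).2.
  by apply: (cvgr_gt _ h2); lra.
apply: filterS near1 => p hp x px; move: hp; rewrite px /= => hp.
rewrite ltNge; apply/negP => xB; have s0 := sqnorm_ge0 x.
have sx : sqnorm x <= n%:R * B ^+ 2.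
  apply: le_trans (sqnorm_le x) _; rewrite ler_wpM2l // ler_sqr ?nnegrE //.
  exact: le_trans xB.
have : c <= 2 / (sqnorm x + 1).
  by rewrite /c ler_pM2l // lef_pV2 ?posrE //; lra.
have -> : 2 / (sqnorm x + 1) = 1 - (sqnorm x - 1) / (sqnorm x + 1).
  by field; rewrite gt_eqF //; lra.
lra.
Qed.

Lemma cvg_stereo_Some (R : realType) n T (F : set_system T) {FF : Filter F}
    (u : T -> 'rV[R]_n) (y : 'rV[R]_n) :
  u @ F --> y -> (fun t => stereo (Some (u t))) @ F --> stereo (Some y).
Proof.
move=> uy; have s0 := sqnorm_ge0 y; have sc := @cvg_sqnorm R T F FF n u y uy.
have hv : (fun t => (sqnorm (u t) + 1)^-1) @ F --> (sqnorm y + 1)^-1.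
  apply: cvgV; first by rewrite gt_eqF //; lra.
  by apply: cvgD sc _; exact: cvg_cst.
apply: cvg_prod.
  by apply: cvgZ uy; apply: cvgM hv; exact: cvg_cst.
by apply: cvgM hv; apply: cvgB sc _; exact: cvg_cst.
Qed.

Lemma cvg_bdry_Some (R : realType) n T (F : set_system T) {FF : Filter F}
    (u : T -> bdry R n) (y : 'rV[R]_n) :
  (forall e : R, 0 < e ->
     \forall t \near F, exists2 z, u t = Some z & `|z - y| <= e) ->
  u @ F --> (Some y : bdry R n).
Proof.
move=> h; have Sc := @cvg_stereo_Some R n _ (nbhs y) (nbhs_filter y) id y cvg_id.
apply: cvg_bdry; apply/cvg_ballP => e e0.
have /cvg_ballP /(_ _ e0) /nbhs_ballP [d /= d0 hd] := Sc.
have d2 : 0 < d / 2 by rewrite divr_gt0.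
apply: filterS (h _ d2) => t [z -> zy]; apply: (hd z).
by rewrite -ball_normE /= distrC; lra.
Qed.

Lemma cvg_bdry_None (R : realType) n T (F : set_system T) {FF : Filter F}
    (u : T -> bdry R n) :
  (forall K : R, \forall t \near F, forall x, u t = Some x -> K < `|x|) ->
  u @ F --> (None : bdry R n).
Proof.
move=> h; apply: cvg_bdry; apply/cvg_ballP => e e0.
pose K := 1 + 2 / e.
have K0 : 0 < 2 / e by rewrite divr_gt0.
apply: filterS (h K); move=> t; case: (u t) => [x|_]; last exact: ballxx.
move=> /(_ x erefl) Kx; have s1 := sqnorm_ge x.
set s := sqnorm x in s1 *; set a := `|x| in s1 Kx *.
have a1 : 1 < a by apply: le_lt_trans Kx; rewrite /K lerDl ltW.
have aa : a < a * a by rewrite ltr_pMr //; lra.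
have as_ : a < s + 1 by rewrite expr2 in s1; lra.
have sp : 0 < s + 1 by lra.
have ae : 2 < e * a.
  have : e * (2 / e) < e * a by rewrite ltr_pM2l //; move: Kx; rewrite /K; lra.
  by rewrite mulrCA mulfV ?mulr1 // gt_eqF.
split; rewrite -ball_normE /ball_ /=.
  rewrite sub0r normrN normrZ ger0_norm ?divr_ge0 ?(ltW sp) // -/a mulrAC.
  rewrite ltr_pdivrMr //; apply: (@lt_le_trans _ _ (e * a * a)).
    by rewrite ltr_pM2r //; lra.
  by rewrite -mulrA ler_pM2l // -expr2 (le_trans s1) // lerDl.
have -> : 1 - (s - 1) / (s + 1) = 2 / (s + 1).
  by field; rewrite gt_eqF.
rewrite ger0_norm ?divr_ge0 ?(ltW sp) // ltr_pdivrMr //.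
by apply: (lt_trans ae); rewrite ltr_pM2l.
Qed.

(** The second hypothesis says that points with bounded images are bounded,
    uniformly in t: this is convergence at infinity, stated without inverse
    maps. *)
Lemma cconv_affine (R : realType) n T (F : set_system T) {FF : Filter F}
    (h : T -> bdry R n -> bdry R n) (A : 'M[R]_n) (w : 'rV[R]_n) :
  (forall B e : R, 0 < e -> \forall t \near F, forall x, `|x| <= B ->
     exists2 y, h t (Some x) = Some y & `|y - (x *m A + w)| <= e) ->
  (forall K : R, exists B : R, \forall t \near F, forall p b,
     h t p = Some b -> `|b| <= K -> exists2 x, p = Some x & `|x| <= B) ->
  cconv F h (affine_ext A w).
Proof.
move=> H1 H2 [x0|] /=.
  apply: cvg_bdry_Some => e e0.
  have e2 : 0 < e / 2 by rewrite divr_gt0.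
  pose d := e / 2 / (n%:R * `|A| + 1).
  have c0 : 0 < n%:R * `|A| + 1 by rewrite ltr_pwDr // mulr_ge0.
  have d0 : 0 < d by rewrite divr_gt0.
  exists ([set t | forall x, `|x| <= `|x0| + d -> exists2 y,
       h t (Some x) = Some y & `|y - (x *m A + w)| <= e / 2],
     [set p | exists2 x, p = Some x & `|x - x0| < d]) => /=.
    by split; [exact: H1|exact: nbhs_bdry_Some].
  move=> [t p] /= [ht [x -> xx0]].
  have [|y -> hy] := ht x.
    rewrite -[x](subrK x0) addrC; apply: le_trans (ler_normD _ _) _.
    by rewrite lerD2l ltW.
  exists y => //.
  rewrite (_ : y - _ = (y - (x *m A + w)) + (x - x0) *m A); last first.
    rewrite mulmxBl; move: (x *m A) (x0 *m A) => a b.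
    by apply/rowP => i; rewrite !mxE; ring.
  apply: le_trans (ler_normD _ _) _; rewrite (splitr e) lerD //.
  apply: le_trans (norm_mulmx _ _) _.
  have : `|x - x0| * (n%:R * `|A| + 1) <= e / 2.
    by rewrite -ler_pdivlMr // ltW.
  have := normr_ge0 (x - x0); set a := `|x - x0|.
  by move=> a0; rewrite mulrDr mulr1 mulrAC mulrC; lra.
apply: cvg_bdry_None => K; have [B hB] := H2 K.
exists ([set t | forall p b, h t p = Some b -> `|b| <= K ->
         exists2 x, p = Some x & `|x| <= B],
     [set p : bdry R n | forall x, p = Some x -> B < `|x|]) => /=.
  by split; [exact: hB|exact: nbhs_bdry_None].
move=> [t p] /= [ht hp] b hb; rewrite ltNge; apply/negP => bK.
have [x px xB] := ht _ _ hb bK.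
by have := hp _ px; rewrite ltNge xB.
Qed.

Lemma affine_extM (R : realType) n (A B : 'M[R]_n) v w (p : bdry R n) :
  affine_ext B w (affine_ext A v p) = affine_ext (A *m B) (v *m B + w) p.
Proof. by case: p => [x|] //=; rewrite mulmxDl mulmxA addrA. Qed.

Lemma affine_ext1 (R : realType) n (p : bdry R n) :
  affine_ext 1%:M 0 p = p.
Proof. by case: p => [x|] //=; rewrite mulmx1 addr0. Qed.

Lemma affine_extK (R : realType) n (A : 'M[R]_n) v : A \in unitmx ->
  cancel (affine_ext A v) (affine_ext (invmx A) (- v *m invmx A)).
Proof.
move=> uA p; rewrite affine_extM mulmxV // -mulmxDl subrr mul0mx.
exact: affine_ext1.
Qed.

Lemma affine_extKV (R : realType) n (A : 'M[R]_n) v : A \in unitmx ->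
  cancel (affine_ext (invmx A) (- v *m invmx A)) (affine_ext A v).
Proof.
move=> uA p; rewrite affine_extM mulVmx // mulmxKV // addNr.
exact: affine_ext1.
Qed.

Lemma cconv_transl (R : realType) n T (F : set_system T) {FF : Filter F}
    (A : 'M[R]_n) (v : T -> 'rV[R]_n) (w : 'rV[R]_n) : A \in unitmx ->
  v @ F --> w -> cconv F (fun t => affine_ext A (v t)) (affine_ext A w).
Proof.
move=> uA vw; apply: cconv_affine => [B e e0|K].
  have /cvgrPdist_le /(_ e e0) := vw; apply: filterS => t /= ht x _.
  exists (x *m A + v t) => //.
  by rewrite opprD addrACA subrr add0r distrC.
exists (n%:R * (K + (`|w| + 1)) * `|invmx A|).
have /cvgrPdist_le /(_ 1 ltr01) := vw.
apply: filterS => t /= ht [x|//] b [<-] hb.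
exists x => //; rewrite -{1}[x](mulmxK uA).
apply: le_trans (norm_mulmx _ _) _; rewrite ler_wpM2r // ler_wpM2l //.
rewrite -[x *m A](addrK (v t)); apply: le_trans (ler_normB _ _) _.
rewrite lerD // -[v t](subrK w) [leRHS]addrC.
apply: le_trans (ler_normD _ _) _.
by rewrite lerD2r distrC.
Qed.

Lemma cconv_continuous (R : realType) n T (F : set_system T)
    {FF : ProperFilter F} (h : bdry R n -> bdry R n) :
  cconv F (fun=> h) h -> continuous h.
Proof.
move=> hc p U /(hc p) [[A B] /= [FA nB] AB].
have [t At] := filter_ex FA.
by apply: filterS nB => x Bx; exact: (AB (t, x)).
Qed.

Lemma homeos_affine (R : realType) n (A : 'M[R]_n) v :
  A \in unitmx -> homeos (affine_ext A v : bdry R n -> bdry R n).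
Proof.
have cA (B : 'M[R]_n) w : B \in unitmx -> continuous (affine_ext B w : bdry R n -> bdry R n).
  move=> uB; apply: (@cconv_continuous _ _ _ (\oo : set_system nat)).
  by apply: cconv_transl => //; exact: cvg_cst.
move=> uA; split; first exact: cA.
exists (affine_ext (invmx A) (- v *m invmx A)); split.
- exact: affine_extK.
- exact: affine_extKV.
- by apply: cA; rewrite unitmx_inv.
Qed.

(** * Moebius maps close to the identity *)

Lemma norm_mkw_le (R : realType) n (x : 'rV[R]_n) d e a :
  `|x| <= a -> `|d| <= a -> `|e| <= a -> `|mkw x d e| <= a.
Proof.
move=> xa da ea; apply: norm_le => [|i j]; first exact: le_trans xa.
rewrite ord1 /mkw; case: (split_ordP j) => k ->.
  by rewrite row_mxEl; apply: le_trans xa; exact: norm_coord.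
rewrite row_mxEr; case: (split_ordP k) => l ->; rewrite ord1.
  by rewrite row_mxEl mxE eqxx.
by rewrite row_mxEr mxE eqxx.
Qed.

Lemma norm_wx (R : realType) n (y : 'rV[R]_(n + (1 + 1))) : `|wx y| <= `|y|.
Proof. by apply: norm_le => // i j; rewrite /wx mxE norm_coord. Qed.

Lemma norm_wd (R : realType) n (y : 'rV[R]_(n + (1 + 1))) : `|wd y| <= `|y|.
Proof. by rewrite /wd !mxE norm_coord. Qed.

(** In the affine coordinate the map is (v + theta v) / (1 + eta v), where theta
    and eta are polynomial in v with coefficients of the size of L - 1. *)
Lemma bact_near1 (R : realType) n (L : 'M[R]_(n + (1 + 1))) k :
  (n + (1 + 1))%:R * (n%:R + 1) * `|L - 1%:M| <= k -> k <= 4^-1 ->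
  exists p : 'rV[R]_n, [/\ bact L (Some 0) = Some p, `|p| <= 2 * k &
    forall v : 'rV[R]_n, `|v| <= 1 ->
      exists2 y, bact L (Some v) = Some y & `|y - p - v| <= 7 * k * `|v|].
Proof.
move=> hk k4; set H := L - 1%:M in hk.
set N := (n + (1 + 1))%:R in hk.
pose z v : 'rV[R]_(n + (1 + 1)) := mkw v 1 (sqnorm v).
pose theta v := wx (z v *m H); pose eta v := wd (z v *m H).
have zL v : z v *m L = z v + z v *m H by rewrite mulmxBr mulmx1 addrC subrK.
have N0 : 0 <= N by rewrite /N ler0n.
have zH (y : 'rV[R]_(n + (1 + 1))) a : `|y| <= (n%:R + 1) * a -> 0 <= a ->
    `|y *m H| <= k * a.
  move=> ya a0; apply: le_trans (norm_mulmx _ _) _; rewrite -/N.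
  apply: (@le_trans _ _ (N * ((n%:R + 1) * a) * `|H|)).
    by rewrite ler_wpM2r // ler_wpM2l.
  rewrite (_ : N * _ * _ = N * (n%:R + 1) * `|H| * a); last by ring.
  exact: ler_wpM2r.
have n1 : 1 <= n%:R + 1 :> R by rewrite lerDr ler0n.
have h0 : `|z 0 *m H| <= k.
  rewrite -[leRHS]mulr1; apply: zH => //; rewrite mulr1.
  by apply: norm_mkw_le; rewrite ?normr0 ?sqnorm0 ?normr0 ?normr1 // ltW // ltr_pwDr.
have hd v : `|v| <= 1 -> `|z v *m H - z 0 *m H| <= k * `|v|.
  move=> v1; rewrite -mulmxBl; apply: zH => //.
  rewrite (_ : z v - z 0 = mkw v 0 (sqnorm v)); last first.
    by apply: wP; rewrite -scaleN1r ?wxD ?wdD ?weD ?wxZ ?wdZ ?weZ !mkwK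
      ?sqnorm0 ?scaler0 ?mulr0 ?addr0 // mulr1 subrr.
  apply: norm_mkw_le.
  - by rewrite ler_peMl.
  - by rewrite normr0 mulr_ge0 // (le_trans _ n1).
  - rewrite ger0_norm ?sqnorm_ge0 //; apply: le_trans (sqnorm_le _) _.
    rewrite mulrDl mul1r ler_wpDr // ler_wpM2l // expr2.
    by rewrite ler_piMr.
have k0 : 0 <= k by apply: le_trans h0.
have et0 : `|eta 0| <= k by apply: le_trans (norm_wd _) h0.
have th0 : `|theta 0| <= k by apply: le_trans (norm_wx _) h0.
have etd v : `|v| <= 1 -> `|eta v - eta 0| <= k * `|v|.
  move=> v1; rewrite /eta -[- wd _]mulN1r -wdZ -wdD scaleN1r.
  exact: le_trans (norm_wd _) (hd _ v1).
have thd v : `|v| <= 1 -> `|theta v - theta 0| <= k * `|v|.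
  move=> v1; rewrite /theta -scaleN1r -wxZ -wxD scaleN1r.
  exact: le_trans (norm_wx _) (hd _ v1).
have etv v : `|v| <= 1 -> `|eta v| <= 2 * k.
  move=> v1; rewrite -[eta v](subrK (eta 0)).
  apply: le_trans (ler_normD _ _) _; have := etd _ v1.
  have : k * `|v| <= k by rewrite ler_piMr.
  lra.
have wdv v : wd (z v *m L) = 1 + eta v by rewrite zL wdD mkwK.
have wxv v : wx (z v *m L) = v + theta v by rewrite zL wxD mkwK.
have pos v : `|v| <= 1 -> 2^-1 <= 1 + eta v.
  by move/etv; rewrite ler_norml => /andP[]; lra.
have bv v : `|v| <= 1 -> bact L (Some v) = Some ((1 + eta v)^-1 *: (v + theta v)).
  move=> v1; rewrite /bact /= -/(z v) /bpt wdv wxv.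
  by rewrite gt_eqF //; have := pos _ v1; lra.
have inv v : `|v| <= 1 -> `|(1 + eta v)^-1| <= 2.
  move=> /pos h; rewrite ger0_norm ?invr_ge0; last by lra.
  by rewrite -[leRHS]invrK lef_pV2 ?posrE //; lra.
have z1 : `|0 : 'rV[R]_n| <= 1 by rewrite normr0.
exists ((1 + eta 0)^-1 *: (0 + theta 0)); split; first exact: bv.
  by rewrite normrZ add0r ler_pM // inv.
move=> v v1; exists ((1 + eta v)^-1 *: (v + theta v)); first exact: bv.
set a := (1 + eta v)^-1; set b := (1 + eta 0)^-1.
have -> : a *: (v + theta v) - b *: (0 + theta 0) - v =
    a *: (theta v - theta 0) - (a * eta v) *: v
    + ((eta 0 - eta v) * a * b) *: theta 0.
  have ha : a * (1 + eta v) = 1 by rewrite mulVf //; have := pos _ v1; lra.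
  have hb : b * (1 + eta 0) = 1 by rewrite mulVf //; have := pos _ z1; lra.
  have e1 : (eta 0 - eta v) * a * b = a - b.
    rewrite (_ : _ * a * b = a * (b * (1 + eta 0)) - b * (a * (1 + eta v))); last by ring.
    by rewrite ha hb !mulr1.
  have e2 : a * eta v = 1 - a by rewrite -ha; ring.
  rewrite e1 e2; apply/rowP => i; rewrite !mxE; ring.
have va := normr_ge0 v.
have t1 : `|a *: (theta v - theta 0)| <= 2 * (k * `|v|).
  by rewrite normrZ ler_pM // ?inv ?thd.
have t2 : `|(a * eta v) *: v| <= 4 * k * `|v|.
  rewrite normrZ ler_wpM2r // normrM (_ : 4 * k = 2 * (2 * k)); last by ring.
  by rewrite ler_pM // ?inv ?etv.
have t3 : `|((eta 0 - eta v) * a * b) *: theta 0| <= k * `|v| * 2 * 2 * k.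
  rewrite normrZ !normrM ler_pM // ?mulr_ge0 // ler_pM // ?mulr_ge0 ?inv //.
  by rewrite ler_pM // ?inv // distrC etd.
have t4 : k * `|v| * 2 * 2 * k <= k * `|v|.
  rewrite -[leRHS]mulr1 -!mulrA; do 2 apply: ler_wpM2l => //; lra.
apply: le_trans (ler_normD _ _) _; apply: le_trans (lerD (ler_normB _ _) (lexx _)) _.
lra.
Qed.

(** For M close to the identity, M is to first order at 0 the translation by
    p = M 0. *)
Lemma moeb_near1 (R : realType) n T (F : set_system T) {FF : Filter F}
    (M : T -> 'M[R]_(n + (1 + 1))) (e : R) :
  M @ F --> (1%:M : 'M[R]_(n + (1 + 1))) -> 0 < e ->
  \forall t \near F,
  exists p : 'rV[R]_n, [/\ bact (M t) (Some 0) = Some p, `|p| <= e &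
    forall v : 'rV[R]_n, `|v| <= 1 ->
      exists2 y, bact (M t) (Some v) = Some y & `|y - p - v| <= e * `|v|].
Proof.
move=> M1 e0; pose k := Num.min 4^-1 (e / 7).
have k0 : 0 < k by rewrite lt_min divr_gt0 // andbT; lra.
have k4 : k <= 4^-1 by rewrite ge_min lexx.
have ke : k <= e / 7 by rewrite ge_min lexx orbT.
pose c : R := (n + (1 + 1))%:R * (n%:R + 1) + 1.
have c1 : 1 <= c by rewrite lerDr mulr_ge0 // addr_ge0.
have d0 : 0 < k / c by rewrite divr_gt0 //; lra.
move/cvgrPdistC_le : M1 => /(_ _ d0); apply: filterS => t hM.
have [|p [pE pk H]] := @bact_near1 R n (M t) k _ k4.
  apply: le_trans (_ : c * `|M t - 1%:M| <= _).
    by rewrite ler_wpM2r // lerDl.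
  by rewrite mulrC -ler_pdivlMr //; lra.
exists p; split => //; first by lra.
move=> v v1; have [y yE hy] := H v v1; exists y => //.
by apply: le_trans hy _; rewrite ler_wpM2r //; lra.
Qed.

(** * Zooming in at the fixed point *)

(** Differentiability at 0 with derivative A, together with a lower bound that
    makes f proper at 0. The latter controls the behaviour near infinity of the
    maps obtained by zooming in. *)
Definition tangent_at0 (R : realType) n (f : bdry R n -> bdry R n)
    (A : 'M[R]_n) : Prop :=
  (forall e : R, 0 < e -> exists2 r : R, 0 < r & forall v, `|v| <= r ->
     exists2 y, f (Some v) = Some y & `|y - v *m A| <= e * `|v|) /\
  (exists c d : R, [/\ 0 < c, 0 < d & forall q y, f q = Some y -> `|y| <= d ->
     exists2 v, q = Some v & `|v| <= c * `|y|]).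

Definition zoom (R : realType) n (s : R) (f : bdry R n -> bdry R n) :
    bdry R n -> bdry R n :=
  affine_ext s%:M 0 \o f \o affine_ext s^-1%:M 0.

Lemma zoom_Some (R : realType) n (s : R) (f : bdry R n -> bdry R n) v y :
  f (Some (s^-1 *: v)) = Some y -> zoom s f (Some v) = Some (s *: y).
Proof.
by rewrite /zoom /= addr0 mul_mx_scalar => -> /=; rewrite mul_mx_scalar addr0.
Qed.

Lemma zoom_inv (R : realType) n (s : R) (f : bdry R n -> bdry R n) q y :
  s != 0 -> zoom s f q = Some y ->
  exists2 q', f q' = Some (s^-1 *: y) &
    forall v', q' = Some v' -> q = Some (s *: v').
Proof.
move=> s0 h; exists (affine_ext s^-1%:M 0 q).
  move: h; rewrite /zoom /=; case: (f _) => [x|] //= [<-].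
  by rewrite mul_mx_scalar addr0 scalerA mulVf // scale1r.
case: q h => [x|] //= _ v' [<-].
by rewrite mul_mx_scalar addr0 scalerA mulfV // scale1r.
Qed.

(** A ball of radius B, seen at scale s t, is a ball of radius B / s t, where
    f is linear to first order. *)
Lemma zoom_near0 (R : realType) n T (F : set_system T) {FF : Filter F}
    (s : T -> R) (f : bdry R n -> bdry R n) (A : 'M[R]_n) (B e : R) :
  tangent_at0 f A -> s @ F --> +oo -> 0 < e ->
  \forall t \near F, forall v, `|v| <= B ->
    exists2 y, zoom (s t) f (Some v) = Some y & `|y - v *m A| <= e * `|v|.
Proof.
move=> [f1 _] sF e0; have [r r0 hr] := f1 _ e0.
have near1 : \forall t \near F, 0 < s t.
  by move/cvgryPgt : sF; apply.
have near2 : \forall t \near F, B / r < s t.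
  by move/cvgryPgt : sF; apply.
apply: filterS (filterI near1 near2) => t [st0 st] v vB.
have [|y yE hy] := hr ((s t)^-1 *: v).
  rewrite normrZ ger0_norm ?invr_ge0 ?(ltW st0) // ler_pdivrMl //.
  apply: le_trans vB _; by move: st; rewrite ltr_pdivrMr // => /ltW.
exists (s t *: y); first exact: zoom_Some.
have -> : s t *: y - v *m A = s t *: (y - ((s t)^-1 *: v) *m A).
  by rewrite scalerBr -scalemxAl scalerA mulfV ?scale1r // gt_eqF.
rewrite normrZ ger0_norm ?(ltW st0) // -ler_pdivlMl //.
apply: le_trans hy _.
by rewrite normrZ ger0_norm ?invr_ge0 ?(ltW st0) // mulrCA.
Qed.

Lemma zoom_proper (R : realType) n (f : bdry R n -> bdry R n) (A : 'M[R]_n) :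
  tangent_at0 f A ->
  exists2 c : R, 0 < c & forall T (F : set_system T) (s : T -> R) (B : R),
    Filter F -> s @ F --> +oo ->
    \forall t \near F, forall q y, zoom (s t) f q = Some y -> `|y| <= B ->
      exists2 v, q = Some v & `|v| <= c * `|y|.
Proof.
move=> [_ [c [d [c0 d0 h]]]]; exists c => // T F s B FF sF.
have near1 : \forall t \near F, 0 < s t.
  by move/cvgryPgt : sF; apply.
have near2 : \forall t \near F, B / d < s t.
  by move/cvgryPgt : sF; apply.
apply: filterS (filterI near1 near2) => t [st0 st] q y /zoom_inv.
case; first by rewrite gt_eqF.
move=> q' fq' qE yB; have [|v' q'E v'y] := h _ _ fq'.
  rewrite normrZ ger0_norm ?invr_ge0 ?(ltW st0) // ler_pdivrMl //.
  apply: le_trans yB _; by move: st; rewrite ltr_pdivrMr // => /ltW.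
exists (s t *: v'); first exact: qE.
move: v'y; rewrite !normrZ !ger0_norm ?invr_ge0 ?(ltW st0) // => v'y.
by rewrite -ler_pdivlMl // mulrCA.
Qed.

Lemma norm_mulmx_le (R : realType) n (A : 'M[R]_n) (v : 'rV[R]_n) :
  `|v *m A| <= (n%:R * `|A|) * `|v|.
Proof. by apply: le_trans (norm_mulmx _ _) _; rewrite mulrAC. Qed.

Lemma cconv_zoom (R : realType) n T (F : set_system T) {FF : Filter F}
    (s : T -> R) (f : bdry R n -> bdry R n) (A : 'M[R]_n) :
  tangent_at0 f A -> s @ F --> +oo ->
  cconv F (fun t => zoom (s t) f) (affine_ext A 0).
Proof.
move=> tf sF; apply: cconv_affine => [B e e0|K].
  pose e' := e / (`|B| + 1).
  have e'0 : 0 < e' by rewrite divr_gt0 // ltr_pwDr.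
  apply: filterS (zoom_near0 B tf sF e'0) => t h v vB.
  have [y yE hy] := h v vB; exists y => //; rewrite addr0.
  apply: le_trans hy _; rewrite /e' mulrAC ler_pdivrMr ?ltr_pwDr //.
  rewrite ler_pM2l //; apply: le_trans vB _.
  by rewrite ler_wpDr // ler_norm.
have [c c0 h] := zoom_proper tf; exists (c * K).
apply: filterS (h T F s K FF sF) => t ht q y qy yK.
have [v -> vy] := ht q y qy yK; exists v => //.
by apply: le_trans vy _; rewrite ler_pM2l.
Qed.

(** The errors are relative to the distance to the fixed point p t, not to the
    distance to 0: this is what survives a rescaling by a factor of 1 / |p t|. *)
Definition tangent_family (R : realType) n T (F : set_system T)
    (alpha : T -> bdry R n -> bdry R n) (A : 'M[R]_n) (p : T -> 'rV[R]_n) :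
    Prop :=
  (forall e : R, 0 < e -> exists2 r : R, 0 < r &
     \forall t \near F, forall y, `|y| <= r ->
       exists2 b, alpha t (Some y) = Some b &
         `|b - (p t + (y - p t) *m A)| <= e * `|y - p t|) /\
  (forall r : R, 0 < r -> exists2 d : R, 0 < d &
     \forall t \near F, forall q b, alpha t q = Some b -> `|b| <= d ->
       exists2 y, q = Some y & `|y| <= r).

(** Write y = M t v with v small: M t is controlled to first order at 0, and so is
    the zoomed map, whose fixed point is 0. *)
Lemma tangent_family_conj (R : realType) n T (F : set_system T)
    {FF : Filter F} (s : T -> R) (f : bdry R n -> bdry R n) (A : 'M[R]_n)
    (M : T -> 'M[R]_(n + (1 + 1))) (p : T -> 'rV[R]_n) :
  tangent_at0 f A -> s @ F --> +oo -> (forall t, moeb (M t)) ->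
  M @ F --> (1%:M : 'M[R]_(n + (1 + 1))) ->
  (fun t => invmx (M t)) @ F --> (1%:M : 'M[R]_(n + (1 + 1))) ->
  (\forall t \near F, bact (M t) (Some 0) = Some (p t)) ->
  tangent_family F
    (fun t => bact (M t) \o zoom (s t) f \o bact (invmx (M t))) A p.
Proof.
move=> tf sF hM M1 I1 hp; set a := n%:R * `|A|.
have a0 : 0 <= a by rewrite mulr_ge0.
split=> [e e0|r r0].
  (* For v of norm at most R1 the image of v by the zoomed map still has norm at
     most 1, so that the first order estimate for M t applies to it. *)
  pose R1 : R := (a + 2)^-1.
  have R10 : 0 < R1 by rewrite invr_gt0; lra.
  have R11 : R1 <= 1 by rewrite invf_le1; lra.
  have aR1 : (a + 1) * R1 <= 1.
    by rewrite /R1 ler_pdivrMr; lra.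
  pose e1 := Num.min (e / (4 * (a + 1))) (Num.min 2^-1 (R1 / 4)).
  have e10 : 0 < e1.
    by rewrite !lt_min !divr_gt0 ?mulr_gt0 //; lra.
  have [e1a e1b e1c] : [/\ e1 <= e / (4 * (a + 1)), e1 <= 2^-1 & e1 <= R1 / 4].
    by rewrite /e1; split; rewrite !ge_min lexx ?orbT.
  exists (R1 / 4); first by rewrite divr_gt0.
  have near1 := @moeb_near1 R n T F FF M e1 M1 e10.
  have near2 := @moeb_near1 R n T F FF _ e1 I1 e10.
  have near3 := @zoom_near0 R n T F FF s f A 1 e1 tf sF e10.
  apply: filterS (filterI (filterI near1 near2) (filterI near3 hp)).
  move=> t [[[p1 [p1E _ h1]] [p2 [_ p2e h2]]] [h3 ptE]] y yR.
  have {p1E} p1E : p1 = p t by move: p1E; rewrite ptE => -[].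
  rewrite {}p1E in h1.
  have y1 : `|y| <= 1 by lra.
  have [v vE hv] := h2 y y1.
  have Mv : bact (M t) (Some v) = Some y by rewrite -vE bactKV.
  have vR : `|v| <= R1.
    rewrite (_ : v = (v - p2 - y) + (p2 + y)); last first.
      by apply/rowP => i; rewrite !mxE; ring.
    apply: le_trans (ler_normD _ _) _.
    have := ler_normD p2 y.
    have : e1 * `|y| <= e1 by rewrite ler_piMr // ltW.
    by move: hv p2e yR e1c R10; clear; lra.
  have v1 : `|v| <= 1 by exact: le_trans vR R11.
  have [y' y'E hy] := h1 v v1.
  have {y'E} yE : y' = y by move: y'E; rewrite Mv => -[].
  rewrite {}yE in hy.
  have [w wE hw] := h3 v v1.
  have wv : `|w| <= (a + 1) * `|v|.
    rewrite -[w](subrK (v *m A)); apply: le_trans (ler_normD _ _) _.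
    have := norm_mulmx_le A v; rewrite -/a.
    have : e1 * `|v| <= `|v|.
      by rewrite ler_piMl //; apply: le_trans e1b _; clear; lra.
    by move: hw; clear; lra.
  have w1 : `|w| <= 1.
    apply: le_trans wv _; apply: le_trans aR1.
    by rewrite ler_wpM2l // addr_ge0.
  have [b bE hb] := h1 w w1.
  exists b; first by rewrite /= vE wE.
  have vy : `|v| <= 2 * `|y - p t|.
    have : `|v| <= `|y - p t| + `|y - p t - v|.
      by rewrite -{1}(subKr (y - p t) v); exact: ler_normB.
    have : e1 * `|v| <= 2^-1 * `|v| by rewrite ler_wpM2r.
    by move: hy; clear; lra.
  have -> : b - (p t + (y - p t) *m A) =
      (b - p t - w) + (w - v *m A) - (y - p t - v) *m A.
    rewrite [(y - p t - v) *m A]mulmxBl; move: ((y - p t) *m A) (v *m A) => X Y.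
    by apply/rowP => i; rewrite !mxE; ring.
  have b1 : `|b - p t - w| <= e1 * ((a + 1) * `|v|).
    by apply: le_trans hb _; rewrite ler_pM2l.
  have b2 : `|(y - p t - v) *m A| <= a * (e1 * `|v|).
    by apply: le_trans (norm_mulmx_le _ _) _; rewrite -/a ler_wpM2l.
  apply: le_trans (ler_normB _ _) _.
  have b3 := ler_normD (b - p t - w) (w - v *m A).
  have b4 : 4 * (a + 1) * e1 <= e.
    by rewrite mulrC -ler_pdivlMr // mulr_gt0 // ltr_wpDl.
  have b5 : 4 * (a + 1) * e1 * `|y - p t| <= e * `|y - p t|.
    by rewrite ler_wpM2r.
  have b6 : (2 * (a + 1) * e1) * `|v| <= (2 * (a + 1) * e1) * (2 * `|y - p t|).
    by rewrite ler_wpM2l // !mulr_ge0 // ?(ltW e10) // addr_ge0.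
  by move: b1 b2 b3 b5 b6 hw; clear; lra.
have [c c0 hc] := zoom_proper tf.
(* If b has norm at most d, then its image w by invmx (M t) has norm at most
   3 d, the point v it comes from at most 3 c d <= 1, and y at most
   d + 2 (3 c d) <= r. *)
pose d := Num.min (Num.min 1 (3 * c)^-1) (r / (1 + 6 * c)).
have d0 : 0 < d by rewrite !lt_min ltr01 invr_gt0 mulr_gt0 // divr_gt0 //; lra.
have [d1 d2 d3] : [/\ d <= 1, d <= (3 * c)^-1 & d <= r / (1 + 6 * c)].
  by rewrite /d; split; rewrite !ge_min lexx ?orbT.
have d2' : 3 * c * d <= 1.
  by move: d2; rewrite -ler_pdivlMl ?mulr1 // mulr_gt0.
have d3' : d * (1 + 6 * c) <= r by rewrite -ler_pdivlMr //; lra.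
exists d => //.
have near1 := @moeb_near1 R n T F FF M d M1 d0.
have near2 := @moeb_near1 R n T F FF _ d I1 d0.
have near3 := hc T F s (3 * d) FF sF.
apply: filterS (filterI (filterI near1 near2) near3).
move=> t [[[p1 [_ p1d h1]] [p2 [_ p2d h2]]] h3] q b /= qb bd.
have b1 : `|b| <= 1 by exact: le_trans bd d1.
have [w wE hw] := h2 b b1.
have zw : zoom (s t) f (bact (invmx (M t)) q) = Some w.
  by rewrite -wE -qb bactK.
have wd : `|w| <= 3 * d.
  rewrite (_ : w = (w - p2 - b) + (p2 + b)); last first.
    by apply/rowP => i; rewrite !mxE; ring.
  apply: le_trans (ler_normD _ _) _.
  have := ler_normD p2 b.
  have : d * `|b| <= d by rewrite ler_piMr // ltW.
  by move: hw p2d bd; clear; lra.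
have [v vE hv] := h3 _ _ zw wd.
have vd : `|v| <= 3 * c * d.
  apply: le_trans hv _; rewrite (_ : 3 * c * d = c * (3 * d)); last by ring.
  by rewrite ler_pM2l.
have v1 : `|v| <= 1 by exact: le_trans vd d2'.
have [y yE hy] := h1 v v1.
exists y; first by rewrite -yE -vE bactKV.
rewrite (_ : y = (y - p1 - v) + (p1 + v)); last first.
  by apply/rowP => i; rewrite !mxE; ring.
apply: le_trans (ler_normD _ _) _.
have := ler_normD p1 v.
have : d * `|v| <= `|v| by rewrite ler_piMl.
by move: hy p1d vd d3'; clear; lra.
Qed.

(** * From the tangent family to a flow of translations *)

Lemma ultra_bounded_mx (R : realType) m n T (F : set_system T)
    (f : T -> 'M[R]_(m, n)) (B : R) :
  UltraFilter F -> (\forall t \near F, `|f t| <= B) ->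
  exists M : 'M[R]_(m, n), f @ F --> M.
Proof.
move=> FU hB.
have H i j : exists l : R, (fun t => f t i j) @ F --> l.
  have [|l _ hl] := @ultra_cvg T F R (fun t => f t i j) `[- B, B]%classic FU
    (@segment_compact R (- B) B).
    apply: filterS hB => t ht; rewrite /preimage /= in_itv /= -ler_norml.
    exact: le_trans (norm_coord _ _ _) ht.
  by exists l.
exists (\matrix_(i, j) sval (cid (H i j))); apply: cvg_mx => i j.
by rewrite mxE; exact: svalP (cid (H i j)).
Qed.

Lemma expr_bracket (R : realType) (mu a : R) : 0 < mu < 1 -> 0 < a <= 1 ->
  exists m : nat, mu ^+ m.+1 < a <= mu ^+ m.
Proof.
move=> /andP[mu0 mu1] /andP[a0 a1].
have ex : exists m, mu ^+ m < a.
  have /cvgrPdist_lt /(_ _ a0) [N _ /(_ N (leqnn N))] : (fun m => mu ^+ m) @ \oo --> (0 : R).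
    by apply: cvg_expr; rewrite ger0_norm // ltW.
  rewrite sub0r normrN ger0_norm ?exprn_ge0 ?(ltW mu0) // => h.
  by exists N.
case: (ex_minnP ex) => -[|m] hm mmin.
  by move: hm; rewrite expr0 ltNge a1.
exists m; rewrite hm /= leNgt; apply/negP => /mmin.
by rewrite ltnn.
Qed.

(** The powers D m of a linear contraction conjugate to a similarity of ratio
    mu, with their inverses E m. *)
Definition similarity_powers (R : realType) n (D E : nat -> 'M[R]_n)
    (k mu : R) : Prop :=
  [/\ 0 < k, 0 < mu < 1, forall m, D m *m E m = 1%:M,
      forall m (x : 'rV[R]_n), `|x *m D m| <= k * mu ^+ m * `|x|
    & forall m (x : 'rV[R]_n), `|x *m E m| <= k * (mu ^+ m)^-1 * `|x|].

Lemma mulmx_conj_affine (R : realType) n (b p x : 'rV[R]_n)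
    (A D E : 'M[R]_n) :
  D *m E = 1%:M -> A *m E = E *m A ->
  (b - (p + (x *m D - p) *m A)) *m E = b *m E - (p *m E + (x - p *m E) *m A).
Proof.
move=> DE AE; rewrite (mulmxBl b) (mulmxDl p); congr (_ - (_ + _)).
by rewrite -mulmxA AE mulmxA mulmxBl -(mulmxA x) DE mulmx1.
Qed.

Lemma distortion_cancel (R : realType) (k c e x : R) : c != 0 ->
  k * c^-1 * (e * (k * c * x)) = k * k * e * x.
Proof. by move=> c0; field. Qed.

(** Conjugating by powers of D that bring the fixed points p t to a bounded
    distance from 0, bounded below, the limit is an affine map with linear part
    A and with a fixed point other than 0. The distortion of D m and of E m
    compensate each other because D is conjugate to a similarity. *)
Lemma tangent_family_limit (R : realType) n T (F : set_system T)
    (Gam : set (bdry R n -> bdry R n))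
    (alpha : T -> bdry R n -> bdry R n) (A : 'M[R]_n) (p : T -> 'rV[R]_n)
    (D E : nat -> 'M[R]_n) (k mu : R) :
  UltraFilter F -> closed_group Gam -> A \in unitmx ->
  tangent_family F alpha A p -> p @ F --> (0 : 'rV[R]_n) ->
  (\forall t \near F, p t != 0) -> (\forall t \near F, Gam (alpha t)) ->
  similarity_powers D E k mu -> (forall m, A *m D m = D m *m A) ->
  (forall m, Gam (affine_ext (D m) 0)) ->
  exists2 z : 'rV[R]_n, z != 0 & Gam (affine_ext A (z - z *m A)).
Proof.
move=> FU cG uA [K1 K2] p0 pn0 Ga [k0 mu01 DE Dle Ele] AD GD.
have /andP[mu0 mu1] := mu01; have [[Gid Gcomp Ginv] Gh Gcl] := cG.
have ED m : E m *m D m = 1%:M by apply: mulmx1C.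
have AE m : A *m E m = E m *m A.
  by rewrite -[LHS]mul1mx -(ED m) -!mulmxA (mulmxA (D m) A) -AD -mulmxA DE mulmx1.
have GE m : Gam (affine_ext (E m) 0).
  apply: Ginv (GD m) _ _ => x.
    by rewrite affine_extM DE mul0mx addr0 affine_ext1.
  by rewrite affine_extM ED mul0mx addr0 affine_ext1.
(* The power that brings p t to norm about 1. *)
pose m t := get [set i : nat | mu ^+ i.+1 < `|p t| <= mu ^+ i].
have pm : \forall t \near F, mu ^+ (m t).+1 < `|p t| <= mu ^+ m t.
  have /cvgr0Pnorm_le /(_ 1 ltr01) p1 := p0.
  apply: filterS (filterI p1 pn0) => t [pt1 ptn0].
  have [|i hi] := @expr_bracket R mu `|p t| mu01.
    by rewrite normr_gt0 ptn0.
  apply: (@getPex _ [set i : nat | mu ^+ i.+1 < `|p t| <= mu ^+ i]).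
  by exists i.
have muX i : 0 < mu ^+ i by rewrite exprn_gt0.
have small (r C : R) : 0 < r -> 0 < C -> \forall t \near F, C * mu ^+ m t <= r.
  move=> r0 C0; have d0 : 0 < r * mu / C by rewrite divr_gt0 // mulr_gt0.
  have /cvgr0Pnorm_le /(_ _ d0) p1 := p0.
  apply: filterS (filterI p1 pm) => t [pt1 /andP[h _]].
  have := lt_le_trans h pt1; rewrite exprS mulrC ltr_pdivlMr //.
  rewrite mulrAC ltr_pM2r // mulrC; exact: ltW.
pose z t := p t *m E (m t).
have zk : \forall t \near F, `|z t| <= k.
  apply: filterS pm => t /andP[_ h]; apply: le_trans (Ele _ _) _.
  by rewrite -mulrA ler_piMr ?(ltW k0) // mulrC ler_pdivrMr ?mul1r.
have zD t : z t *m D (m t) = p t by rewrite /z -mulmxA ED mulmx1.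
have zlow : \forall t \near F, mu / k < `|z t|.
  apply: filterS pm => t /andP[h _]; rewrite ltr_pdivrMr //.
  rewrite -(ltr_pM2r (muX (m t))); apply: lt_le_trans (_ : `|p t| <= _).
    by rewrite -exprS.
  by rewrite -(zD t) (le_trans (Dle _ _)) // mulrC mulrA.
have [zz hz] := ultra_bounded_mx FU zk.
have FF : ProperFilter F by apply: ultra_proper.
exists zz.
  apply/eqP => zz0; rewrite zz0 in hz.
  have /cvgr0Pnorm_lt /(_ _ (divr_gt0 mu0 k0)) z1 := hz.
  have [t [h1 h2]] := filter_ex (filterI z1 zlow).
  by have := lt_trans h1 h2; rewrite ltxx.
pose beta t := affine_ext (E (m t)) 0 \o alpha t \o affine_ext (D (m t)) 0.
set a := n%:R * `|invmx A| + 1.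
have a1 : 1 <= a by rewrite lerDr mulr_ge0.
have Alow (u : 'rV[R]_n) : `|u| <= a * `|u *m A|.
  rewrite -{1}[u](mulmxK uA); apply: le_trans (norm_mulmx_le _ _) _.
  by rewrite ler_wpM2r // lerDl.
apply: (@closed_group_cconv R n Gam T F FF beta) => //.
- exact: homeos_affine.
- apply: cconv_affine => [B e e0|K].
  + pose B' := `|B| + k + 1.
    have B'0 : 0 < B' by rewrite ltr_wpDl // addr_ge0 // ltW.
    (* The factor k * k is the distortion of D m and E m. *)
    pose e1 := e / 2 / (k * k * B').
    have e10 : 0 < e1 by rewrite !divr_gt0 ?mulr_gt0.
    have [r r0 hr] := K1 _ e10.
    have hw : (fun t => z t - z t *m A) @ F --> zz - zz *m A.
      by apply: (cvgB (FF := FF) (hz)); apply: (cvg_mulmx (FF := FF) (hz)); exact: cvg_cst.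
    have e2 : 0 < e / 2 by rewrite divr_gt0.
    have /cvgrPdistC_le /(_ _ e2) hw2 := hw.
    have hs := small r (k * B') r0 (mulr_gt0 k0 B'0).
    apply: filterS (filterI (filterI hr hw2) (filterI hs zk)).
    move=> t [[ht hwt] [hst zt]] x xB.
    have xB' : `|x| <= B'.
      apply: le_trans xB _; apply: le_trans (ler_norm B) _.
      by rewrite /B' -addrA lerDl addr_ge0 // ltW.
    have xzB' : `|x - z t| <= B'.
      apply: le_trans (ler_normB _ _) _; rewrite /B' ler_wpDr // lerD //.
      exact: le_trans xB (ler_norm B).
    have [|b bE hb] := ht (x *m D (m t)).
      apply: le_trans (Dle _ _) _; apply: le_trans hst.
      by rewrite mulrAC ler_wpM2r ?(ltW (muX _)) // ler_wpM2l // ltW.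
    exists (b *m E (m t)); first by rewrite /beta /= addr0 bE /= addr0.
    have -> : b *m E (m t) - (x *m A + (zz - zz *m A)) =
        (b - (p t + (x *m D (m t) - p t) *m A)) *m E (m t)
        + ((z t - z t *m A) - (zz - zz *m A)).
      rewrite mulmx_conj_affine // -/(z t) mulmxBl.
      move: (x *m A) (z t *m A) (zz *m A) (b *m E (m t)) => X1 X2 X3 X4.
      by apply/rowP => i; rewrite !mxE; ring.
    apply: le_trans (ler_normD _ _) _; rewrite (splitr e) lerD //.
    apply: le_trans (Ele _ _) _.
    apply: (@le_trans _ _ (k * (mu ^+ m t)^-1 * (e1 * (k * mu ^+ m t * B')))).
      apply: ler_wpM2l; first by rewrite mulr_ge0 ?invr_ge0 ?ltW.
      apply: le_trans hb _; apply: ler_wpM2l; first exact: ltW.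
      rewrite -{1}(zD t) -mulmxBl; apply: le_trans (Dle _ _) _.
      by apply: ler_wpM2l xzB'; rewrite mulr_ge0 ?ltW.
    rewrite distortion_cancel ?gt_eqF // mulrAC mulrC /e1 divfK //.
    by rewrite gt_eqF // !mulr_gt0.
  (* With this choice of e1 the error is at most half of the lower bound
     given by Alow for (x - z t) *m A, and x - z t is bounded by b0 - z t. *)
  + pose e1 := (2 * a * (k * k))^-1.
    have a0 : 0 < a by apply: lt_le_trans a1.
    have e10 : 0 < e1 by rewrite invr_gt0 !mulr_gt0.
    have [r r0 hr] := K1 _ e10; have [d d0 hd] := K2 _ r0.
    exists (2 * a * (`|K| + k) + k).
    have K'0 : 0 < k * (`|K| + 1) by rewrite mulr_gt0 // ltr_wpDl.
    have hs := small d _ d0 K'0.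
    apply: filterS (filterI (filterI hr hd) (filterI hs zk)).
    move=> t [[ht hdt] [hst zt]] q b0; rewrite /beta /=.
    case qE: (alpha t _) => [b|] //= [bE] bK.
    have bD : b = b0 *m D (m t).
      by rewrite -bE addr0 -mulmxA ED mulmx1.
    have [|y yE yr] := hdt _ _ qE.
      rewrite bD; apply: le_trans (Dle _ _) _; apply: le_trans hst.
      rewrite mulrAC ler_wpM2r ?(ltW (muX _)) // ler_wpM2l ?(ltW k0) //.
      by apply: le_trans bK _; apply: le_trans (ler_norm K) _; rewrite lerDl.
    case: q qE yE => [x|] //= qE [yE]; rewrite addr0 in yE.
    exists x => //.
    have [b' b'E hb] := ht y yr.
    have {b'E} bb : b' = b by move: qE; rewrite addr0 yE b'E => -[].
    rewrite {}bb bD -yE in hb.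
    have xz : `|(b0 - z t) - (x - z t) *m A| <= (2 * a)^-1 * `|x - z t|.
      have -> : (b0 - z t) - (x - z t) *m A =
         (b0 *m D (m t) - (p t + (x *m D (m t) - p t) *m A)) *m E (m t).
        rewrite mulmx_conj_affine // -/(z t) mulmxBl -(mulmxA b0) DE mulmx1.
        move: (x *m A) (z t *m A) => X1 X2.
        by apply/rowP => i; rewrite !mxE; ring.
      apply: le_trans (Ele _ _) _.
      apply: (@le_trans _ _ (k * (mu ^+ m t)^-1 * (e1 * (k * mu ^+ m t * `|x - z t|)))).
        apply: ler_wpM2l; first by rewrite mulr_ge0 ?invr_ge0 ?ltW.
        apply: le_trans hb _; apply: ler_wpM2l; first exact: ltW.
        by rewrite -{1}(zD t) -mulmxBl; apply: le_trans (Dle _ _) _.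
      rewrite distortion_cancel ?gt_eqF // ler_wpM2r // mulrC /e1 (invfM (2 * a)).
      by rewrite divfK // gt_eqF // mulr_gt0.
    have h1 := Alow (x - z t).
    have h2 : `|(x - z t) *m A| <= (`|K| + k) + (2 * a)^-1 * `|x - z t|.
      rewrite -(subKr (b0 - z t) ((x - z t) *m A)).
      apply: le_trans (ler_normB _ _) _; apply: lerD => //.
      apply: le_trans (ler_normB _ _) _; apply: lerD => //.
      exact: le_trans bK (ler_norm _).
    have h3 : a * `|(x - z t) *m A| <= a * (`|K| + k) + 2^-1 * `|x - z t|.
      have aE : a * (2 * a)^-1 = 2^-1 by rewrite invfM mulrCA mulfV ?mulr1 // gt_eqF.
      by rewrite -aE -mulrA -mulrDr ler_wpM2l // ltW.
    rewrite -[x](subrK (z t)); apply: le_trans (ler_normD _ _) _.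
    rewrite lerD //; move: h1 h3; clear; lra.
- apply: filterS Ga => t Gat; rewrite /beta.
  by apply: (Gcomp); [apply: (Gcomp)|].
Qed.

Lemma closed_group_transl (R : realType) n (Gam : set (bdry R n -> bdry R n))
    (v : 'rV[R]_n) (j : int) :
  @transf_closed (bdry R n) Gam -> Gam (affine_ext 1%:M v) ->
  Gam (affine_ext 1%:M (j%:~R *: v)).
Proof.
move=> [Gid Gcomp Ginv] Gv.
have Gnat (i : nat) : Gam (affine_ext 1%:M (i%:R *: v)).
  elim: i => [|i IH].
    by rewrite scale0r (_ : affine_ext _ _ = id) //; apply: funext => p; exact: affine_ext1.
  rewrite (_ : affine_ext _ _ = affine_ext 1%:M v \o affine_ext 1%:M (i%:R *: v)).
    exact: Gcomp.
  apply: funext => p; rewrite /= affine_extM !mulmx1.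
  by rewrite -natr1 scalerDl scale1r.
case: j => i; first exact: Gnat.
have cK (x : 'rV[R]_n) : cancel (affine_ext 1%:M x : bdry R n -> _) (affine_ext 1%:M (- x)).
  by move=> p; rewrite affine_extM !mulmx1 subrr affine_ext1.
rewrite NegzE mulrNz scaleNr; apply: Ginv (Gnat i.+1) _ _; first exact: cK.
by move=> p; have := cK (- (i.+1%:R *: v)) p; rewrite opprK.
Qed.

(** Conjugating a translation by powers of the contraction D gives arbitrarily
    short translations; a limit direction u of these and the multiples of short
    translations give all the translations along u. *)
Lemma translation_flow (R : realType) n (Gam : set (bdry R n -> bdry R n))
    (w : 'rV[R]_n) (D E : nat -> 'M[R]_n) (k mu : R) :
  closed_group Gam -> w != 0 -> Gam (affine_ext 1%:M w) ->
  similarity_powers D E k mu -> (forall m, Gam (affine_ext (D m) 0)) ->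
  exists2 u : 'rV[R]_n, u != 0 & forall r : R, Gam (affine_ext 1%:M (r *: u)).
Proof.
move=> cG w0 Gw [k0 mu01 DE Dle Ele] GD; have /andP[mu0 mu1] := mu01.
have [tG Gh Gcl] := cG; have [Gid Gcomp Ginv] := tG.
have ED m : E m *m D m = 1%:M by apply: mulmx1C.
pose v m := w *m D m.
have Gv m : Gam (affine_ext 1%:M (v m)).
  have GE : Gam (affine_ext (E m) 0).
    apply: Ginv (GD m) _ _ => x.
      by rewrite affine_extM DE mul0mx addr0 affine_ext1.
    by rewrite affine_extM ED mul0mx addr0 affine_ext1.
  rewrite (_ : affine_ext _ _ =
      affine_ext (D m) 0 \o affine_ext 1%:M w \o affine_ext (E m) 0).
    by apply: (Gcomp) => //; exact: Gcomp.
  apply: funext => p; rewrite /= !affine_extM mul1mx mul0mx add0r addr0 ED.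
  by [].
have v0 m : 0 < `|v m|.
  rewrite normr_gt0; apply: contra w0 => /eqP vm.
  by rewrite -[w]mulmx1 -(DE m) mulmxA -/(v m) vm mul0mx.
have vs : (fun m => `|v m|) @ \oo --> (0 : R).
  have hk : (fun m => k * `|w| * mu ^+ m) @ \oo --> (0 : R).
    rewrite -[0](mulr0 (k * `|w|)); apply: cvgM; first exact: cvg_cst.
    by apply: cvg_expr; rewrite ger0_norm // ltW.
  apply: (@squeeze_cvgr _ _ _ _ (cst 0) (fun m => k * `|w| * mu ^+ m)) => //.
    apply: nearW => m; rewrite normr_ge0 /=; apply: le_trans (Dle _ _) _.
    by rewrite mulrAC.
  exact: cvg_cst.
have Foo : ProperFilter (\oo : set_system nat) by exact: _.
have [U [UU oU]] := ultraFilterLemma Foo.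
have FU : ProperFilter U by apply: ultra_proper.
have vsU : (fun m => `|v m|) @ U --> (0 : R).
  by move=> X hX; apply: oU; exact: vs.
pose u m := `|v m|^-1 *: v m.
have u1 m : `|u m| = 1.
  by rewrite normrZ normrV ?unitfE ?gt_eqF // normr_id mulVf // gt_eqF.
have [uu hu] : exists M : 'rV[R]_n, u @ U --> M.
  apply: (@ultra_bounded_mx _ _ _ _ _ _ 1 UU).
  by apply: filterS filterT => m _; rewrite u1.
exists uu.
  apply/eqP => uu0; rewrite uu0 in hu.
  have /cvgr0Pnorm_lt /(_ 1 ltr01) z1 := hu.
  by have [m] := filter_ex z1; rewrite u1 ltxx.
(* The multiple j m of v m has length within that of v m of r. *)
move=> r; pose j m := Num.floor (r / `|v m|).
have jr : (fun m => (j m)%:~R * `|v m|) @ U --> r.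
  apply/cvgrPdist_le => e e0.
  have /cvgr0Pnorm_le /(_ _ e0) := vsU; apply: filterS => m; rewrite normr_id => h.
  have l1 : (j m)%:~R * `|v m| <= r.
    by rewrite -ler_pdivlMr // ge_floor.
  have l2 : r < ((j m)%:~R + 1) * `|v m|.
    by rewrite -ltr_pdivrMr // -intrD1 floorD1_gt.
  rewrite ger0_norm; move: l1 l2 h; rewrite ?mulrDl ?mul1r; lra.
have jv : (fun m => (j m)%:~R *: v m) @ U --> r *: uu.
  rewrite (_ : (fun m => _) = (fun m => ((j m)%:~R * `|v m|) *: u m)).
    exact: cvgZ.
  by apply: funext => m; rewrite /u scalerA mulfK // gt_eqF.
apply: (@closed_group_cconv R n Gam _ U FU (fun m => affine_ext 1%:M ((j m)%:~R *: v m))) => //.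
- by apply: homeos_affine; exact: unitmx1.
- by apply: cconv_transl => //; exact: unitmx1.
- by apply: filterS filterT => m _; exact: closed_group_transl.
Qed.

(** * Boundary values of isometries *)

(** The normalised lift hlift p / (d + e) extends continuously to the boundary:
    a point of hyperbolic space is close to xi exactly when its normalised lift
    is close to that of xi. *)
Definition hnorm (R : realType) n (y : 'rV[R]_(n + (1 + 1))) :
    'rV[R]_(n + (1 + 1)) := (wd y + we y)^-1 *: y.

Lemma hnormZ (R : realType) n c (y : 'rV[R]_(n + (1 + 1))) :
  c != 0 -> hnorm (c *: y) = hnorm y.
Proof.
move=> c0; rewrite /hnorm wdZ weZ -mulrDr scalerA invfM mulrAC mulVf //.
by rewrite mul1r.
Qed.

Lemma hnorm_mulmx (R : realType) n (y : 'rV[R]_(n + (1 + 1)))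
    (L : 'M[R]_(n + (1 + 1))) :
  wd y + we y != 0 -> hnorm (hnorm y *m L) = hnorm (y *m L).
Proof.
move=> y0; rewrite -[hnorm y]/(_ *: y) -scalemxAl hnormZ //.
by rewrite invr_eq0.
Qed.

Lemma cvg_hnorm (R : realType) T (F : set_system T) {FF : Filter F} n
    (f : T -> 'rV[R]_(n + (1 + 1))) (y : 'rV[R]_(n + (1 + 1))) :
  lightlike y -> f @ F --> y -> (fun t => hnorm (f t)) @ F --> hnorm y.
Proof.
move=> [_ _ _ de] fy; apply: cvgZ => //; apply: cvgV; first by rewrite gt_eqF.
by apply: cvgD; [exact: cvg_wd|exact: cvg_we].
Qed.

Lemma to_bdry_filter (R : realType) n (xi : bdry R n) : Filter (to_bdry xi).
Proof.
apply: filter_from_filter; first by exists setT; exact: filterT.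
move=> A B hA hB; exists (A `&` B); first exact: filterI.
by move=> p [].
Qed.

Lemma cvg_hnorm_to_bdry (R : realType) n (xi : bdry R n) :
  (fun p : hyp R n => hnorm (hlift (val p))) @ to_bdry xi --> hnorm (blift xi).
Proof.
case: xi => [x|].
  have Fx := nbhs_filter ((x, 0) : 'rV[R]_n * R).
  have h : (fun q : 'rV[R]_n * R => hnorm (hlift q)) @ nbhs ((x, 0) : 'rV[R]_n * R)
      --> hnorm (blift (Some x)).
    apply: cvg_hnorm; first exact: lightlike_blift.
    have -> : blift (Some x) = mkw x 1 (sqnorm x + 0 * 0) by rewrite mul0r addr0.
    rewrite /hlift; under eq_fun do rewrite expr2.
    apply: cvg_mkw; [exact: cvg_fst|exact: cvg_cst|].
    apply: cvgD; first by apply: cvg_sqnorm; exact: cvg_fst.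
    by apply: cvgM; exact: cvg_snd.
  move=> X /h hX.
  have hB : nbhs (bdry_emb (Some x : bdry R n))
      (Some @` [set q | X (hnorm (hlift q))]).
    exact: one_point_compactification_some_nbhs.
  exists (Some @` [set q | X (hnorm (hlift q))]); first exact: hB.
  by move=> p [q hq [qp]]; subst q; exact: hq.
move=> X hX; have : nbhs (hnorm (blift None)) X by exact: hX.
move=> /nbhs_ballP[e /= e0 eX]; pose c := 1 + e^-1.
(* Outside the cube C the distance r to the origin exceeds c, and the
   normalised lift is within r / (1 + r^2) < 1 / r of that of infinity. *)
have c1 : 1 < c by rewrite ltrDl invr_gt0.
pose C : set ('rV[R]_n * R) :=
  [set v : 'rV[R]_n | forall i, `[- c, c]%classic (v ord0 i)] `*` `[- c, c]%classic.
have cC : compact C.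
  apply: compact_setX; last exact: segment_compact.
  by apply: (@rV_compact _ _ (fun=> `[- c, c]%classic)) => i; exact: segment_compact.
have clC : closed C by apply: compact_closed => //; exact: norm_hausdorff.
exists ((Some @` ~` C) `|` [set None]); first by exists C.
move=> p [|//] [q nCq] [qp]; subst q; change (~ C (val p)) in nCq.
change (X (hnorm (hlift (val p)))).
apply: eX; case: (val p) nCq => x s nC /=.
have [r0 cr] : 0 <= Num.sqrt (sqnorm x + s ^+ 2) /\ c < Num.sqrt (sqnorm x + s ^+ 2).
  split; first exact: sqrtr_ge0.
  rewrite ltNge; apply/negP => rc; apply: nC.
  have cp : 0 <= c by lra.
  split => [i|] /=; rewrite in_itv /= -ler_norml; apply: le_trans rc.
    rewrite -sqrtr_sqr ler_wsqrtr // /sqnorm (bigD1 i) //= -addrA lerDl.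
    by rewrite addr_ge0 ?sqr_ge0 //; apply: sumr_ge0 => k _; exact: sqr_ge0.
  by rewrite -sqrtr_sqr ler_wsqrtr // lerDr sqnorm_ge0.
have rr : Num.sqrt (sqnorm x + s ^+ 2) ^+ 2 = sqnorm x + s ^+ 2.
  by rewrite sqr_sqrtr // addr_ge0 ?sqnorm_ge0 ?sqr_ge0.
have xr : `|x| <= Num.sqrt (sqnorm x + s ^+ 2).
  rewrite -(ger0_norm (normr_ge0 x)) -sqrtr_sqr ler_wsqrtr //.
  by apply: le_trans (sqnorm_ge x) _; rewrite lerDl sqr_ge0.
rewrite -ball_normE /= /hnorm /hlift /= !mkwK add0r invr1 scale1r -rr.
move: (Num.sqrt _) r0 cr xr => r r0 cr xr.
have d0 : 0 < 1 + r ^+ 2 by rewrite ltr_pwDl // sqr_ge0.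
have er : 1 < e * r.
  have : e * c < e * r by rewrite ltr_pM2l.
  by rewrite /c mulrDr mulr1 mulfV ?gt_eqF //; lra.
have key a : `|a| <= r -> `|(1 + r ^+ 2)^-1 * a| <= r / (1 + r ^+ 2).
  move=> ar; rewrite normrM ger0_norm ?invr_ge0 ?(ltW d0) // mulrC.
  by rewrite ler_wpM2r // invr_ge0 ltW.
have r1 : 1 <= r by lra.
have -> : mkw 0 0 1 - (1 + r ^+ 2)^-1 *: mkw x 1 (r ^+ 2) =
    mkw (- ((1 + r ^+ 2)^-1 *: x)) (- (1 + r ^+ 2)^-1) ((1 + r ^+ 2)^-1).
  apply: wP; rewrite -[- (_ *: mkw _ _ _)]scaleN1r ?wxD ?wdD ?weD ?wxZ ?wdZ ?weZ !mkwK.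
  - by rewrite add0r scaleN1r.
  - by rewrite add0r mulN1r mulr1.
  - by field; rewrite gt_eqF.
apply: (@le_lt_trans _ _ (r / (1 + r ^+ 2))); last first.
  rewrite ltr_pdivrMr // mulrDr mulr1 expr2 mulrA.
  have : r <= e * r * r by rewrite ler_peMl // ltW.
  lra.
have i1 : `|(1 + r ^+ 2)^-1| <= r / (1 + r ^+ 2).
  by rewrite -[X in `|X|]mulr1; apply: key; rewrite normr1.
apply: norm_mkw_le; rewrite ?normrN // normrZ ger0_norm ?invr_ge0 ?(ltW d0) //.
by rewrite mulrC ler_wpM2r // invr_ge0 ltW.
Qed.

(** For a finite boundary point, the point of hyperbolic space is a continuous
    function of its normalised lift. At infinity, d tends to 0 in the normalised
    lift, while it is bounded below over compact sets. *)
Lemma hnorm_cvg (R : realType) n T (F : set_system T) {FF : Filter F}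
    (u : T -> hyp R n) (xi : bdry R n) :
  (fun t => hnorm (hlift (val (u t)))) @ F --> hnorm (blift xi) ->
  (fun t => hyp_emb (u t)) @ F --> bdry_emb xi.
Proof.
move=> h; case: xi h => [x|] h.
  pose rec (y : 'rV[R]_(n + (1 + 1))) : 'rV[R]_n * R :=
    let x := (wd y)^-1 *: wx y in (x, Num.sqrt (we y / wd y - sqnorm x)).
  have recZ c y : c != 0 -> rec (c *: y) = rec y.
    move=> c0; rewrite /rec wxZ wdZ weZ scalerA invfM [_^-1 * _ * c]mulrAC mulVf // mul1r.
    by rewrite mulrACA mulfV // mul1r.
  have recE (q : 'rV[R]_n * R) : 0 <= q.2 -> rec (hlift q) = q.
    move=> q2; rewrite /rec /= !mkwK invr1 scale1r mulr1 [sqnorm _ + _]addrC addrK sqrtr_sqr.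
    by rewrite ger0_norm //; case: q q2.
  have hr : (fun t => rec (hnorm (hlift (val (u t))))) @ F --> rec (hnorm (blift (Some x))).
    have wd0 : wd (hnorm (blift (Some x))) != 0.
      have := sqnorm_ge0 x => s0.
      by rewrite wdZ mulf_neq0 // ?invr_eq0 /= !mkwK ?oner_eq0 // gt_eqF //; lra.
    pose y t := hnorm (hlift (val (u t))).
    pose y0 := hnorm (blift (Some x : bdry R n)).
    have hd : (fun t => (wd (y t))^-1) @ F --> (wd y0)^-1.
      by apply: cvgV => //; exact: cvg_wd.
    have hx : (fun t => (wd (y t))^-1 *: wx (y t)) @ F --> (wd y0)^-1 *: wx y0.
      by apply: cvgZ => //; exact: cvg_wx.
    apply: cvg_prod => //.
    apply: (cvg_comp _ (@Num.sqrt R)); last exact: sqrt_continuous.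
    apply: cvgB; first by apply: cvgM hd; exact: cvg_we.
    exact: cvg_sqnorm.
  have lim : rec (hnorm (blift (Some x))) = (x, 0).
    rewrite /hnorm recZ; last first.
      by rewrite invr_eq0; have [_ _ _ de] := lightlike_blift (Some x : bdry R n); rewrite gt_eqF.
    have -> : blift (Some x) = hlift (x, 0) by rewrite /hlift /= expr0n /= addr0.
    by rewrite recE.
  have eqr t : rec (hnorm (hlift (val (u t)))) = val (u t).
    rewrite /hnorm recZ ?recE ?(ltW (hyp_gt0 _)) // invr_eq0 gt_eqF //.
    have fu := future_hlift (hyp_gt0 (u t)).
    by rewrite addr_gt0 ?future_we //; case: fu.
  move: hr; rewrite lim; under eq_fun do rewrite eqr.
  move=> hr; apply: (cvg_comp _ (Some : _ -> one_point_compactification _) hr).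
  exact: one_point_compactification_some_continuous.
move=> B [C [cC clC]] CB.
pose g (q : 'rV[R]_n * R) := 1 + (sqnorm q.1 + q.2 ^+ 2).
have gc : {within C, continuous g}.
  apply: continuous_subspaceT => q; apply: (@cvgD _ _ _ (nbhs q)); first exact: cvg_cst.
  apply: cvgD; first by apply: cvg_sqnorm; exact: cvg_fst.
  under eq_fun do rewrite expr2.
  by rewrite expr2; apply: cvgM; exact: cvg_snd.
have [b [_ hb]] := compact_bounded (continuous_compact gc cC).
have g0 q : 0 < g q by rewrite ltr_pwDl // addr_ge0 ?sqnorm_ge0 ?sqr_ge0.
pose b' := `|b| + 1; have b'0 : 0 < b' by rewrite ltr_wpDl.
have {}hb q : C q -> g q <= b'.
  move=> Cq; have := hb b' _ (g q).
  rewrite /b' (le_lt_trans (ler_norm b)) ?ltrDl // => /(_ isT).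
  by move=> H; apply: le_trans (ler_norm _) (H _); exists q.
have hd : (fun t => wd (hnorm (hlift (val (u t))))) @ F --> (0 : R).
  have := @cvg_wd R T F FF n _ _ h.
  by rewrite [X in _ --> X](_ : _ = 0) // wdZ /= !mkwK mulr0.
have /cvgrPdist_lt /(_ (b'^-1)) := hd.
rewrite invr_gt0 => /(_ b'0); apply: filterS => t ht.
apply: CB; left; exists (val (u t)) => // /hb gb; move: ht.
rewrite sub0r normrN wdZ /= !mkwK mulr1 -/(g (val (u t))).
rewrite ger0_norm ?invr_ge0 ?(ltW (g0 _)) // ltf_pV2 ?posrE //.
by rewrite ltNge gb.
Qed.

Lemma boundary_value_hact (R : realType) n (L : 'M[R]_(n + (1 + 1))) :
  moeb L -> boundary_value (@hact R n L) (@bact R n L).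
Proof.
move=> hL xi; have FF := to_bdry_filter xi; apply: hnorm_cvg.
have hn (p : hyp R n) : hnorm (hlift (val (hact L p))) =
    hnorm (hnorm (hlift (val p)) *m L).
  rewrite hlift_hact // hnormZ ?invr_eq0; last first.
    by rewrite gt_eqF // wd_moeb_gt0 // hyp_gt0.
  have fu := future_hlift (hyp_gt0 p).
  rewrite hnorm_mulmx // gt_eqF //.
  by rewrite addr_gt0 ?future_we //; case: fu.
under eq_fun do rewrite hn.
have ll := lightlike_blift xi; have [_ _ _ de] := ll.
have [c c0 ec] := blift_bpt (moeb_lightlike hL ll).
have -> : hnorm (blift (bact L xi)) = hnorm (hnorm (blift xi) *m L).
  by rewrite hnorm_mulmx ?gt_eqF // ec hnormZ ?gt_eqF.
apply: cvg_hnorm.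
  by rewrite -scalemxAl; apply: lightlikeZ; rewrite ?invr_gt0 //; exact: moeb_lightlike.
by apply: cvg_mulmx; [exact: cvg_hnorm_to_bdry|exact: cvg_cst].
Qed.

(** * Dilations, translations and the inversion *)

Lemma moebP (R : realType) n (L : 'M[R]_(n + (1 + 1))) :
  (forall y, bil (y *m L) (y *m L) = bil y y) ->
  (forall y, future y -> 0 < wd (y *m L)) -> moeb L.
Proof.
move=> hq hd; split; last by move=> y fy; split; [exact: hd|rewrite hq; case: fy].
apply: lorentzP => y z; have := hq (y + z).
rewrite mulmxDl !bilDl !bilDr !hq (bilC z y) (bilC (z *m L)).
by move: (bil _ _) (bil (_ *m _) _) (bil y y) (bil z z) => a b c d; lra.
Qed.

(** The extension to hyperbolic space of v |-> s v. *)
Definition dilM (R : realType) n (s : R) : 'M[R]_(n + (1 + 1)) :=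
  block_mx 1%:M 0 0 (block_mx (s^-1)%:M 0 0 s%:M).

Lemma mul_dilM (R : realType) n (s : R) (y : 'rV[R]_(n + (1 + 1))) :
  y *m dilM n s = mkw (wx y) (wd y / s) (we y * s).
Proof.
rewrite {1}(mkwE y) /mkw /dilM mul_row_block !mulmx0 add0r addr0 mulmx1.
by rewrite mul_row_block !mulmx0 add0r addr0 -!scalar_mxM.
Qed.

Lemma moeb_dilM (R : realType) n (s : R) : 0 < s -> moeb (dilM n s).
Proof.
move=> s0; apply: moebP => y; rewrite mul_dilM.
  by rewrite !bilyy !mkwK; field; rewrite gt_eqF.
by case=> d0 _; rewrite mkwK divr_gt0.
Qed.

Lemma bact_dilM (R : realType) n (s : R) : 0 < s ->
  @bact R n (dilM n s) = affine_ext s%:M 0.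
Proof.
move=> s0; apply: funext => -[x|]; rewrite /bact /= mul_dilM !mkwK /bpt !mkwK.
  rewrite mul1r invr_eq0 gt_eqF // invrK mul_mx_scalar addr0.
  by [].
by rewrite mul0r eqxx.
Qed.

Definition transM (R : realType) n (a : 'rV[R]_n) : 'M[R]_(n + (1 + 1)) :=
  block_mx 1%:M (row_mx 0 (2 *: a^T)) (col_mx a 0)
    (block_mx 1%:M (sqnorm a)%:M 0 1%:M).

Lemma mul_transM (R : realType) n (a : 'rV[R]_n) (y : 'rV[R]_(n + (1 + 1))) :
  y *m transM a = mkw (wx y + wd y *: a) (wd y)
                      (we y + 2 * dot (wx y) a + wd y * sqnorm a).
Proof.
rewrite {1}(mkwE y) /mkw /transM mul_row_block mulmx1 mul_row_col mulmx0 addr0.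
rewrite mul_scalar_mx mul_row_block !mulmx1 mulmx0 addr0 mul_mx_row mulmx0.
rewrite add_row_mx add0r -scalemxAr; congr (row_mx _ (row_mx _ _)).
rewrite -scalar_mxM [_ *m a^T]mx11_scalar -[(_ *m _) _ _]/(dot (wx y) a).
by apply/matrixP => i j; rewrite !ord1 !mxE eqxx !mulr1n; ring.
Qed.

Lemma moeb_transM (R : realType) n (a : 'rV[R]_n) : moeb (transM a).
Proof.
apply: moebP => y; rewrite mul_transM; last by case=> d0 _; rewrite mkwK.
by rewrite !bilyy !mkwK sqnormD sqnormZ dotZr; ring.
Qed.

Lemma bact_transM (R : realType) n (a : 'rV[R]_n) :
  @bact R n (transM a) = affine_ext 1%:M a.
Proof.
apply: funext => -[x|]; rewrite /bact /= mul_transM !mkwK /bpt !mkwK ?eqxx //.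
by rewrite oner_eq0 invr1 !scale1r mulmx1.
Qed.

Definition swapM (R : realType) n : 'M[R]_(n + (1 + 1)) :=
  block_mx 1%:M 0 0 (block_mx 0 1%:M 1%:M 0).

Lemma mul_swapM (R : realType) n (y : 'rV[R]_(n + (1 + 1))) :
  y *m swapM R n = mkw (wx y) (we y) (wd y).
Proof.
rewrite {1}(mkwE y) /mkw /swapM mul_row_block !mulmx0 add0r addr0 mulmx1.
by rewrite mul_row_block !mulmx0 add0r addr0 !mulmx1.
Qed.

Lemma moeb_swapM (R : realType) n : moeb (swapM R n).
Proof.
apply: moebP => y; rewrite mul_swapM.
  by rewrite !bilyy !mkwK [wd y * _]mulrC.
by move=> /future_we; rewrite mkwK.
Qed.

Lemma bact_swapM (R : realType) n (x : 'rV[R]_n) :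
  bact (swapM R n) (Some x) = chart_inv false x.
Proof.
rewrite /bact /= mul_swapM !mkwK /bpt !mkwK /chart_inv.
case: (eqVneq x 0) => [->|x0]; first by rewrite sqnorm0 eqxx.
by case: eqP => [/sqnorm_eq0 /eqP|//]; rewrite (negPf x0).
Qed.

(** * The diffeomorphism at its fixed point *)

Lemma inversionK (R : realType) n (x : 'rV[R]_n) :
  x != 0 -> inversion (inversion x) = x.
Proof.
move=> x0; have s0 : sqnorm x != 0.
  by apply: contra_neq x0; exact: sqnorm_eq0.
rewrite /inversion sqnormZ scalerA.
rewrite [X in X *: _](_ : _ = 1) ?scale1r //.
by field.
Qed.

Lemma chart_invK (R : realType) n b : cancel (@chart_inv R n b) (chart b).
Proof.
case: b => x //=; case: eqVneq => [->//|x0] /=.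
exact: inversionK.
Qed.

Lemma chartK (R : realType) n b (q : bdry R n) :
  chart_dom b q -> chart_inv b (chart b q) = q.
Proof.
case: b q => -[x|] //= h; last by rewrite eqxx.
rewrite /chart_dom /= in h.
have x0 : x != 0 by apply/eqP => x0; apply: h; rewrite x0.
have s0 : sqnorm x != 0 by apply: contra_neq x0; exact: sqnorm_eq0.
rewrite ifF; first by rewrite inversionK.
by apply/negbTE; rewrite /inversion scaler_eq0 invr_eq0 negb_or s0.
Qed.

(** Because S is a translate of the inverse of the chart at x0, conjugating f by S
    gives a map with the derivative of f at x0 in that chart. *)
Lemma centered_chart (R : realType) n (x0 : bdry R n) :
  exists2 S : 'M[R]_(n + (1 + 1)), moeb S &
    forall v, bact S (Some v) =
      chart_inv (isSome (x0 : option 'rV[R]_n))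
        (chart (isSome (x0 : option 'rV[R]_n)) x0 + v).
Proof.
case: x0 => [a|] /=.
  exists (transM a); first exact: moeb_transM.
  by move=> v; rewrite bact_transM /= mulmx1 addrC.
exists (swapM R n); first exact: moeb_swapM.
by move=> v; rewrite bact_swapM add0r.
Qed.

Lemma jacobian_approx (R : realType) n (F : 'rV[R]_n -> 'rV[R]_n) c (e : R) :
  differentiable F c -> 0 < e ->
  exists2 r : R, 0 < r & forall v, `|v| <= r ->
    `|F (c + v) - F c - v *m 'J F c| <= e * `|v|.
Proof.
move=> dF e0; have /eqaddoP /(_ _ e0) /nbhs_ballP [r /= r0 hr] := diff_locally dF.
have r2 : 0 < r / 2 by rewrite divr_gt0.
exists (r / 2) => // v vr; have := hr v.
rewrite -ball_normE /= sub0r normrN => /(_ _).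
have -> : (F \o +%R^~ c - (cst (F c) + 'd F c)) v =
    F (c + v) - F c - v *m 'J F c.
  rewrite /jacobian mul_rV_lin1 -[LHS]/(F (v + c) - (F c + 'd F c v)).
  by rewrite opprD addrA (addrC v).
by apply; lra.
Qed.

Lemma norm_mulmx_low (R : realType) n (A : 'M[R]_n) : A \in unitmx ->
  exists2 a : R, 0 < a & forall u : 'rV[R]_n, `|u| <= a * `|u *m A|.
Proof.
move=> uA; exists (n%:R * `|invmx A| + 1); first by rewrite ltr_wpDl // mulr_ge0.
move=> u; rewrite -{1}[u](mulmxK uA); apply: le_trans (norm_mulmx_le _ _) _.
by rewrite ler_wpM2r // lerDl.
Qed.

Lemma Some_bdry_continuous (R : realType) n (v : 'rV[R]_n) :
  (Some : 'rV[R]_n -> bdry R n) @ nbhs v --> (Some v : bdry R n).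
Proof.
apply: cvg_bdry_Some => e e0; apply/nbhs_ballP; exists e => // x.
by rewrite -ball_normE /= => h; exists x => //; rewrite distrC ltW.
Qed.

(** Continuity of the inverse at 0 shows that points with small images are small;
    then the lower bound for A applies to them. *)
Lemma tangent_at0_homeo (R : realType) n (h : bdry R n -> bdry R n)
    (A : 'M[R]_n) :
  A \in unitmx -> homeos h -> h (Some 0) = Some 0 ->
  (forall e : R, 0 < e -> exists2 r : R, 0 < r & forall v, `|v| <= r ->
     exists2 y, h (Some v) = Some y & `|y - v *m A| <= e * `|v|) ->
  tangent_at0 h A.
Proof.
move=> uA [_ [g [hg gh gc]]] h0 H; split => //.
have [a a0 ha] := norm_mulmx_low uA.
have e0 : 0 < (2 * a)^-1 by rewrite invr_gt0 mulr_gt0.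
have [r r0 hr] := H _ e0.
have g0 : g (Some 0) = Some 0 by rewrite -h0 hg.
have : \forall q \near (Some 0 : bdry R n),
    exists2 x, g q = Some x & `|x - 0| < r.
  have gc0 := gc (Some 0); rewrite /continuous_at g0 in gc0.
  exact: gc0 (nbhs_bdry_Some 0 r0).
have Sc := @Some_bdry_continuous R n 0.
move=> /Sc /nbhs_ballP [d /= d0 hd].
exists (2 * a), (d / 2); split; [by rewrite mulr_gt0|by rewrite divr_gt0|].
move=> q y qy yd; have [|x gx xr] := hd y.
  by rewrite -ball_normE /= sub0r normrN; lra.
rewrite subr0 in xr.
have qx : q = Some x by rewrite -gx -qy hg.
exists x => //; have [|y' y'E hy] := hr x; first exact: ltW.
have yy : y' = y by move: y'E; rewrite -qx qy => -[].
rewrite {}yy in hy.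
have h1 := ha x; have h2 : `|x *m A| <= `|y| + (2 * a)^-1 * `|x|.
  rewrite -(subKr y (x *m A)); apply: le_trans (ler_normB _ _) _.
  by rewrite lerD2l.
have h3 : a * `|x *m A| <= a * `|y| + 2^-1 * `|x|.
  have aE : a * (2 * a)^-1 = 2^-1 by rewrite invfM mulrCA mulfV ?mulr1 // gt_eqF.
  by rewrite -aE -mulrA -mulrDr ler_wpM2l // ltW.
by rewrite -mulrA; move: h1 h3; clear; lra.
Qed.

Lemma homeos_diffeo (R : realType) n k (f : bdry R n -> bdry R n) :
  diffeo k f -> homeos f.
Proof. by move=> [[fc _] [g [fg gf [gc _]]]]; split => //; exists g. Qed.

Lemma diffeo_tangent (R : realType) n (f : bdry R n -> bdry R n) x0
    (A : 'M[R]_n) :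
  diffeo 2 f -> f x0 = x0 -> fixpt_diff f x0 = A -> A \in unitmx ->
  exists2 S : 'M[R]_(n + (1 + 1)), moeb S &
    bact S (Some 0) = x0 /\ tangent_at0 (bact (invmx S) \o f \o bact S) A.
Proof.
move=> df fx0 dfA uA; have hf := homeos_diffeo df.
have [S hS SE] := centered_chart x0; exists S => //.
rewrite /fixpt_diff in dfA; move: dfA SE.
set b := isSome _; set c := chart b x0 => dfA SE.
have x0b : chart_dom b x0 by rewrite /b /chart_dom; case: (x0).
have S0 : bact S (Some 0) = x0 by rewrite SE addr0 chartK.
split => //.
have [hid hcomp hinv] := @homeos_closed R n.
have hh : homeos (bact (invmx S) \o f \o bact S).
  by apply: (hcomp); [apply: (hcomp) => //|]; apply: homeos_bact => //; exact: moeb_inv.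
have h0 : (bact (invmx S) \o f \o bact S) (Some 0) = Some 0.
  by rewrite /= S0 fx0 -S0 bactK.
apply: tangent_at0_homeo => // e e0.
have dF : differentiable (local_rep b b f) c.
  have [[_ /(_ b b) [dF _]] _] := df; apply: dF.
  by split; rewrite /= chartK // fx0.
have [r r0 hr] := jacobian_approx dF e0.
have Fc : local_rep b b f c = c by rewrite /local_rep /= chartK // fx0.
have Sc := @Some_bdry_continuous R n 0.
have : \forall q \near (Some 0 : bdry R n),
    exists2 x, (bact (invmx S) \o f \o bact S) q = Some x & `|x - 0| < 1.
  have [hc _] := hh; have hc0 := hc (Some 0); rewrite /continuous_at h0 in hc0.
  exact: hc0 (nbhs_bdry_Some 0 ltr01).
move=> /Sc /nbhs_ballP [d /= d0 hd].
exists (Num.min r (d / 2)); first by rewrite lt_min r0 divr_gt0.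
move=> v; rewrite le_min => /andP[vr vd].
have [|y yE _] := hd v; first by rewrite -ball_normE /= sub0r normrN; lra.
exists y => //.
have Fy : local_rep b b f (c + v) = c + y.
  rewrite /local_rep /= -SE -[f _](bactKV hS) yE SE.
  exact: chart_invK.
by have := hr v vr; rewrite Fy Fc dfA (addrC c) addrK.
Qed.

(** * Compactness of the set of isometries moving a point a bounded amount *)

(** This formula makes the inverse continuous in the matrix. *)
Lemma lorentz_invE (R : realType) n (L : 'M[R]_(n + (1 + 1))) :
  lorentz L -> invmx L = form R n *m L^T *m invmx (form R n).
Proof.
move=> hL; have uL := lorentz_unit hL.
rewrite -[RHS]mul1mx -(mulVmx uL) -!mulmxA (mulmxA L) (mulmxA (L *m _)) hL.
by rewrite mulmxV ?form_unit // mulmx1.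
Qed.

Lemma cvg_invmx_lorentz (R : realType) n T (F : set_system T) {FF : Filter F}
    (M : T -> 'M[R]_(n + (1 + 1))) (L : 'M[R]_(n + (1 + 1))) :
  (forall t, lorentz (M t)) -> lorentz L -> M @ F --> L ->
  (fun t => invmx (M t)) @ F --> invmx L.
Proof.
move=> hM hL ML; rewrite lorentz_invE //; under eq_fun do rewrite lorentz_invE //.
apply: cvg_mulmx; last exact: cvg_cst.
by apply: cvg_mulmx; [exact: cvg_cst|exact: cvg_trmx].
Qed.

Lemma moeb_lim (R : realType) n T (F : set_system T) {FF : ProperFilter F}
    (M : T -> 'M[R]_(n + (1 + 1))) (L : 'M[R]_(n + (1 + 1))) :
  (forall t, moeb (M t)) -> M @ F --> L -> moeb L.
Proof.
move=> hM ML.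
have lL : lorentz L.
  have h1 : (fun t => M t *m form R n *m (M t)^T) @ F --> L *m form R n *m L^T.
    apply: cvg_mulmx; last exact: cvg_trmx.
    by apply: cvg_mulmx => //; exact: cvg_cst.
  have h2 : (fun t => M t *m form R n *m (M t)^T) @ F --> form R n.
    rewrite (_ : (fun t => _) = fun=> form R n); first exact: cvg_cst.
    by apply: funext => t; case: (hM t).
  exact: (cvg_unique _ h1 h2).
split => // y fy; have : bil (y *m L) (y *m L) < 0.
  by rewrite lorentz_bil //; case: fy.
case/timelike_cases => // -[]; rewrite -scaleN1r wdZ mulN1r oppr_gt0 => d0 _.
have hd : (fun t => wd (y *m M t)) @ F --> wd (y *m L).
  by apply: cvg_wd; apply: cvg_mulmx => //; exact: cvg_cst.
have hn : \forall t \near F, wd (y *m M t) < 0 by exact: (cvgr_lt _ hd).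
have [t ht] := filter_ex hn.
by have [_ /(_ y fy) [+ _]] := hM t; move: ht; clear; lra.
Qed.

Definition hbase (R : realType) n : hyp R n := mkhyp 0 ltr01.

Lemma compact_hyp_bounded (R : realType) n (K : set (hyp R n)) : compact K ->
  exists2 c : R, 0 < c & forall p, K p ->
    [/\ `|(val p).1| <= c, (val p).2 <= c & (val p).2^-1 <= c].
Proof.
move=> cK; pose g (p : hyp R n) := `|(val p).1| + (val p).2 + (val p).2^-1.
have vc : continuous (fun p : hyp R n => val p).
  exact: (@initial_continuous (hyp R n) _ set_val).
have gc : {within K, continuous g}.
  apply: continuous_subspaceT => p.
  have h1 : (fun q : hyp R n => (val q).1) @ nbhs p --> (val p).1.
    by apply: (cvg_comp _ fst (vc p)); exact: cvg_fst.
  have h2 : (fun q : hyp R n => (val q).2) @ nbhs p --> (val p).2.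
    by apply: (cvg_comp _ snd (vc p)); exact: cvg_snd.
  apply: (@cvgD _ _ _ (nbhs p)).
    by apply: cvgD => //; exact: cvg_norm.
  by apply: cvgV => //; rewrite gt_eqF // hyp_gt0.
have [b [_ hb]] := compact_bounded (continuous_compact gc cK).
exists (`|b| + 1); first by rewrite ltr_wpDl.
move=> p Kp; have p0 := hyp_gt0 p.
have : `|g p| <= `|b| + 1.
  by apply: hb; [rewrite (le_lt_trans (ler_norm b)) // ltrDl|exists p].
have i0 : 0 < (val p).2^-1 by rewrite invr_gt0.
have n0 := normr_ge0 (val p).1.
rewrite ger0_norm; last by rewrite /g !addr_ge0 // ltW.
by rewrite /g => h; split; move: p0 i0 n0 h; clear; lra.
Qed.

(** Points at bounded distance from a compact set form a bounded set: with
    p = (x', t') and q = (x, t), the bound on the distance reads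
    |x - x'|^2 + t^2 + t'^2 <= 2 b t t', so that t and t' bound each other. *)
Lemma hyperb_bounded (R : realType) n (b c : R) : 1 <= b -> 0 < c ->
  exists B : R, forall p q : hyp R n,
    `|(val p).1| <= c -> (val p).2 <= c -> (val p).2^-1 <= c ->
    - bil (hyperb q) (hyperb p) <= b -> `|hyperb q| <= B.
Proof.
move=> b1 c0; pose X := c + 2 * b * c.
exists (2 * b * c * (1 + X + (n%:R * X ^+ 2 + (2 * b * c) ^+ 2))).
move=> p q; have p0 := hyp_gt0 p; have q0 := hyp_gt0 q.
rewrite /hyperb bilZl bilZr bil_hlift.
case: p p0 => -[x' t'] /= _ t'0; case: q q0 => -[x t] /= _ t0 xc tc ic.
have -> : - (t^-1 * (t'^-1 * (- (sqnorm (x - x') + t ^+ 2 + t' ^+ 2) / 2))) =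
    (sqnorm (x - x') + t ^+ 2 + t' ^+ 2) / (2 * t * t').
  by field; rewrite !gt_eqF.
rewrite ler_pdivrMr ?mulr_gt0 // => h.
have b0 : 0 < b by apply: lt_le_trans b1.
have s0 := sqnorm_ge0 (x - x').
have tt : t <= 2 * b * t'.
  rewrite -(ler_pM2l t0); have := sqr_ge0 t'.
  have -> : t * (2 * b * t') = b * (2 * t * t') by ring.
  by move: s0 h; rewrite [t ^+ 2]expr2; clear; lra.
have tt' : t' <= 2 * b * t.
  rewrite -(ler_pM2l t'0); have := sqr_ge0 t.
  have -> : t' * (2 * b * t) = b * (2 * t * t') by ring.
  by move: s0 h; rewrite [t' ^+ 2]expr2; clear; lra.
have bc0 : 0 < 2 * b * c by rewrite !mulr_gt0.
have tb : t <= 2 * b * c.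
  by apply: le_trans tt _; rewrite ler_pM2l // mulr_gt0.
have ti : t^-1 <= 2 * b * c.
  have : t'^-1 * t' <= t'^-1 * (2 * b * t) by rewrite ler_pM2l ?invr_gt0.
  rewrite mulVf ?gt_eqF // => h1; rewrite -(ler_pM2r t0) mulVf ?gt_eqF //.
  apply: le_trans h1 _; rewrite mulrA; apply: ler_wpM2r; first exact: ltW.
  by rewrite mulrC ler_pM2l // mulr_gt0.
have sx : sqnorm (x - x') <= (2 * b * c) ^+ 2.
  apply: (@le_trans _ _ (b * (2 * t * t'))).
    by move: h (sqr_ge0 t) (sqr_ge0 t'); clear; lra.
  have -> : b * (2 * t * t') = t * (2 * b * t') by ring.
  rewrite expr2 ler_pM ?(ltW t0) ?mulr_ge0 ?(ltW b0) ?(ltW t'0) //.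
  by rewrite ler_pM2l // mulr_gt0.
have xX : `|x| <= X.
  rewrite -[x](subrK x') addrC; apply: le_trans (ler_normD _ _) _.
  rewrite /X lerD //; have := le_trans (sqnorm_ge _) sx.
  by rewrite ler_sqr ?nnegrE // ltW.
have X0 : 0 <= X by apply: le_trans xX.
have Q0 : 0 <= n%:R * X ^+ 2 by rewrite mulr_ge0 ?sqr_ge0.
have Q1 := sqr_ge0 (2 * b * c).
have we_le : sqnorm x + t ^+ 2 <= n%:R * X ^+ 2 + (2 * b * c) ^+ 2.
  apply: lerD; last by rewrite ler_sqr ?nnegrE ?(ltW t0) ?(ltW bc0).
  apply: le_trans (sqnorm_le _) _; rewrite ler_wpM2l //.
  by rewrite ler_sqr ?nnegrE.
rewrite normrZ ler_pM // ?ger0_norm ?invr_ge0 ?(ltW t0) //.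
apply: norm_mkw_le => /=.
- by apply: le_trans xX _; move: Q0 Q1; clear; lra.
- by rewrite normr1; move: X0 Q0 Q1; clear; lra.
- rewrite ger0_norm ?addr_ge0 ?sqnorm_ge0 ?sqr_ge0 //.
  by apply: le_trans we_le _; move: X0; clear; lra.
Qed.

(** The images of a frame stay at bounded distance from the image of the base
    point, hence are bounded, and they determine the matrix linearly. *)
Lemma moeb_bounded (R : realType) n (c : R) : 0 < c ->
  exists B : R, forall L : 'M[R]_(n + (1 + 1)), moeb L ->
    `|(val (hact L (hbase R n))).1| <= c -> (val (hact L (hbase R n))).2 <= c ->
    (val (hact L (hbase R n))).2^-1 <= c -> `|L| <= B.
Proof.
move=> c0.
pose b i := - bil (hyperb (frame_pt R i)) (hyperb (hbase R n)).
pose bb := 1 + \sum_i b i.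
have b1 i : 0 <= b i by apply: le_trans (bil_hyperb_ge1 _ _).
have bb1 : 1 <= bb by rewrite lerDl sumr_ge0.
have bib i : b i <= bb.
  by rewrite /bb (bigD1 i) //= addrCA lerDl addr_ge0 // sumr_ge0.
have [B hB] := @hyperb_bounded R n bb c bb1 c0.
exists ((n + (1 + 1))%:R * `|invmx (frame (@id (hyp R n)))| * `|B|).
move=> L hL h1 h2 h3.
rewrite -[L](mulKmx (frame_unit R n)); apply: le_trans (norm_mulmx _ _) _.
rewrite ler_wpM2l ?mulr_ge0 // norm_le // => i j.
have -> : (frame (@id (hyp R n)) *m L) i j = hyperb (hact L (frame_pt R i)) 0 j.
  transitivity (row i (frame (@id (hyp R n)) *m L) 0 j); first by rewrite [RHS]mxE.
  by rewrite row_mul rowK hyperb_hact.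
apply: le_trans (norm_coord _ _ _) _; apply: le_trans (ler_norm B).
apply: (hB _ _ h1 h2 h3); rewrite !hyperb_hact // lorentz_bil ?bib //.
by case: hL.
Qed.

(** * Powers of the derivative *)

Definition mxpow (R : realType) n (B : 'M[R]_n) m : 'M[R]_n :=
  iter m (mulmx B) 1%:M.

Lemma mxpow_comm (R : realType) n (B C : 'M[R]_n) m :
  B *m C = C *m B -> C *m mxpow B m = mxpow B m *m C.
Proof.
move=> BC; elim: m => [|m IH]; first by rewrite mulmx1 mul1mx.
by rewrite /= mulmxA -BC -mulmxA IH mulmxA.
Qed.

Lemma mxpowV (R : realType) n (B C : 'M[R]_n) m :
  B *m C = 1%:M -> mxpow B m *m mxpow C m = 1%:M.
Proof.
move=> BC; have CB := mulmx1C BC.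
elim: m => [|m IH]; first by rewrite mulmx1.
rewrite /= -mulmxA (mulmxA (iter _ _ _)) -mxpow_comm ?BC ?CB //.
by rewrite -(mulmxA C) IH mulmx1.
Qed.

Lemma mxpow_conj (R : realType) n (P O : 'M[R]_n) s m : P \in unitmx ->
  mxpow (invmx P *m (s *: O) *m P) m = s ^+ m *: (invmx P *m mxpow O m *m P).
Proof.
move=> uP; elim: m => [|m IH]; first by rewrite expr0 scale1r mulmx1 mulVmx.
rewrite /= -/(mxpow _ m) IH exprS -scalemxAr -scalemxAr -!scalemxAl scalerA mulrC.
congr (_ *: _); rewrite -!mulmxA (mulmxA P) mulmxV // mul1mx.
by rewrite !mulmxA.
Qed.

Lemma orthogonal_tr (R : realType) n (O : 'M[R]_n) :
  orthogonal_mx O -> orthogonal_mx O^T.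
Proof. by move=> h; rewrite /orthogonal_mx trmxK; exact: mulmx1C. Qed.

Lemma orthogonal_mxpow (R : realType) n (O : 'M[R]_n) m :
  orthogonal_mx O -> orthogonal_mx (mxpow O m).
Proof.
rewrite /orthogonal_mx => hO; elim: m => [|m IH]; first by rewrite trmx1 mulmx1.
by rewrite /= trmx_mul -mulmxA (mulmxA (iter _ _ _)) IH mul1mx.
Qed.

Lemma norm_orthogonal (R : realType) n (O : 'M[R]_n) :
  orthogonal_mx O -> `|O| <= 1.
Proof.
move=> hO; apply: norm_le => // i j.
have := congr1 (fun A : 'M[R]_n => A i i) hO; rewrite !mxE eqxx => /= h.
rewrite -(@expr_le1 _ 2) // -normrX ger0_norm ?sqr_ge0 //.
move: h; rewrite (bigD1 j) //= mxE -expr2 mulr1n => <-; rewrite lerDl.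
by apply: sumr_ge0 => k _; rewrite mxE -expr2 sqr_ge0.
Qed.

Lemma similarity_mxpow (R : realType) n (P O : 'M[R]_n) (s : R) :
  P \in unitmx -> orthogonal_mx O -> 0 < s < 1 ->
  exists k : R, similarity_powers (mxpow (invmx P *m (s *: O) *m P))
    (mxpow (invmx P *m (s^-1 *: O^T) *m P)) k s.
Proof.
move=> uP hO /andP[s0 s1].
pose k : R := (n%:R * `|P|) * n%:R * (n%:R * `|invmx P|) + 1.
have bnd (Q : 'M[R]_n) (r : R) (x : 'rV[R]_n) m : orthogonal_mx Q -> 0 < r ->
    `|x *m mxpow (invmx P *m (r *: Q) *m P) m| <= k * r ^+ m * `|x|.
  move=> hQ r0; rewrite mxpow_conj // -scalemxAr normrZ.
  rewrite ger0_norm ?exprn_ge0 ?(ltW r0) // [k * _]mulrC -mulrA.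
  rewrite ler_pM2l ?exprn_gt0 // !mulmxA.
  apply: le_trans (norm_mulmx_le _ _) _.
  apply: (@le_trans _ _ ((n%:R * `|P|) * (n%:R * ((n%:R * `|invmx P|) * `|x|)))).
    rewrite ler_wpM2l ?mulr_ge0 //; apply: le_trans (norm_mulmx_le _ _) _.
    apply: ler_pM; rewrite ?mulr_ge0 //; last exact: norm_mulmx_le.
    by rewrite ler_piMr // norm_orthogonal //; exact: orthogonal_mxpow.
  by rewrite !mulrA ler_wpM2r // /k !mulrA lerDl.
exists k; split.
- by rewrite ltr_wpDl // !mulr_ge0.
- by rewrite s0.
- move=> m; apply: mxpowV.
  rewrite -!scalemxAr -!scalemxAl -scalemxAr scalerA mulfV ?gt_eqF // scale1r.
  rewrite -!mulmxA (mulmxA P) mulmxV // mul1mx (mulmxA O) hO mul1mx.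
  exact: mulVmx.
- by move=> m x; exact: bnd.
- move=> m x; rewrite -exprVn; apply: bnd; first exact: orthogonal_tr.
  by rewrite invr_gt0.
Qed.

Lemma similarity_fixed (R : realType) n (D E : nat -> 'M[R]_n) (k mu : R)
    (z : 'rV[R]_n) :
  similarity_powers D E k mu -> (forall m, z *m D m = z) -> z = 0.
Proof.
move=> [k0 /andP[mu0 mu1] _ Dle _] zD; apply/eqP; rewrite -normr_eq0.
apply: contraT; rewrite normr_eq0 -normr_gt0 => z0.
have k1 : 0 < k^-1 by rewrite invr_gt0.
have /cvgrPdist_lt /(_ _ k1) [N _ /(_ N (leqnn N))] :
    (fun m => mu ^+ m) @ \oo --> (0 : R).
  by apply: cvg_expr; rewrite ger0_norm // ltW.
rewrite sub0r normrN ger0_norm ?exprn_ge0 ?(ltW mu0) // => h.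
have := Dle N z; rewrite zD -{1}[`|z|]mul1r ler_pM2r //.
have : k * mu ^+ N < 1 by rewrite mulrC -ltr_pdivlMr // div1r.
by move=> h1 h2; have := le_lt_trans h2 h1; rewrite ltxx.
Qed.

Lemma closed_group_mxpow (R : realType) n (Gam : set (bdry R n -> bdry R n))
    (B : 'M[R]_n) m :
  @transf_closed (bdry R n) Gam -> Gam (affine_ext B 0) ->
  Gam (affine_ext (mxpow B m) 0).
Proof.
move=> [Gid Gcomp _] GB; elim: m => [|m IH].
  by rewrite (_ : affine_ext _ _ = id) //; apply: funext => p; exact: affine_ext1.
rewrite (_ : affine_ext _ _ = affine_ext (mxpow B m) 0 \o affine_ext B 0).
  exact: Gcomp.
by apply: funext => p; rewrite /= affine_extM mul0mx addr0.
Qed.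

Lemma sub_closure_homeos (R : realType) n (X : set (bdry R n -> bdry R n)) h :
  homeos h -> X h -> closure_in_homeos (generated X) h.
Proof.
move=> hh Xh; apply/closure_homeosP; split => // e e0.
by exists h; [exact: sub_generated|move=> x; exact: ballxx].
Qed.

Lemma closure_homeos_sub (R : realType) n (X Y : set (bdry R n -> bdry R n)) :
  X `<=` Y ->
  closure_in_homeos (generated X) `<=` closure_in_homeos (generated Y).
Proof.
move=> XY h /closure_homeosP [hh ha]; apply/closure_homeosP; split => // e e0.
have [k gk hk] := ha _ e0; exists k => // A [tA YA]; apply: gk; split => //.
exact: subset_trans YA.
Qed.

(** The contraction is A or its inverse, according to the value of lambda. The
    last clause serves to show that A has no non-zero fixed vector. *)
Lemma contraction_powers (R : realType) n (Gam : set (bdry R n -> bdry R n))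
    (P O : 'M[R]_n) (lambda : R) (A : 'M[R]_n) :
  P \in unitmx -> orthogonal_mx O -> 0 < lambda -> lambda != 1 ->
  A = invmx P *m (lambda *: O) *m P ->
  @transf_closed (bdry R n) Gam -> Gam (affine_ext A 0) ->
  exists D E k mu, [/\ @similarity_powers R n D E k mu,
    forall m, A *m D m = D m *m A, forall m, Gam (affine_ext (D m) 0)
    & forall z : 'rV[R]_n, z *m A = z -> forall m, z *m D m = z].
Proof.
move=> uP hO l0 l1 AE tG GA.
pose C := invmx P *m (lambda^-1 *: O^T) *m P.
have AC : A *m C = 1%:M.
  rewrite AE /C -!scalemxAr -!scalemxAl -scalemxAr scalerA mulfV ?gt_eqF //.
  rewrite scale1r -!mulmxA (mulmxA P) mulmxV // mul1mx (mulmxA O) hO mul1mx.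
  exact: mulVmx.
have CA := mulmx1C AC.
have GC : Gam (affine_ext C 0).
  have [_ _ Ginv] := tG; apply: Ginv GA _ _ => p.
    by rewrite affine_extM AC mul0mx addr0 affine_ext1.
  by rewrite affine_extM CA mul0mx addr0 affine_ext1.
have pow_fix (B : 'M[R]_n) z m : z *m B = z -> z *m mxpow B m = z.
  by move=> zB; elim: m => [|m IH]; rewrite ?mulmx1 //= mulmxA zB.
have [ll|ll|/eqP] := ltrgtP lambda 1; last by rewrite (negPf l1).
  have [|k hk] := similarity_mxpow uP hO (_ : 0 < lambda < 1); first by rewrite l0.
  exists (mxpow A), (mxpow C), k, lambda; split.
  - by rewrite AE.
  - by move=> m; exact: mxpow_comm.
  - by move=> m; exact: closed_group_mxpow.
  - by move=> z zA m; exact: pow_fix.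
have [|k hk] := similarity_mxpow uP (orthogonal_tr hO) (_ : 0 < lambda^-1 < 1).
  by rewrite invr_gt0 l0 invf_lt1.
exists (mxpow C), (mxpow A), k, lambda^-1; split.
- by move: hk; rewrite trmxK invrK -AE.
- by move=> m; apply: mxpow_comm; rewrite AC CA.
- by move=> m; exact: closed_group_mxpow.
- by move=> z zA m; apply: pow_fix; rewrite -{1}zA -mulmxA AC mulmx1.
Qed.

(** The affine map with linear part A that fixes z, composed with the inverse of
    A, is the translation by z - z A, which is not 0 since A contracts or
    expands. *)
Lemma tangent_family_flow (R : realType) n T (F : set_system T)
    (Gam : set (bdry R n -> bdry R n)) (alpha : T -> bdry R n -> bdry R n)
    (P O : 'M[R]_n) (lambda : R) (A : 'M[R]_n) (p : T -> 'rV[R]_n) :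
  UltraFilter F -> closed_group Gam ->
  P \in unitmx -> orthogonal_mx O -> 0 < lambda -> lambda != 1 ->
  A = invmx P *m (lambda *: O) *m P -> A \in unitmx ->
  tangent_family F alpha A p -> p @ F --> (0 : 'rV[R]_n) ->
  (\forall t \near F, p t != 0) -> (\forall t \near F, Gam (alpha t)) ->
  Gam (affine_ext A 0) ->
  exists2 u : 'rV[R]_n, u != 0 & forall r : R, Gam (affine_ext 1%:M (r *: u)).
Proof.
move=> FU cG uP hO l0 l1 AE uA ta p0 pn0 Ga GA.
have [tG _ _] := cG; have [_ Gcomp Ginv] := tG.
have [D [E [k [mu [sp AD GD fixD]]]]] := contraction_powers uP hO l0 l1 AE tG GA.
have [z z0 Gz] := tangent_family_limit FU cG uA ta p0 pn0 Ga sp AD GD.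
apply: (@translation_flow R n Gam (z - z *m A) D E k mu) => //.
  rewrite subr_eq0; apply: contra z0 => /eqP zA.
  by apply/eqP/(similarity_fixed sp)/fixD; rewrite -zA.
have GAV : Gam (affine_ext (invmx A) 0).
  apply: Ginv GA _ _ => x.
    by rewrite affine_extM mulmxV // mul0mx addr0 affine_ext1.
  by rewrite affine_extM mulVmx // mul0mx addr0 affine_ext1.
rewrite (_ : affine_ext _ _ =
    affine_ext A (z - z *m A) \o affine_ext (invmx A) 0); first exact: Gcomp.
by apply: funext => x; rewrite /= affine_extM mulVmx // mul0mx add0r.
Qed.

Lemma conj_translation_flow (R : realType) n (Gam : set (bdry R n -> bdry R n))
    (M : 'M[R]_(n + (1 + 1))) (u : 'rV[R]_n) :
  moeb M -> u != 0 ->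
  (forall r : R, Gam (bact M \o affine_ext 1%:M (r *: u) \o bact (invmx M))) ->
  exists F : R -> bdry R n -> bdry R n,
    [/\ one_parameter_subgroup Gam F, exists t, F t <> id & conformally_affine F].
Proof.
move=> hM u0 GF; have hV := moeb_inv hM.
exists (fun r => bact M \o affine_ext 1%:M (r *: u) \o bact (invmx M)); split.
- split => //.
    move=> s t; apply: funext => x /=; rewrite bactK // affine_extM !mulmx1.
    by rewrite scalerDl addrC.
  move=> r B /uniform_nbhs [E [entE EB]].
  move: entE; rewrite -entourage_ballE => -[e /= e0 eE].
  have uc : (fun t : R => t *: u) @ nbhs r --> r *: u.
    by apply: cvgZ; [exact: cvg_id|exact: cvg_cst].
  have hc : cconv (nbhs r)
      (fun t => bact M \o affine_ext 1%:M (t *: u) \o bact (invmx M))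
      (bact M \o affine_ext 1%:M (r *: u) \o bact (invmx M)).
    apply: cconv_comp; last by apply: cconv_cst; exact: bact_continuous.
    apply: cconv_comp; first by apply: cconv_cst; exact: bact_continuous.
    by apply: cconv_transl => //; exact: unitmx1.
  have hcont : continuous
      (bact M \o affine_ext 1%:M (r *: u) \o bact (invmx M) : bdry R n -> bdry R n).
    have [_ hcomp _] := @homeos_closed R n.
    have hh : homeos (bact M \o affine_ext 1%:M (r *: u) \o bact (invmx M)).
      apply: (hcomp); last exact: homeos_bact.
      apply: (hcomp); first exact: homeos_bact.
      by apply: homeos_affine; exact: unitmx1.
    by case: hh.
  have hn : \forall t \near r, forall x, ball ((bact M \o
      affine_ext 1%:M (r *: u) \o bact (invmx M)) x) e
      ((bact M \o affine_ext 1%:M (t *: u) \o bact (invmx M)) x).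
    exact: (cconv_unif (FF := nbhs_filter r) hc hcont e0).
  apply: filterS hn => t ht; apply: EB => x _; apply: eE; exact: ht.
- exists 1 => /(congr1 (fun g => bact (invmx M) (g (bact M (Some 0))))) /=.
  by rewrite !bactK //= scale1r mul0mx add0r => -[] /eqP; rewrite (negPf u0).
- exists (bact (invmx M)), (bact M); split.
  + exists (hact (invmx M)); first exact: isometry_hact.
    exact: boundary_value_hact.
  + exact: bactKV.
  + exact: bactK.
  + move=> t; exists 1%:M, (t *: u); split; first exact: unitmx1.
    by apply: funext => x /=; rewrite !bactK.
Qed.

(** * Renormalisation by the group *)

(** Matrices act on rows, so that the first factor acts first. The scale is t + 1
    to be positive. *)
Definition renorm (R : realType) n (S : 'M[R]_(n + (1 + 1)))
    (L : nat -> 'M[R]_(n + (1 + 1))) (t : nat) : 'M[R]_(n + (1 + 1)) :=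
  dilM n (t.+1%:R)^-1 *m S *m L t.

Lemma moeb_renorm (R : realType) n (S : 'M[R]_(n + (1 + 1))) L t :
  moeb S -> moeb (L t) -> moeb (renorm S L t).
Proof.
move=> hS hL; apply: moebM => //; apply: moebM => //.
by apply: moeb_dilM; rewrite invr_gt0.
Qed.

(** By cocompactness the points (0, 1 / (t + 1)) on the ray to the fixed point
    can be brought back to a compact set. *)
Lemma renorm_bounded (R : realType) n (G : set (hyp R n -> hyp R n))
    (S : 'M[R]_(n + (1 + 1))) :
  G `<=` @Defs.isometry R n -> transf_closed G -> cocompact G -> moeb S ->
  exists L (B : R), forall t, [/\ moeb (L t), G (hact (L t))
    & `|renorm S L t| <= B].
Proof.
move=> Gi [_ _ Ginv] [K cK GK] hS.
have [c c0 hc] := compact_hyp_bounded cK.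
have [B hB] := @moeb_bounded R n c c0.
have hD (t : nat) : moeb (dilM n (t.+1%:R : R)^-1).
  by apply: moeb_dilM; rewrite invr_gt0.
have ex (t : nat) : exists L, [/\ moeb L, G (hact L) &
    K (hact L (hact S (hact (dilM n (t.+1%:R)^-1) (hbase R n))))].
  set q := hact S _; have : (\bigcup_(g in G) (g @` K)) q by rewrite GK.
  move=> [g Gg [p Kp gp]]; have [L0 hL0 gE] := isometry_moeb (Gi _ Gg).
  exists (invmx L0); split; first exact: moeb_inv.
    by apply: Ginv Gg _ _; rewrite gE; [exact: hactK|exact: hactKV].
  by rewrite -gp gE hactK.
have [L hL] := choice ex; exists L, B => t; have [h1 h2 h3] := hL t.
split => //; have hM := @moeb_renorm R n S L t hS h1.
have eM : hact (renorm S L t) (hbase R n) =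
    hact (L t) (hact S (hact (dilM n (t.+1%:R)^-1) (hbase R n))).
  by rewrite hactM ?hactM //; exact: moebM.
have [b1 b2 b3] := hc _ h3.
by apply: hB; rewrite ?eM.
Qed.

(** A fixed isometry moves the ray to the boundary, hence can be used to bring
    back only finitely many of its points. *)
Lemma renorm_distinct (R : realType) n (S : 'M[R]_(n + (1 + 1))) L (B : R)
    (K : 'M[R]_(n + (1 + 1))) :
  moeb S -> moeb K -> (forall t, moeb (L t)) ->
  (forall t, `|renorm S L t| <= B) ->
  \forall t \near \oo, hact (L t) <> hact K.
Proof.
move=> hS hK hL hB.
pose N : R := (n + (1 + 1))%:R.
pose C := N * (N * `|hyperb (hbase R n)| * B) * `|invmx (S *m K)|.
have : \forall t \near \oo, C <= t%:R :> R by exact: nbhs_infty_ger.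
apply: filterS => t Ct eqL.
have hD : moeb (dilM n (t.+1%:R : R)^-1) by apply: moeb_dilM; rewrite invr_gt0.
have hM := @moeb_renorm R n S L t hS (hL t).
have hSK : moeb (S *m K) by exact: moebM.
have e1 : hyperb (hact (dilM n (t.+1%:R)^-1) (hbase R n)) =
    hyperb (hbase R n) *m renorm S L t *m invmx (S *m K).
  rewrite -hyperb_hact // hactM ?hactM //; last exact: moebM.
  rewrite eqL -hactM // [hyperb (hact (S *m K) _)]hyperb_hact //.
  by rewrite mulmxK //; apply: lorentz_unit; case: hSK.
have : wd (hyperb (hact (dilM n (t.+1%:R)^-1) (hbase R n))) = t.+1%:R.
  by rewrite hyperb_hact // mul_dilM mkwK /hyperb /= wdZ !mkwK !invr1 !mul1r invrK.
have n0 := norm_wd (hyperb (hact (dilM n (t.+1%:R)^-1) (hbase R n))).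
move=> wdE; rewrite wdE ger0_norm // e1 in n0.
have := le_trans n0 (norm_mulmx _ _).
apply/negP; rewrite -ltNge; apply: (@le_lt_trans _ _ C).
  rewrite /C ler_wpM2r // ler_wpM2l ?ler0n //.
  by apply: le_trans (norm_mulmx _ _) _; rewrite ler_wpM2l ?mulr_ge0.
by apply: le_lt_trans Ct _; rewrite ltr_nat.
Qed.

Lemma renorm_bact (R : realType) n (S : 'M[R]_(n + (1 + 1))) L t q :
  moeb S -> bact (renorm S L t) q =
  bact (L t) (bact S (affine_ext (t.+1%:R^-1)%:M 0 q)).
Proof.
move=> hS; have hD : moeb (dilM n (t.+1%:R : R)^-1).
  by apply: moeb_dilM; rewrite invr_gt0.
by rewrite bactM ?bactM ?bact_dilM ?invr_gt0 //; exact: moebM.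
Qed.

(** Conjugating f by g_t amounts to zooming in at the fixed point. *)
Lemma renorm_conj (R : realType) n (S M0 : 'M[R]_(n + (1 + 1))) L t
    (f : bdry R n -> bdry R n) :
  moeb S -> moeb (L t) -> moeb M0 ->
  bact M0 \o (bact (renorm S L t *m invmx M0)
    \o zoom t.+1%:R (bact (invmx S) \o f \o bact S)
    \o bact (invmx (renorm S L t *m invmx M0))) \o bact (invmx M0)
  = bact (L t) \o f \o bact (invmx (L t)).
Proof.
move=> hS hL hM0; have hM := @moeb_renorm R n S L t hS hL.
have hV := moeb_inv hM0; have hN := moebM hM hV.
set M := renorm S L t in hM hN *.
apply: funext => x /=.
set y := bact (invmx M) x.
have My : bact M y = x by rewrite bactKV.
have -> : bact (invmx (M *m invmx M0)) (bact (invmx M0) x) = y.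
  by rewrite -{1}My -[bact (invmx M0) _]bactM // bactK.
rewrite bactM // (bactKV hM0) /zoom /=.
have e1 : bact S (affine_ext (t.+1%:R^-1)%:M 0 y) = bact (invmx (L t)) x.
  by rewrite -My renorm_bact // bactK.
rewrite e1 renorm_bact // affine_extM mul0mx addr0 -scalar_mxM mulfV //.
by rewrite affine_ext1 bactKV.
Qed.

(** The group Gam' is the closed group seen through M0, the limit of the
    renormalised maps; alpha t and p t are the conjugate of f by the t-th element
    of G and its fixed point, seen in the same way. *)
Lemma boundary_flow (R : realType) n
  (G : set (hyp R n -> hyp R n))
  (hG : kleinian G) (hGc : cocompact G)
  (f : bdry R n -> bdry R n) (hf : diffeo 2 f)
  (x0 : bdry R n) (hx0 : f x0 = x0)
  (hGx0 : forall (g : hyp R n -> hyp R n) (gamma : bdry R n -> bdry R n),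
      G g -> boundary_value g gamma -> gamma x0 = x0 -> g = id)
  (P O : 'M[R]_n) (lambda : R)
  (hP : P \in unitmx) (hO : orthogonal_mx O)
  (hlambda : 0 < lambda) (hlambda1 : lambda != 1)
  (hDf : fixpt_diff f x0 = invmx P *m (lambda *: O) *m P) :
  exists2 M : 'M[R]_(n + (1 + 1)), moeb M &
  exists2 u : 'rV[R]_n, u != 0 & forall r : R,
    closure_in_homeos (generated (boundary_action G `|` [set f]))
      (bact M \o affine_ext 1%:M (r *: u) \o bact (invmx M)).
Proof.
have [Gi tG _] := hG; have [_ Gcomp Ginv] := tG.
set A := invmx P *m (lambda *: O) *m P in hDf *.
have uA : A \in unitmx.
  have [uO _] := mulmx1_unit hO.
  rewrite !unitmx_mul unitmx_inv hP andbT /= unitmxZ ?uO //.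
  by rewrite unitfE gt_eqF.
have [S hS [S0 tf]] := diffeo_tangent hf hx0 hDf uA.
set ft := bact (invmx S) \o f \o bact S in tf.
have [L [B hL]] := renorm_bounded Gi tG hGc hS.
have hLm t : moeb (L t) by have [] := hL t.
have GL t : G (hact (L t)) by have [] := hL t.
have MB t : `|renorm S L t| <= B by have [] := hL t.
pose s (t : nat) : R := t.+1%:R.
pose M t := renorm S L t.
have hM t : moeb (M t) by apply: moeb_renorm.
have Foo : ProperFilter (\oo : set_system nat) by exact: _.
have [U [UU oU]] := ultraFilterLemma Foo.
have FU : ProperFilter U by apply: ultra_proper.
have FF : Filter U by exact: _.
have [M0 MM0] : exists M0 : 'M[R]_(n + (1 + 1)), M @ U --> M0.
  by apply: (@ultra_bounded_mx _ _ _ _ _ _ B UU); apply: filterS filterT => t _.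
have hM0 : moeb M0 by exact: moeb_lim hM MM0.
have hV := moeb_inv hM0.
have uM0 : M0 \in unitmx by apply: lorentz_unit; case: hM0.
pose Nt t := M t *m invmx M0.
have hN t : moeb (Nt t) by apply: moebM.
have N1 : Nt @ U --> (1%:M : 'M[R]_(n + (1 + 1))).
  by rewrite -(mulmxV uM0); apply: cvg_mulmx => //; exact: cvg_cst.
have I1 : (fun t => invmx (Nt t)) @ U --> (1%:M : 'M[R]_(n + (1 + 1))).
  rewrite -[1%:M]invmx1; apply: cvg_invmx_lorentz => //.
    by move=> t; case: (hN t).
  by case: (@moeb1 R n).
have sU : s @ U --> +oo.
  apply/cvgryPge => a; apply: oU.
  have : \forall t \near \oo, a <= t%:R :> R by exact: nbhs_infty_ger.
  by apply: filterS => t at_; apply: le_trans at_ _; rewrite ler_nat.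
(* The group generated by f and the maps bact K consists of homeomorphisms, and
   its closure is contained in the given one. *)
pose X : set (bdry R n -> bdry R n) :=
  [set h | exists2 K : 'M[R]_(n + (1 + 1)), moeb K /\ G (hact K) & h = bact K]
  `|` [set f].
have hfh := homeos_diffeo hf.
have Xh : X `<=` @homeos R n.
  by move=> h [[K [hK _] ->]|->] //; exact: homeos_bact.
have XX : X `<=` boundary_action G `|` [set f].
  move=> h [[K [hK GK] ->]|->]; last by right.
  by left; exists (hact K) => //; exact: boundary_value_hact.
have cG := closed_group_closure Xh.
set Gam := closure_in_homeos (generated X) in cG.
have [[_ Gamcomp Gaminv] _ _] := cG.
have Gf : Gam f by apply: sub_closure_homeos => //; right.
have GamL K : moeb K -> G (hact K) -> Gam (bact K).
  by move=> hK GK; apply: sub_closure_homeos; [exact: homeos_bact|left; exists K].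
pose Gam' := [set h : bdry R n -> bdry R n |
  Gam (bact M0 \o h \o bact (invmx M0))].
have cG' : closed_group Gam'.
  exact: closed_group_conj cG (homeos_bact hM0) (bactK hM0) (bactKV hM0).
pose alpha t := bact (Nt t) \o zoom (s t) ft \o bact (invmx (Nt t)).
have Ga t : Gam' (alpha t).
  rewrite /Gam' /= /alpha /Nt /M /s /ft renorm_conj //.
  have GLt := GamL _ (hLm t) (GL t).
  apply: (Gamcomp); first exact: Gamcomp.
  by apply: Gaminv GLt _ _; [exact: bactK|exact: bactKV].
pose p t := chart true (bact (Nt t) (Some 0)).
have hp : \forall t \near U, bact (Nt t) (Some 0) = Some (p t).
  have := @moeb_near1 R n nat U FF Nt 1 N1 ltr01.
  by apply: filterS => t [q [qE _ _]]; rewrite /p qE.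
have p0 : p @ U --> (0 : 'rV[R]_n).
  apply/cvgr0Pnorm_le => e e0.
  have := @moeb_near1 R n nat U FF Nt e N1 e0.
  by apply: filterS => t [q [qE qe _]]; rewrite /p qE.
(* If p t = 0 then g_t sends x0 to the limit point bact M0 (Some 0). Since x0
   has a trivial stabiliser, this determines g_t, which can happen only for
   finitely many t. *)
have pn0 : \forall t \near U, p t != 0.
  have [//|UN] := in_ultra_setVsetC [set t | p t != 0] UU.
  have Lx : \forall t \near U, bact (L t) x0 = bact M0 (Some 0).
    apply: filterS (filterI hp UN) => t [pE /negP]; rewrite negbK => /eqP pt0.
    move: pE; rewrite pt0 /Nt bactM // => /(congr1 (bact M0)).
    by rewrite bactKV // /M renorm_bact //= mul0mx addr0 S0.
  have [t1 Lx1] := filter_ex Lx.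
  have := oU _ (renorm_distinct hS (hLm t1) hLm MB) => dist.
  have [t [Lxt]] := filter_ex (filterI Lx dist).
  case; have hLV := moeb_inv (hLm t1).
  have hK := moebM (hLm t) hLV.
  have Kid : hact (L t *m invmx (L t1)) = id.
    apply: (hGx0 _ (bact (L t *m invmx (L t1)))).
    - rewrite (_ : hact _ = hact (invmx (L t1)) \o hact (L t)).
        by apply: Gcomp => //; apply: Ginv (GL t1) _ _; [exact: hactK|exact: hactKV].
      by apply: funext => q; rewrite /= hactM.
    - exact: boundary_value_hact.
    - by rewrite bactM // Lxt -Lx1 bactK.
  apply: funext => q; rewrite -[LHS](hactKV (hLm t1)) -[hact (invmx _) _]hactM //.
  by rewrite Kid.
have ta : tangent_family U alpha A p by exact: tangent_family_conj.
have GA : Gam' (affine_ext A 0).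
  apply: (@closed_group_cconv R n Gam' nat U FU alpha _ cG').
  - exact: homeos_affine.
  - have -> : affine_ext A 0 = @bact R n 1%:M \o affine_ext A 0 \o @bact R n 1%:M.
      by apply: funext => q; rewrite /= !bact1.
    apply: cconv_comp; last first.
      by apply: cconv_bact => //; [move=> t; exact: moeb_inv|exact: moeb1].
    apply: cconv_comp; first by apply: cconv_bact => //; exact: moeb1.
    exact: cconv_zoom.
  - by apply: filterS filterT => t _; exact: Ga.
have [u u0 hu] : exists2 u : 'rV[R]_n, u != 0 &
    forall r : R, Gam' (affine_ext 1%:M (r *: u)).
  apply: (@tangent_family_flow R n nat U Gam' alpha P O lambda A p) => //.
  by apply: filterS filterT => t _; exact: Ga.
exists M0 => //; exists u => // r.
exact: closure_homeos_sub XX _ (hu r).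
Qed.

Theorem theorem1p2 (R : realType) (N : nat) (hN : (3 <= N)%N)
  (G : set (hyp R N.-1 -> hyp R N.-1))
  (hG : kleinian G) (hGc : cocompact G)
  (f : bdry R N.-1 -> bdry R N.-1) (hf : diffeo 2 f)
  (x0 : bdry R N.-1) (hx0 : f x0 = x0)
  (hGx0 : forall (g : hyp R N.-1 -> hyp R N.-1)
                 (gamma : bdry R N.-1 -> bdry R N.-1),
      G g -> boundary_value g gamma -> gamma x0 = x0 -> g = id)
  (P O : 'M[R]_(N.-1)) (lambda : R)
  (hP : P \in unitmx) (hO : orthogonal_mx O)
  (hlambda : 0 < lambda) (hlambda1 : lambda != 1)
  (hDf : fixpt_diff f x0 = invmx P *m (lambda *: O) *m P) :
  exists F : R -> bdry R N.-1 -> bdry R N.-1,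
    [/\ one_parameter_subgroup
          (closure_in_homeos (generated (boundary_action G `|` [set f]))) F,
        exists t, F t <> id
      & conformally_affine F].
Proof.
have [M hM [u u0 hu]] :=
  boundary_flow hG hGc hf hx0 hGx0 hP hO hlambda hlambda1 hDf.
exact: conj_translation_flow hM u0 hu.
Qed.
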